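(* There is a polynomial-time algorithm that, given a pair $(G,M)$ where $G$ is a bipartite graph and $M$ is a maximum matching in $G$, decides whether $\mathrm{diss}(G)=\frac{4}{3}\alpha(G-M)$. Moreover, whenever this equality holds, a maximum dissociation set of $G$ can be computed in polynomial time.
   Context: All graphs are finite, simple and undirected. A set $I$ of vertices of a graph $G$ is a dissociation set if the induced subgraph $G[I]$ has maximum degree at most $1$; $\mathrm{diss}(G)$ is the maximum order of a dissociation set in $G$. $\alpha(H)$ denotes the independence number of $H$. For a set $M$ of edges, $G-M$ is the graph on $V(G)$ with edge set $E(G)\setminus M$. For every bipartite $G$ and maximum matching $M$ one has $\mathrm{diss}(G)\le\frac{4}{3}\alpha(G-M)$. *)

(* Defs.v *)
From mathcomp Require Import all_boot.
Set Implicit Arguments. Unset Strict Implicit. Unset Printing Implicit Defensive.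

Section Graphs.
Variable T : finType.

Definition simple_graph (e : rel T) : Prop :=
  (forall x y, e x y = e y x) /\ (forall x, e x x = false).

Definition bipartite (e : rel T) : Prop :=
  exists side : T -> bool, forall x y, e x y -> side x != side y.

Definition edge_minus (e m : rel T) : rel T := fun x y => e x y && ~~ m x y.

Definition is_matching (e m : rel T) : Prop :=
  (forall x y, m x y = m y x) /\ (forall x y, m x y -> e x y) /\
  (forall x, #|[set y | m x y]| <= 1).

(* number of ordered pairs (x,y) with xy in M, i.e. twice the number of edges *)
Definition npairs (m : rel T) : nat := #|[set p : T * T | m p.1 p.2]|.

Definition max_matching (e m : rel T) : Prop :=
  is_matching e m /\ forall m', is_matching e m' -> npairs m' <= npairs m.

Definition dissociation (e : rel T) (I : {set T}) : bool :=
  [forall x in I, #|[set y in I | e x y]| <= 1].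

Definition independent (e : rel T) (I : {set T}) : bool :=
  [forall x in I, forall y in I, ~~ e x y].

Definition diss (e : rel T) : nat := \max_(I : {set T} | dissociation e I) #|I|.
Definition alpha (e : rel T) : nat := \max_(I : {set T} | independent e I) #|I|.

Definition max_dissociation_set (e : rel T) (I : {set T}) : Prop :=
  dissociation e I /\ #|I| = diss e.
End Graphs.

(* Symbols of a machine with parameter s are 'I_s.+3:
   0 = blank, 1 = bit false, 2 = bit true, others are work symbols.
   States are 'I_q.+1, start state 0. The machine halts when delta = None. *)
Inductive move := MoveL | MoveR | Stay.

Record TM := { tm_q : nat; tm_s : nat;
  tm_delta : 'I_tm_q.+1 -> 'I_tm_s.+3 -> option ('I_tm_q.+1 * 'I_tm_s.+3 * move) }.

Section TMsem.
Variable M : TM.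
Notation St := ('I_(tm_q M).+1).
Notation Sy := ('I_(tm_s M).+3).

(* configuration: state, tape left of head (nearest first), head symbol,
   tape right of head (nearest first); unlisted cells are blank. *)
Record config := Config { c_state : St; c_left : seq Sy; c_head : Sy; c_right : seq Sy }.

Definition blank : Sy := ord0.
Definition bit_sym (b : bool) : Sy := if b then inord 2 else inord 1.

Definition step (c : config) : option config :=
  match tm_delta (c_state c) (c_head c) with
  | None => None
  | Some (q', a, d) =>
    Some match d with
    | Stay => Config q' (c_left c) a (c_right c)
    | MoveL => match c_left c with
               | [::] => Config q' [::] blank (a :: c_right c)
               | x :: l => Config q' l x (a :: c_right c)
               end
    | MoveR => match c_right c with
               | [::] => Config q' (a :: c_left c) blank [::]
               | x :: r => Config q' (a :: c_left c) x r
               end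
    end
  end.

Fixpoint run (k : nat) (c : config) : option config :=
  match step c with
  | None => Some c
  | Some c' => if k is k'.+1 then run k' c' else None
  end.

Definition init (w : seq bool) : config :=
  match map bit_sym w with
  | [::] => Config ord0 [::] blank [::]
  | x :: r => Config ord0 [::] x r
  end.

Definition is_bit (a : Sy) : bool := (val a == 1) || (val a == 2).
Definition output (c : config) : seq bool :=
  let t := c_head c :: c_right c in
  [seq val a == 2 | a <- take (find (predC is_bit) t) t].

Definition computes_within (w : seq bool) (k : nat) (o : seq bool) : Prop :=
  exists c, run k (init w) = Some c /\ output c = o.
End TMsem.

Definition enc (n : nat) (e m : rel 'I_n) : seq bool :=
  nseq n true ++ [:: false] ++
  [seq e i j | i <- enum 'I_n, j <- enum 'I_n] ++
  [seq m i j | i <- enum 'I_n, j <- enum 'I_n].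

Definition valid_input (n : nat) (e m : rel 'I_n) : Prop :=
  simple_graph e /\ bipartite e /\ max_matching e m.

Definition enc_set (n : nat) (I : {set 'I_n}) : seq bool := [seq i \in I | i <- enum 'I_n].

(* Main.v *)
(* Let C be the complement of a dissociation set D, H = G - M, and let N be a maximum
   matching of the bipartite double cover of H, i.e. a partial injection of V along
   edges of H.  Counting gives 3|D| + |isolated vertices of G[D]| <= 4 alpha(H), and
   equality forces |N| = 2|M| and a rigid pattern: every vertex of C is matched by M and
   both ways by N into D, and along any M-edge uv followed by an N-edge vw exactly one of
   u, v, w lies in C; every other edge of G meets C.  Conversely this pattern gives
   equality.  Fixing one vertex of C fixes C on the whole component of M and N, so the
   pattern is a 2-SAT-like problem: a set of consequences of one choice that contains no
   conflict never conflicts with earlier, closed choices, so choosing greedily works.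

   N is found by an auction: prices yield the complementary vertex cover through an
   unused price level, which at the same time proves Koenig's theorem.

   The algorithms are written in a language of for-loops over vertices acting on binary
   relations, in which every program runs in polynomial time.  A store is a tape whose
   cells are the pairs (i, j); each elementary command is one left-to-right pass of a
   finite-state transducer, and such passes are executed by a Turing machine. *)
From HB Require Import structures.
From Stdlib Require Import FunctionalExtensionality.
Require Import Defs.
From mathcomp Require Import all_boot zify.
Set Implicit Arguments. Unset Strict Implicit. Unset Printing Implicit Defensive.

(** * Turing machines sweeping over their tape *)

(** The double cover is used because the input carries no bipartition: the rows and the columns of
    the matrix of H are two copies of V, so N can be found without knowing the sides, and Koenig's
    theorem takes the form 2 alpha(H) + |N| = 2|V|. The bipartition of G enters only the proofs.

    The constant 4/3 comes from adding two lower bounds. Let A be the vertices of D matched by M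
    inside D, and B those on other edges inside D. Keeping one end of every edge inside B, chosen by
    side, gives alpha(H) >= |D| - |B|/2 on average over the sides. Koenig's theorem in G, with M
    counted on D and on C, gives alpha(H) >= |D| - |A|/2. As A and B are disjoint, the sum is at
    least 3|D|/2, and in the equality case both bounds are tight at once.

    The exactly-one triples are not 2-clauses, but two triples with two common vertices make the
    third ones equivalent. This carries information along alternating paths, and it makes one hit
    triple in a component enough for all of them.

    The loop language has no numbers. Prices are therefore unary relations, and |M| is compared with
    |N| by a second auction that tries to inject one set into the other. *)

Section Scan.
Variables (Mem G : Type).

Fixpoint scan (f : Mem -> G -> Mem * G) (m : Mem) (w : seq G) : Mem * seq G :=
  if w is a :: w' then
    let: (m1, a1) := f m a in let: (m2, w2) := scan f m1 w' in (m2, a1 :: w2)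
  else (m, [::]).

Lemma size_scan f m w : size (scan f m w).2 = size w.
Proof.
elim: w m => //= a w IH m; case: (f m a) => m1 a1.
by have := IH m1; case: (scan f m1 w) => m2 w2 /= ->.
Qed.

Lemma scan_cat f m w1 w2 : scan f m (w1 ++ w2) =
  let: (m1, v1) := scan f m w1 in let: (m2, v2) := scan f m1 w2 in (m2, v1 ++ v2).
Proof.
elim: w1 m => [|a w1 IH] m /=; first by case: (scan f m w2).
case: (f m a) => m1 a1; rewrite IH.
by case: (scan f m1 w1) => m2 v1; case: (scan f m2 w2).
Qed.
End Scan.

Section Sweep.
Variables (Mem A : finType).
Notation G := (bool + A)%type.

(* A node [s] reads the whole tape from left to right, starting in memory
   [pr_init s] and rewriting each cell by the Mealy machine [pr_fun s]; the final
   memory selects the next node, or the exit ([None]). *)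
Record prog := Prog {
  pr_node : finType;
  pr_ent : pr_node;
  pr_init : pr_node -> Mem;
  pr_fun : pr_node -> Mem -> G -> Mem * G;
  pr_next : pr_node -> Mem -> option pr_node }.

(** The index counts sweeps. A sweep preserves the length of the word, so each one costs at most
    [2 * size w + 3] machine steps. *)
Inductive exits (P : prog) : nat -> pr_node P -> seq G -> seq G -> Prop :=
| exits_now s w m w' : scan (@pr_fun P s) (pr_init s) w = (m, w') ->
    pr_next s m = None -> exits 1 s w w'
| exits_step k s s' w m w' w'' : scan (@pr_fun P s) (pr_init s) w = (m, w') ->
    pr_next s m = Some s' -> exits k s' w' w'' -> exits k.+1 s w w''.

Definition runs (P : prog) k w w' := exits k (pr_ent P) w w'.

(** * Simulation of sweeps by a one-tape Turing machine *)

Section Compile.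
Variables (P : prog) (stop : G -> bool).
Notation S := (pr_node P).
(* sweeping in node s with memory m | rewinding before node s | final rewind | halted *)
Definition tst : finType := (S * Mem + option (option S))%type.
Definition q_start : tst := inl (pr_ent P, pr_init (pr_ent P)).

(** Sweeps never write the blank [None], so the first blank on either side marks the end of the
    word. The final rewind halts just to the right of the nearest [stop] cell, because the output is
    read from the head rightwards. *)
Definition tdelta (q : tst) (a : option G) : option (tst * option G * move) :=
  match q, a with
  | inl (s, m), Some a =>
      let: (m', a') := pr_fun s m a in Some (inl (s, m'), Some a', MoveR)
  | inl (s, m), None =>
      Some (inr (Some (pr_next s m)), None, MoveL)
  | inr (Some (Some s)), Some a => Some (inr (Some (Some s)), Some a, MoveL)
  | inr (Some (Some s)), None => Some (inl (s, pr_init s), None, MoveR)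
  | inr (Some None), Some a =>
      if stop a then Some (inr None, Some a, MoveR) else Some (inr (Some None), Some a, MoveL)
  | inr (Some None), None => Some (inr None, None, MoveR)
  | inr None, _ => None
  end.

Definition enc_sym (a : option G) : 'I_#|A|.+3 :=
  match a with
  | None => ord0
  | Some (inl b) => if b then inord 2 else inord 1
  | Some (inr x) => inord (enum_rank x).+3
  end.

Definition dec_sym (a : 'I_#|A|.+3) : option G :=
  match val a with
  | 0 => None
  | 1 => Some (inl false)
  | 2 => Some (inl true)
  | k.+3 => omap (fun i => inr (enum_val i)) (insub k : option 'I_#|A|)
  end.

Lemma val_enc_sym a : val (enc_sym a) =
  match a with
  | None => 0 | Some (inl b) => b.+1 | Some (inr x) => (enum_rank x).+3
  end.
Proof.
case: a => [[[]|x]|] //=; rewrite inordK //.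
by rewrite !ltnS; exact: ltn_ord.
Qed.

Lemma enc_symK : cancel enc_sym dec_sym.
Proof.
move=> a; rewrite /dec_sym val_enc_sym; case: a => [[[]|x]|] //=.
by rewrite valK /= enum_rankK.
Qed.

(** Number 0 is reserved for the start state, as [init] requires; all other states are shifted by
    one. *)
Definition enc_st (q : tst) : 'I_#|tst|.+1 :=
  if q == q_start then ord0 else inord (enum_rank q).+1.

Definition dec_st (s : 'I_#|tst|.+1) : tst :=
  if val s is k.+1 then
    if (insub k : option 'I_#|tst|) is Some i then enum_val i else q_start
  else q_start.

Lemma enc_stK : cancel enc_st dec_st.
Proof.
move=> q; rewrite /dec_st /enc_st; case: eqP => [->//|_].
rewrite /= inordK ?valK ?enum_rankK //.
by rewrite !ltnS; exact: ltn_ord.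
Qed.

Definition TM_of : TM :=
  @Build_TM #|tst| #|A| (fun s a =>
    omap (fun x => (enc_st x.1.1, enc_sym x.1.2, x.2)) (tdelta (dec_st s) (dec_sym a))).

(* The head scans the first symbol of [t]; [l] is the tape to its left, nearest first. *)
Definition cfg (q : tst) (l t : seq (option G)) : config TM_of :=
  @Config TM_of (enc_st q) (map enc_sym l) (enc_sym (head None t)) (map enc_sym (behead t)).

Lemma step_cfg q l t : step (cfg q l t) =
  if tdelta q (head None t) is Some (q', a, d) then
    Some match d with
    | Stay => cfg q' l (a :: behead t)
    | MoveL => cfg q' (behead l) (head None l :: a :: behead t)
    | MoveR => cfg q' (a :: l) (behead t)
    end
  else None.
Proof.
rewrite /step /= enc_stK enc_symK; case: (tdelta _ _) => //= -[[q' a] d] /=.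
by case: d => //; [case: l | case: t => [|x [|y t]]].
Qed.

Fixpoint nsteps k (c : config TM_of) : option (config TM_of) :=
  if k is k'.+1 then obind (nsteps k') (step c) else Some c.

Lemma nsteps_add i j c c1 : nsteps i c = Some c1 -> nsteps (i + j) c = nsteps j c1.
Proof. by elim: i c => [|i IH] c /=; [case=> -> | case: (step c)]. Qed.

Lemma nsteps_run k K c c' : nsteps k c = Some c' -> step c' = None -> k <= K ->
  run K c = Some c'.
Proof.
elim: k K c => [|k IH] [|K] c //=; try by case=> -> ->.
by case: (step c) => //= d /IH; apply.
Qed.

Lemma sweep_right s m l w z : nsteps (size w) (cfg (inl (s, m)) l (map Some w ++ z)) =
  Some (cfg (inl (s, (scan (@pr_fun P s) m w).1))
            (rev (map Some (scan (@pr_fun P s) m w).2) ++ l) z).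
Proof.
elim: w m l => [|a w IH] m l //=.
rewrite step_cfg /=; case: (pr_fun s m a) => m1 a1 /=; rewrite IH.
by case: (scan _ m1 w) => m2 w2 /=; rewrite rev_cons cat_rcons.
Qed.

Lemma sweep_left q u l a t :
  {in a :: u, forall b, tdelta q (Some b) = Some (q, Some b, MoveL)} ->
  nsteps (size u).+1 (cfg q (map Some u ++ l) (Some a :: t)) =
  Some (cfg q (behead l) (head None l :: map Some (rev u) ++ Some a :: t)).
Proof.
elim: u a t => [|b u IH] a t hq; rewrite [nsteps _ _]/= step_cfg hq ?mem_head //.
rewrite [obind _ _]IH ?rev_cons ?map_rcons ?cat_rcons // => x xu.
by apply: hq; rewrite inE xu orbT.
Qed.

(** Once the head has stepped beyond an end, that side of the tape lists one explicit blank, which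
    the initial configuration does not. *)
Definition end_blank (l : seq (option G)) := l = [::] \/ l = [:: None].

Lemma sweep_next s s' w m w' l z : w <> [::] -> end_blank l -> end_blank z ->
  scan (@pr_fun P s) (pr_init s) w = (m, w') -> pr_next s m = Some s' ->
  nsteps (2 * size w + 2) (cfg (inl (s, pr_init s)) l (map Some w ++ z)) =
  Some (cfg (inl (s', pr_init s')) [:: None] (map Some w' ++ [:: None])).
Proof.
move=> wn0 hl hz hs hn.
have sw : size w' = size w by rewrite -[w'](congr1 snd hs) size_scan.
have -> : 2 * size w + 2 = size w + (1 + (size w + 1)) by lia.
rewrite (nsteps_add _ (sweep_right _ _ _ _ _)) hs [(_, _).1]/= [(_, _).2]/=.
have h : nsteps 1 (cfg (inl (s, m)) (rev (map Some w') ++ l) z) =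
  Some (cfg (inr (Some (Some s'))) (behead (rev (map Some w') ++ l))
            (head None (rev (map Some w') ++ l) :: [:: None])).
  by rewrite /= step_cfg; case: hz => -> /=; rewrite hn.
rewrite (nsteps_add _ h) -map_rev {h}.
case: (lastP w') sw => [/=|u a]; first by case: w wn0 {hs}.
rewrite size_rcons rev_rcons => <-; rewrite [map Some (a :: _)]/= [head _ _]/= [behead _]/=.
have h := @sweep_left (inr (Some (Some s'))) (rev u) l a [:: None]; rewrite size_rev in h.
rewrite (nsteps_add _ (h _)) // revK /= step_cfg.
have -> : head None l = None by case: hl => ->.
rewrite /=; congr (Some (cfg _ _ _)); first by case: hl => ->.
by rewrite map_rcons cat_rcons.
Qed.

(** What the rewind needs in order to stop at the border of [w1]: a stopping letter there, or else
    the blank before the tape. *)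
Definition cut_at (w1 : seq G) := if rev w1 is x :: _ then stop x else true.

Lemma sweep_halt s w m w1 w2 l z : w <> [::] -> end_blank l -> end_blank z ->
  scan (@pr_fun P s) (pr_init s) w = (m, w1 ++ w2) -> pr_next s m = None ->
  all (predC stop) w2 -> cut_at w1 ->
  exists2 k, k <= 2 * size w + 3 & exists l',
  nsteps k (cfg (inl (s, pr_init s)) l (map Some w ++ z)) =
  Some (cfg (inr None) l' (map Some w2 ++ [:: None])).
Proof.
move=> wn0 hl hz hs hn /allP ns hc.
have sw : size (w1 ++ w2) = size w by rewrite -(congr1 snd hs : _ = w1 ++ w2) size_scan.
have h1 : nsteps (size w + 1) (cfg (inl (s, pr_init s)) l (map Some w ++ z)) =
    Some (cfg (inr (Some None)) (behead (rev (map Some (w1 ++ w2)) ++ l))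
              (head None (rev (map Some (w1 ++ w2)) ++ l) :: [:: None])).
  rewrite (nsteps_add _ (sweep_right _ _ _ _ _)) hs /= step_cfg.
  by case: hz => -> /=; rewrite hn.
have h2 t : exists l', nsteps 1 (cfg (inr (Some None)) (behead (rev (map Some w1) ++ l))
      (head None (rev (map Some w1) ++ l) :: t)) = Some (cfg (inr None) l' t).
  rewrite -map_rev /= step_cfg; move: hc; rewrite /cut_at.
  case: (rev w1) => [_|x v /= ->]; last by eexists.
  by case: hl => -> /=; eexists.
case: (lastP w2) ns sw h1 => [_|u a ns] sw.
  rewrite cats0 => h1; have [l' h] := h2 [:: None]; exists (size w + 2); first by lia.
  by exists l'; rewrite (_ : _ + 2 = (size w + 1) + 1) ?(nsteps_add _ h1) //; lia.
rewrite map_cat rev_cat -[in rev (map Some (rcons u a))]map_rev rev_rcons /= -catA => h1.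
have [l' h] := h2 (map Some (rcons u a) ++ [:: None]).
exists (size w + 1 + ((size (rev u)).+1 + 1)).
  by move: sw; rewrite size_cat size_rcons size_rev; lia.
exists l'; rewrite (nsteps_add _ h1) (nsteps_add _ (sweep_left _ _ _)) => [|b hb].
  by rewrite revK -h map_rcons cat_rcons.
rewrite /= ifN //; apply: ns; move: hb.
by rewrite mem_rcons !inE mem_rev.
Qed.

Lemma exits_nsteps k s w w1 w2 l z : w <> [::] -> end_blank l -> end_blank z ->
  exits k s w (w1 ++ w2) -> all (predC stop) w2 -> cut_at w1 ->
  exists2 j, j <= k * (2 * size w + 3) & exists l',
  nsteps j (cfg (inl (s, pr_init s)) l (map Some w ++ z)) =
  Some (cfg (inr None) l' (map Some w2 ++ [:: None])).
Proof.
move=> wn0 hl hz ex ns hc; move e: (w1 ++ w2) ex => w' ex.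
elim: ex l z wn0 hl hz e => {k s w w'}.
  move=> s w m w' hs hn l z wn0 hl hz e; rewrite -e in hs.
  by have [k kl h] := sweep_halt wn0 hl hz hs hn ns hc; exists k; rewrite ?mul1n.
move=> k s s' w m w' w'' hs hn _ IH l z wn0 hl hz e.
have sw : size w' = size w by rewrite -[w'](congr1 snd hs) size_scan.
have wn0' : w' <> [::] by move=> ew; rewrite ew in sw; case: w wn0 sw {hs}.
have [j jl [l' h]] := IH [:: None] [:: None] wn0' (or_intror erefl) (or_intror erefl) e.
exists (2 * size w + 2 + j); first by rewrite mulSn; rewrite sw in jl; lia.
by exists l'; rewrite (nsteps_add _ (sweep_next wn0 hl hz hs hn)).
Qed.

Definition no_bit (w : seq G) := if w is inl _ :: _ then false else true.

Lemma output_cfg l bs w : no_bit w ->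
  output (cfg (inr None) l (map Some (map inl bs ++ w) ++ [:: None])) = bs.
Proof.
move=> hw; rewrite /output.
set t := (c_head _ :: _).
have {t}-> : t = map (enc_sym : _ -> 'I_(tm_s TM_of).+3) (map Some (map inl bs ++ w) ++ [:: None]).
  by rewrite /t /=; case: (map Some _).
rewrite find_map (@eq_find _ _ (fun a => if a is Some (inl _) then false else true)); last first.
  by move=> a; rewrite /= /is_bit val_enc_sym; case: a => [[[]|x]|].
rewrite -map_take -map_comp (@eq_map _ _ _ (fun a => a == Some (inl true))); last first.
  by move=> a; rewrite [LHS](congr1 (eq_op^~ 2) (val_enc_sym a)); case: a => [[[]|x]|].
elim: bs => [|b bs IH]; last by rewrite /= IH; case: b.
by case: w hw => [|[b|a] w].
Qed.

Theorem runs_computes k bits w1 bs w2 : bits <> [::] ->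
  runs P k (map inl bits) (w1 ++ map inl bs ++ w2) ->
  all (predC stop) (map inl bs ++ w2) -> cut_at w1 -> no_bit w2 ->
  forall K, k * (2 * size bits + 3) <= K -> computes_within TM_of bits K bs.
Proof.
move=> bn0 hr ns hc hw K hK.
have wn0 : map inl bits <> [::] :> seq G by case: bits bn0 {hr hK}.
have [j jl [l' h]] := exits_nsteps wn0 (or_introl erefl) (or_introl erefl) hr ns hc.
rewrite size_map in jl.
have ei : init TM_of bits =
    cfg (inl (pr_ent P, pr_init (pr_ent P))) [::] (map Some (map inl bits) ++ [::]).
  have est : enc_st (inl (pr_ent P, pr_init (pr_ent P))) = ord0.
    by rewrite /enc_st eqxx.
  rewrite cats0 /cfg est /init; case: bits {hr h jl hK bn0 wn0} => //= b bits.
  by rewrite -!map_comp; congr Config.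
exists (cfg (inr None) l' (map Some (map inl bs ++ w2) ++ [:: None])).
split; last exact: output_cfg.
by rewrite ei; apply: nsteps_run h _ (leq_trans jl hK); rewrite step_cfg.
Qed.
End Compile.

(** * Sequences, branches and loops of sweep programs *)

Section Combinators.
Implicit Types (f : Mem -> G -> Mem * G) (t : Mem -> bool).

Definition sweep_prog i f : prog :=
  @Prog unit tt (fun _ => i) (fun _ => f) (fun _ _ => None).

Definition seq_prog (P Q : prog) : prog :=
  @Prog (pr_node P + pr_node Q)%type (inl (pr_ent P))
    (fun s => match s with inl s => pr_init s | inr s => pr_init s end)
    (fun s => match s with inl s => @pr_fun P s | inr s => @pr_fun Q s end)
    (fun s m => match s with
     | inl s => Some (if pr_next s m is Some s' then inl s' else inr (pr_ent Q))
     | inr s => omap inr (pr_next s m) end).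

Definition if_prog i f t (P Q : prog) : prog :=
  @Prog (option (pr_node P + pr_node Q))%type None
    (fun s => match s with
       None => i | Some (inl s) => pr_init s | Some (inr s) => pr_init s end)
    (fun s => match s with
       None => f | Some (inl s) => @pr_fun P s | Some (inr s) => @pr_fun Q s end)
    (fun s m => match s with
     | None => Some (Some (if t m then inl (pr_ent P) else inr (pr_ent Q)))
     | Some (inl s) => omap (fun s => Some (inl s)) (pr_next s m)
     | Some (inr s) => omap (fun s => Some (inr s)) (pr_next s m) end).

Definition while_prog i f t (P : prog) : prog :=
  @Prog (option (pr_node P)) None
    (fun s => if s is Some s then pr_init s else i)
    (fun s => if s is Some s then @pr_fun P s else f)
    (fun s m => match s with
     | None => if t m then Some (Some (pr_ent P)) else None
     | Some s => Some (pr_next s m) end).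

Lemma runs_sweep i f m w w' : scan f i w = (m, w') -> runs (sweep_prog i f) 1 w w'.
Proof. by move=> h; apply: (@exits_now (sweep_prog i f) _ _ _ _ h _). Qed.

Lemma runs_seq P Q j k w w1 w2 :
  runs P j w w1 -> runs Q k w1 w2 -> runs (seq_prog P Q) (j + k) w w2.
Proof.
move=> hP hQ.
have hQ' : @exits (seq_prog P Q) k (inr (pr_ent Q)) w1 w2.
  elim: hQ => [s w0 m w' hs hn|j0 s s' w0 m w' w'' hs hn _ IH].
    by eapply exits_now; [exact: hs | rewrite /= hn].
  by eapply exits_step; [exact: hs | rewrite /= hn | exact: IH].
rewrite /runs [pr_ent (seq_prog P Q)]/=; move: hP; rewrite /runs; move: (pr_ent P) => s hP.
elim: hP hQ' {hQ} => {j w w1}[s' w m w' hs hn|j s' s'' w m w' w'' hs hn _ IH] hQ'.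
  by eapply exits_step; [exact: hs | rewrite /= hn | exact: hQ'].
by eapply exits_step; [exact: hs | rewrite /= hn | exact: IH hQ'].
Qed.

Lemma runs_if i f t P Q k w m w1 w2 : scan f i w = (m, w1) ->
  runs (if t m then P else Q) k w1 w2 -> runs (if_prog i f t P Q) k.+1 w w2.
Proof.
move=> hs h; eapply exits_step; [exact: hs | by [] |].
case: (t m) h => {hs}; rewrite /runs.
  elim => [s w0 m0 w' hs hn|j0 s s' w0 m0 w' w'' hs hn _ IH].
    by eapply exits_now; [exact: hs | rewrite /= hn].
  by eapply exits_step; [exact: hs | rewrite /= hn | exact: IH].
elim => [s w0 m0 w' hs hn|j0 s s' w0 m0 w' w'' hs hn _ IH].
  by eapply exits_now; [exact: hs | rewrite /= hn].
by eapply exits_step; [exact: hs | rewrite /= hn | exact: IH].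
Qed.

Lemma runs_while_exit i f t P w m w1 : scan f i w = (m, w1) -> ~~ t m ->
  runs (while_prog i f t P) 1 w w1.
Proof.
by move=> hs ht; eapply exits_now; [exact: hs | rewrite /= (negbTE ht)].
Qed.

Lemma runs_while_loop i f t P j k w m w1 w2 w3 : scan f i w = (m, w1) -> t m ->
  runs P j w1 w2 -> runs (while_prog i f t P) k w2 w3 ->
  runs (while_prog i f t P) (j + k).+1 w w3.
Proof.
move=> hs ht hP hW; eapply exits_step; [exact: hs | by rewrite /= ht |].
move: hP; rewrite /runs; move: (pr_ent P) => s hP.
elim: hP hW => {j w1 w2 hs}[s' w1 m' w' hs hn|j s' s'' w1 m' w' w'' hs hn _ IH] hW.
  by eapply exits_step; [exact: hs | rewrite /= hn | exact: hW].
by eapply exits_step; [exact: hs | rewrite /= hn | exact: IH hW].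
Qed.
End Combinators.
End Sweep.

(** * A language of bounded loops over relations *)

Section BitVectors.
Variable m : nat.
Implicit Types t : {ffun 'I_m -> bool}.
(** Commands name tracks and variables by plain numbers; an index out of range reads as false and
    writing there has no effect. *)
Definition bget t k := [exists i : 'I_m, (val i == k) && t i].
Definition bput t k b : {ffun 'I_m -> bool} := [ffun i => if val i == k then b else t i].

Lemma bgetE (F : nat -> bool) k : k < m -> bget [ffun i => F (val i)] k = F k.
Proof.
move=> km; apply/existsP/idP => [[i /andP[/eqP<-]]|hF]; first by rewrite ffunE.
by exists (Ordinal km); rewrite ffunE eqxx.
Qed.

Lemma bputE (F : nat -> bool) k b :
  bput [ffun i => F (val i)] k b = [ffun i => if val i == k then b else F (val i)].
Proof. by apply/ffunP => i; rewrite !ffunE. Qed.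
End BitVectors.

Section Lang.
Variables (K X : nat).

(** [Hd] replaces a letter of the unary prefix and carries two marks; [Un] is an input bit not yet
    converted. In [Cell b r s t u v], [b] is the block, [r] marks the first column, [s] the first
    cell of the block, [t] holds the entry of every relation, [u] and [v] the variables whose value
    is the row and the column. [Cut] and [Junk] delimit the output on the left and on the right. *)
Inductive sym :=
| Hd of bool & bool
| Sep
| Un of bool
| Cell of bool & bool & bool & {ffun 'I_K -> bool} & {ffun 'I_X -> bool} & {ffun 'I_X -> bool}
| Cut
| Junk.

Definition sym_code (s : sym) : option (option (option (bool * bool + bool +
    bool * bool * bool * {ffun 'I_K -> bool} * {ffun 'I_X -> bool} * {ffun 'I_X -> bool}))) :=
  match s with
  | Hd p q => Some (Some (Some (inl (inl (p, q)))))
  | Sep => None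
  | Un b => Some (Some (Some (inl (inr b))))
  | Cell b r s t u v => Some (Some (Some (inr (b, r, s, t, u, v))))
  | Cut => Some None
  | Junk => Some (Some None)
  end.
Definition sym_decode c : sym :=
  match c with
  | Some (Some (Some (inl (inl (p, q))))) => Hd p q
  | None => Sep
  | Some (Some (Some (inl (inr b)))) => Un b
  | Some (Some (Some (inr (b, r, s, t, u, v)))) => Cell b r s t u v
  | Some None => Cut
  | Some (Some None) => Junk
  end.
Lemma sym_codeK : cancel sym_code sym_decode. Proof. by case. Qed.
HB.instance Definition _ := Finite.copy sym (can_type sym_codeK).

Notation G := (bool + sym)%type.
Definition mem4 : finType := (bool * bool * bool * bool)%type.
Definition m00 : mem4 := (false, false, false, false).
Notation prg := (prog mem4 sym).

(* The second matrix of the input is stored as track 1 of the second block of cells;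
   all other tracks live in the first block. *)
Definition blk (k : nat) := k == 1.

Section Tape.
Variable n : nat.
Definition env := nat -> option 'I_n.
Definition store := nat -> rel 'I_n.
Implicit Types (rho : env) (R : store).

(** A variable is marked on its whole row and on its whole column, in both blocks, so a single cell
    decides locally whether it is the one addressed by two variables. *)
Definition cell rho R b (i j : 'I_n) : G :=
  inr (Cell b (val j == 0) ((val i == 0) && (val j == 0))
        [ffun k => (blk (val k) == b) && R (val k) i j]
        [ffun x => rho (val x) == Some i] [ffun x => rho (val x) == Some j]).

Definition block rho R b := [seq cell rho R b i j | i <- enum 'I_n, j <- enum 'I_n].

Definition tape rho R : seq G :=
  nseq n (inr (Hd false false)) ++ inr Sep :: block rho R false ++ block rho R true.

Lemma scan_seq (T : Type) (Mem : Type) (f : Mem -> G -> Mem * G) (g g' : T -> seq G)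
    (s : seq T) x0 (Inv : nat -> Mem -> Prop) :
  (forall k m, k < size s -> Inv k m -> exists2 m', Inv k.+1 m' &
     scan f m (g (nth x0 s k)) = (m', g' (nth x0 s k))) ->
  forall m, Inv 0 m -> exists2 m', Inv (size s) m' &
    scan f m (flatten (map g s)) = (m', flatten (map g' s)).
Proof.
elim: s Inv => [|x s IH] Inv hk m h0 /=; first by exists m.
have [m1 h1 e1] := hk 0 m isT h0.
have [|m2 h2 e2] := IH (fun k => Inv k.+1) _ m1 h1.
  by move=> k m' ks hm; apply: (hk k.+1).
by exists m2 => //; rewrite scan_cat e1 e2.
Qed.

Lemma flatten_seq1 (T T' : Type) (g : T -> T') s : flatten [seq [:: g x] | x <- s] = map g s.
Proof. by elim: s => //= x s ->. Qed.

Lemma scan_block (f : mem4 -> G -> mem4 * G) (c c' : 'I_n -> 'I_n -> G)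
    (Inv : nat -> nat -> mem4 -> Prop) :
  (forall (i j : 'I_n) m, Inv i j m -> exists2 m', Inv i j.+1 m' & f m (c i j) = (m', c' i j)) ->
  (forall (i : 'I_n) m, Inv i n m -> Inv i.+1 0 m) ->
  forall m, Inv 0 0 m -> exists2 m', Inv n 0 m' &
    scan f m [seq c i j | i <- enum 'I_n, j <- enum 'I_n] =
    (m', [seq c' i j | i <- enum 'I_n, j <- enum 'I_n]).
Proof.
move=> hc hrow m hm; case: (posnP n) => [n0|npos].
  rewrite (_ : enum 'I_n = [::]) /=; first by exists m; rewrite ?n0.
  by apply: size0nil; rewrite size_enum_ord.
pose x0 := Ordinal npos.
have [|m'] := @scan_seq 'I_n mem4 f (fun i => [seq c i j | j <- enum 'I_n])
  (fun i => [seq c' i j | j <- enum 'I_n]) (enum 'I_n) x0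
  (fun i => Inv i 0) _ m hm; last by rewrite size_enum_ord => h e; exists m'.
move=> k m' kn hm'; rewrite size_enum_ord in kn; set i := nth _ _ _.
have vi : val i = k by rewrite /= nth_enum_ord.
have hm2 : Inv i 0 m' by rewrite [nat_of_ord i]vi.
have [|m2] := @scan_seq 'I_n mem4 f (fun j => [:: c i j])
  (fun j => [:: c' i j]) (enum 'I_n) x0 (Inv i) _ m' hm2.
  move=> l m3 ln hm3; rewrite size_enum_ord in ln; set j := nth _ _ _.
  have vj : val j = l by rewrite /= nth_enum_ord.
  have [|m4 h4 e4] := hc i j m3; first by rewrite [nat_of_ord j]vj.
  by exists m4; rewrite -?vj //= e4.
rewrite !flatten_seq1 size_enum_ord => h e; exists m2 => //.
by rewrite -vi; apply: hrow.
Qed.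

(** [Inv b i j] describes the memory on arrival at cell (i, j) of block [b]; column [n] is the end
    of a row, before the change to column 0 of the next one. *)
Lemma scan_tape (f : mem4 -> G -> mem4 * G) rho R rho' R' m0
    (Inv : bool -> nat -> nat -> mem4 -> Prop) :
  f m0 (inr (Hd false false)) = (m0, inr (Hd false false)) ->
  (exists2 m, Inv false 0 0 m & f m0 (inr Sep) = (m, inr Sep)) ->
  (forall b (i j : 'I_n) m, Inv b i j m -> exists2 m', Inv b i j.+1 m' &
     f m (cell rho R b i j) = (m', cell rho' R' b i j)) ->
  (forall b (i : 'I_n) m, Inv b i n m -> Inv b i.+1 0 m) ->
  (forall m, Inv false n 0 m -> Inv true 0 0 m) ->
  exists2 m, Inv true n 0 m & scan f m0 (tape rho R) = (m, tape rho' R').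
Proof.
move=> hH [m1 h1 hS] hc hrow hblk.
have hH' : scan f m0 (nseq n (inr (Hd false false))) = (m0, nseq n (inr (Hd false false))).
  by elim: n => //= k IH; rewrite hH IH.
have [m2 h2 e2] := scan_block (hc false) (hrow false) h1.
have [m3 h3 e3] := scan_block (hc true) (hrow true) (hblk _ h2).
by exists m3 => //; rewrite /tape scan_cat hH' /= hS scan_cat e2 e3.
Qed.

Definition setv rho x v : env := fun y => if y == x then v else rho y.
Definition setr R k (Q : rel 'I_n) : store := fun l => if l == k then Q else R l.
Definition upd R k i j b : store :=
  setr R k (fun i' j' => if (i' == i) && (j' == j) then b else R k i' j').
End Tape.

(** * Syntax, semantics and cost of the loop language *)

Inductive bexp := Atom of nat & nat & nat | Not of bexp | And of bexp & bexp | Or of bexp & bexp.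

Inductive cmd :=
| Skip
| Set_ of nat & nat & nat & bool
| If of bexp & cmd & cmd
| Seq of cmd & cmd
| For of nat & cmd.

Section Eval.
Variable n : nat.
Implicit Types (rho : env n) (R : store n).

Fixpoint beval E rho R : bool :=
  match E with
  | Atom k x y => if rho x is Some i then if rho y is Some j then R k i j else false else false
  | Not E => ~~ beval E rho R
  | And E F => beval E rho R && beval F rho R
  | Or E F => beval E rho R || beval F rho R
  end.

Fixpoint eval c rho R : store n :=
  match c with
  | Skip => R
  | Set_ k x y b =>
      if rho x is Some i then if rho y is Some j then upd R k i j b else R else R
  | If E c1 c2 => if beval E rho R then eval c1 rho R else eval c2 rho R
  | Seq c1 c2 => eval c2 rho (eval c1 rho R)
  | For x c => foldl (fun R i => eval c (setv rho x (Some i)) R) R (enum 'I_n)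
  end.
End Eval.

Fixpoint bwf E :=
  match E with
  | Atom k x y => [&& k < K, x < X & y < X]
  | Not E => bwf E
  | And E F | Or E F => bwf E && bwf F
  end.

Fixpoint bound c : seq nat :=
  match c with
  | Skip | Set_ _ _ _ _ => [::]
  | If _ c d | Seq c d => bound c ++ bound d
  | For x c => x :: bound c
  end.

(** A loop ends by pushing its mark off the tape, so an inner loop over the same variable would
    destroy the outer counter; hence the ban on rebinding. *)
Fixpoint wf c :=
  match c with
  | Skip => true
  | Set_ k x y _ => [&& k < K, x < X & y < X]
  | If E c d => [&& bwf E, wf c & wf d]
  | Seq c d => wf c && wf d
  | For x c => [&& x < X, x \notin bound c & wf c]
  end.

Fixpoint bsize E :=
  match E with
  | Atom _ _ _ => 1
  | Not E => bsize E
  | And E F | Or E F => bsize E + bsize F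
  end.

(** Counts sweeps. A loop pays for one reset and one failing test, and in each round for one
    successful test and one increment. *)
Fixpoint cost n c :=
  match c with
  | Skip | Set_ _ _ _ _ => 1
  | If E c d => bsize E + cost n c + cost n d
  | Seq c d => cost n c + cost n d
  | For _ c => 2 + n * (cost n c + 2)
  end.

Lemma cost_poly c : exists a d, forall n, cost n c <= a * n.+1 ^ d.
Proof.
have le_pow m d d' : d <= d' -> m.+1 ^ d <= m.+1 ^ d' by move=> h; rewrite leq_pexp2l.
have pow_pos m d : 0 < m.+1 ^ d by rewrite expn_gt0.
have add2 (F F' : nat -> nat) a d a' d' : (forall n, F n <= a * n.+1 ^ d) ->
    (forall n, F' n <= a' * n.+1 ^ d') -> forall n, F n + F' n <= (a + a') * n.+1 ^ (d + d').
  move=> h h' m; apply: leq_trans (leq_add (h m) (h' m)) _; rewrite mulnDl leq_add // leq_mul2l le_pow ?orbT //; lia.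
elim: c => [|k x y b|E c [a [d h]] c' [a' [d' h']]|c [a [d h]] c' [a' [d' h']]|x c [a [d h]]].
- by exists 1, 0 => n; rewrite expn0.
- by exists 1, 0 => n; rewrite expn0.
- have hE n : bsize E <= bsize E * n.+1 ^ 0 by rewrite expn0 muln1.
  by exists (bsize E + a + a'), (0 + d + d') => n /=; apply: (add2 _ _ _ _ _ _ (add2 _ _ _ _ _ _ hE h) h').
- by exists (a + a'), (d + d') => n /=; apply: (add2 _ _ _ _ _ _ h h').
- exists (a + 4), d.+1 => n /=; have := h n; have := pow_pos n d; rewrite expnS.
  move: (n.+1 ^ d) (cost n c) => p q; nia.
Qed.

(** * Elementary commands as transducers *)

Definition f_set k x y b (m : mem4) (a : G) : mem4 * G :=
  if a is inr (Cell bb rs bs t u v) then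
    if [&& bb == blk k, bget u x & bget v y]
    then (m, inr (Cell bb rs bs (bput t k b) u v)) else (m, a)
  else (m, a).

Definition f_test k x y (m : mem4) (a : G) : mem4 * G :=
  if a is inr (Cell bb rs bs t u v) then
    if [&& bb == blk k, bget u x & bget v y]
    then ((bget t k, false, false, false), a) else (m, a)
  else (m, a).

Definition f_reset x (m : mem4) (a : G) : mem4 * G :=
  if a is inr (Cell bb rs bs t u v) then
    let r := if rs then bs else m.1.1.1 in
    ((r, false, false, false), inr (Cell bb rs bs t (bput u x r) (bput v x rs)))
  else (m, a).

Definition f_alive x (m : mem4) (a : G) : mem4 * G :=
  if a is inr (Cell bb rs bs t u v) then
    ((m.1.1.1 || bget u x, false, false, false), a)
  else (m, a).

(* Memory: new row mark, old row mark (both of the current row), old column mark of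
   the previous cell. *)
Definition f_inc x (m : mem4) (a : G) : mem4 * G :=
  if a is inr (Cell bb rs bs t u v) then
    let: (p, c, l, _) := m in
    let p' := if rs then ~~ bs && c else p in
    ((p', if rs then bget u x else c, bget v x, false),
     inr (Cell bb rs bs t (bput u x p') (bput v x (~~ rs && l))))
  else (m, a).

Definition test1 (m : mem4) := m.1.1.1.

Section Sweeps.
Variable n : nat.
Implicit Types (rho : env n) (R : store n).

Lemma bget_cell (rho : env n) x (i : 'I_n) : x < X ->
  bget [ffun x : 'I_X => rho (val x) == Some i] x = (rho x == Some i).
Proof. exact: (bgetE (fun x => rho x == Some i)). Qed.

Lemma scan_set k x y b rho R : k < K -> x < X -> y < X ->
  exists m, scan (f_set k x y b) m00 (tape rho R) = (m, tape rho (eval (Set_ k x y b) rho R)).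
Proof.
move=> kK xX yX; have [|||||m _ e] := @scan_tape n (f_set k x y b) rho R rho
  (eval (Set_ k x y b) rho R) m00 (fun _ _ _ _ => True) => //; last by exists m.
- by exists m00.
- move=> bb i j m _; exists m => //; rewrite /f_set /= !bget_cell //.
  case: ifP => [/and3P[/eqP-> /eqP-> /eqP->]|ncond].
    congr (_, inr (Cell _ _ _ _ _ _)); apply/ffunP => l; rewrite !ffunE /upd /setr.
    by case: (altP (val l =P k)) => [->|//]; rewrite !eqxx.
  congr (_, inr (Cell _ _ _ _ _ _)); apply/ffunP => l; rewrite !ffunE.
  case ex: (rho x) ncond => [i'|] //; case ey: (rho y) => [j'|] //.
  rewrite /upd /setr; case: (altP (val l =P k)) => [->|//] /=.
  rewrite (eq_sym _ bb) /=; case: (bb =P blk k) => //= _.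
  rewrite (inj_eq Some_inj) (inj_eq Some_inj).
  by rewrite (eq_sym i) (eq_sym j) => ->.
Qed.

Lemma scan_test k x y rho R : k < K -> x < X -> y < X ->
  exists2 m, scan (f_test k x y) m00 (tape rho R) = (m, tape rho R) &
    test1 m = beval (Atom k x y) rho R.
Proof.
move=> kK xX yX.
(* The only cell that can switch the memory on already lies behind the head. In the block not
   holding [k] this is constant: true exactly when that block is the second one. *)
pose passed b i j (i0 j0 : 'I_n) := if b == blk k then (i0 < i) || (i0 == i :> nat) && (j0 < j) else b.
pose Inv b i j (m : mem4) := m = (if rho x is Some i0 then if rho y is Some j0 then
  R k i0 j0 && passed b i j i0 j0 else false else false, false, false, false).
have [|||||m -> e] := @scan_tape n (f_test k x y) rho R rho R m00 Inv => //.
- exists m00 => //; rewrite /Inv /passed /m00; case: (rho x) => // i0; case: (rho y) => // j0.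
  by rewrite !ltn0 andbF if_same andbF.
- move=> b i j m ->; rewrite /f_test /= !bget_cell //.
  rewrite (@bgetE K (fun l => (blk l == b) && R l i j) k kK) (eq_sym (blk k)).
  eexists; first by rewrite /Inv; reflexivity.
  case: ifP => [/and3P[/eqP hb /eqP -> /eqP ->]|].
    by rewrite /passed hb eqxx /= eqxx ltnSn orbT andbT.
  case: (rho x) => // i0; case: (rho y) => // j0; rewrite /passed; case: (b =P blk k) => //= _.
  rewrite !(inj_eq Some_inj) -!val_eqE /= => h; congr (_ && _, _, _, _, _).
  by lia.
- move=> b i m ->; rewrite /Inv /passed.
  case: (rho x) => // i0; case: (rho y) => // j0; case: (b == _) => //.
  by congr (_ && _, _, _, _); have := ltn_ord j0; lia.
- move=> m ->; rewrite /Inv /passed.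
  case: (rho x) => // i0; case: (rho y) => // j0; have := ltn_ord i0.
  by move=> h; congr (_ && _, _, _, _); case: (blk k) => /=; lia.
- eexists; first exact: e.
  rewrite /test1 /passed /=; case: (rho x) => // i0; case: (rho y) => // j0.
  by case: (blk k) => /=; rewrite ?ltn_ord andbT.
Qed.

Lemma some_ord_eq (i0 : 'I_n) (i : 'I_n) : (Some i0 == Some i) = (val i0 == val i).
Proof. by rewrite (inj_eq Some_inj). Qed.

(** The value after the last vertex is [None]: incrementing past the end erases the mark, which is
    how a loop notices that it is finished. *)
Definition ord_at k : option 'I_n := insub k.

Lemma ord_atE k (i : 'I_n) : (ord_at k == Some i) = (k == val i).
Proof.
rewrite /ord_at; case: insubP => [j _ <-|h]; first by rewrite some_ord_eq.
by apply/esym/negbTE; apply: contraNneq h => ->; exact: ltn_ord.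
Qed.

Lemma tape_ext rho rho' R : (forall x, x < X -> rho x = rho' x) -> tape rho R = tape rho' R.
Proof.
move=> e; have ec b i j : cell rho R b i j = cell rho' R b i j.
  have er l : [ffun x : 'I_X => rho (val x) == Some l] = [ffun x : 'I_X => rho' (val x) == Some l].
    by apply/ffunP => x; rewrite !ffunE e; last exact: ltn_ord.
  by rewrite /cell !er.
rewrite /tape /block; congr (_ ++ _ :: _ ++ _);
by congr flatten; apply: eq_map => i; apply: eq_map => j; rewrite ec.
Qed.

Lemma cell_setv rho R x v b (i j : 'I_n) : cell (setv rho x v) R b i j =
  inr (Cell b (val j == 0) ((val i == 0) && (val j == 0))
    [ffun k => (blk (val k) == b) && R (val k) i j]
    (bput [ffun x => rho (val x) == Some i] x (v == Some i))
    (bput [ffun x => rho (val x) == Some j] x (v == Some j))).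
Proof.
rewrite (bputE _ (fun x => rho x == Some i)) (bputE _ (fun x => rho x == Some j)).
by congr (inr (Cell _ _ _ _ _ _)); apply/ffunP => y; rewrite !ffunE /setv; case: ifP.
Qed.

Lemma scan_reset x rho R : x < X ->
  exists m, scan (f_reset x) m00 (tape rho R) = (m, tape (setv rho x (ord_at 0)) R).
Proof.
move=> xX; pose Inv (b : bool) i j (m : mem4) := 0 < j -> test1 m = (i == 0).
have [|||||m _ e] := @scan_tape n (f_reset x) rho R (setv rho x (ord_at 0)) R m00 Inv => //;
  last by exists m.
- by exists m00.
- move=> b i j m hm; rewrite cell_setv !ord_atE.
  exists (val i == 0, false, false, false); first by [].
  have er : (if val j == 0 then (val i == 0) && (val j == 0) else m.1.1.1) = (val i == 0).
    case e0: (val j == 0); first by rewrite andbT.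
    by apply: hm; rewrite lt0n [_ == _]e0.
  by rewrite /f_reset /cell er !(eq_sym 0).
Qed.

Lemma scan_alive x rho R : x < X ->
  exists2 m, scan (f_alive x) m00 (tape rho R) = (m, tape rho R) &
    test1 m = (rho x : bool).
Proof.
move=> xX.
pose Inv b i j (m : mem4) := m = (if rho x is Some i0 then
  [|| b, i0 < i | (i0 == i :> nat) && (0 < j)] else false, false, false, false).
have [|||||m -> e] := @scan_tape n (f_alive x) rho R rho R m00 Inv => //.
- by exists m00 => //; rewrite /Inv; case: (rho x) => // i0; rewrite andbF.
- move=> b i j m ->; rewrite /= bget_cell //; eexists; last reflexivity.
  rewrite /Inv; case: (rho x) => //= i0; rewrite some_ord_eq /=.
  by congr (_, _, _, _); lia.
- move=> b i m ->; rewrite /Inv; case: (rho x) => // i0; congr (_, _, _, _).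
  by have := ltn_ord i; case: b => //=; lia.
- by move=> m ->; rewrite /Inv; case: (rho x) => //= i0; rewrite ltn_ord.
- by eexists; first exact: e; rewrite /test1 /=; case: (rho x).
Qed.

Lemma scan_inc x rho R k : x < X -> rho x = ord_at k -> k < n ->
  exists m, scan (f_inc x) m00 (tape rho R) = (m, tape (setv rho x (ord_at k.+1)) R).
Proof.
move=> xX ex kn.
(* On entering row i > 0 only the middle component matters: it still holds the old mark of row i -
   1, which is the new mark of row i. *)
pose Inv (b : bool) i j (m : mem4) :=
  if j is j'.+1 then m = (i == k.+1, i == k, j' == k, false) else 0 < i -> m.1.1.2 = (i == k.+1).
have [|||||m _ e] := @scan_tape n (f_inc x) rho R (setv rho x (ord_at k.+1)) R m00 Inv => //;
  last by exists m.
- by exists m00.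
- move=> b i j [[[p c] l] z] hm; rewrite cell_setv !ord_atE.
  exists (val i == k.+1, val i == k, val j == k, false); first by [].
  have [hm0 hmS] : (val j = 0 -> 0 < val i -> c = (val i == k.+1)) /\
      (0 < val j -> [/\ p = (val i == k.+1), c = (val i == k) & l = (val j == k.+1)]).
    by move: hm; rewrite /Inv -[nat_of_ord j]/(val j); case: (val j) => [|j'] // [-> -> ->].
  rewrite /f_inc /cell !bget_cell // ex !ord_atE !(eq_sym k) !(eq_sym k.+1).
  case e0: (val j == 0).
    rewrite andbT (_ : ~~ (val i == 0) && c = (val i == k.+1)) ?(eqP e0) //.
    case: posnP => [->//|ip]; exact: hm0 (eqP e0) ip.
  by have [|-> -> ->] := hmS; first by rewrite lt0n e0.
- move=> b i m; have gen N : 0 < N -> Inv b i N m -> Inv b i.+1 0 m.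
    by case: N => // N _ -> _; rewrite /= eqSS.
  exact: gen (leq_ltn_trans (leq0n _) (ltn_ord i)).
Qed.

Lemma scan_skip rho R :
  scan (fun m (a : G) => (m, a)) m00 (tape rho R) = (m00, tape rho R).
Proof. by elim: (tape rho R) => //= a w ->. Qed.
End Sweeps.

(** Connectives become jumps. A continuation may be copied, which enlarges the machine by an amount
    independent of the input and costs no extra sweeps. *)
Fixpoint compile_test E (P Q : prg) : prg :=
  match E with
  | Atom k x y => if_prog m00 (f_test k x y) test1 P Q
  | Not E => compile_test E Q P
  | And E F => compile_test E (compile_test F P Q) Q
  | Or E F => compile_test E P (compile_test F P Q)
  end.

Fixpoint compile c : prg :=
  match c with
  | Skip => sweep_prog m00 (fun m a => (m, a))
  | Set_ k x y b => sweep_prog m00 (f_set k x y b)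
  | If E c d => compile_test E (compile c) (compile d)
  | Seq c d => seq_prog (compile c) (compile d)
  | For x c => seq_prog (sweep_prog m00 (f_reset x))
      (while_prog m00 (f_alive x) test1 (seq_prog (compile c) (sweep_prog m00 (f_inc x))))
  end.

(** * Correctness and cost of the compilation *)

Section CompileCorrect.
Variable n : nat.
Implicit Types (rho : env n) (R : store n).

Lemma runs_compile_test E P Q k w rho R : bwf E ->
  runs (if beval E rho R then P else Q) k (tape rho R) w ->
  exists2 k', k' <= bsize E + k & runs (compile_test E P Q) k' (tape rho R) w.
Proof.
elim: E P Q k => [a x y|E IH|E IHE F IHF|E IHE F IHF] P Q k /=.
- case/and3P => aK xX yX h; exists k.+1 => //.
  have [m e et] := scan_test rho R aK xX yX.
  by apply: runs_if e _; rewrite et.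
- by move=> hw h; apply: IH => //; case: (beval E rho R) h.
- case/andP => hE hF h; case e: (beval E rho R) h => /= h.
    have [k1 le1 h1] := IHF _ _ _ hF h.
    have [|k2 le2 h2] := IHE (compile_test F P Q) Q k1 hE; first by rewrite e.
    by exists k2 => //; lia.
  have [|k2 le2 h2] := IHE (compile_test F P Q) Q k hE; first by rewrite e.
  by exists k2 => //; lia.
- case/andP => hE hF h; case e: (beval E rho R) h => /= h.
    have [|k2 le2 h2] := IHE P (compile_test F P Q) k hE; first by rewrite e.
    by exists k2 => //; lia.
  have [k1 le1 h1] := IHF _ _ _ hF h.
  have [|k2 le2 h2] := IHE P (compile_test F P Q) k1 hE; first by rewrite e.
  by exists k2 => //; lia.
Qed.

Theorem runs_compile c rho R : wf c -> (forall x, x \in bound c -> rho x = None) ->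
  exists2 k, k <= cost n c & runs (compile c) k (tape rho R) (tape rho (eval c rho R)).
Proof.
elim: c rho R => [|a x y b|E c IHc d IHd|c IHc d IHd|x c IHc] rho R.
- by exists 1 => //; apply: runs_sweep (scan_skip _ _).
- case/and3P => aK xX yX _; exists 1 => //.
  by have [m e] := scan_set b rho R aK xX yX; apply: runs_sweep e.
- case/and3P => wE wc wd hb.
  have [|k1 le1 h1] := IHc rho R wc; first by move=> x hx; apply: hb; rewrite mem_cat hx.
  have [|k2 le2 h2] := IHd rho R wd; first by move=> x hx; apply: hb; rewrite mem_cat hx orbT.
  have : exists2 k, k <= cost n c + cost n d &
      runs (if beval E rho R then compile c else compile d) k (tape rho R)
        (tape rho (eval (If E c d) rho R)).
    by rewrite /=; case: ifP; [exists k1 | exists k2] => //; lia.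
  case=> k le h; have [k' le' h'] := runs_compile_test wE h.
  by exists k' => //=; lia.
- case/andP => wc wd hb.
  have [|k1 le1 h1] := IHc rho R wc; first by move=> x hx; apply: hb; rewrite mem_cat hx.
  have [|k2 le2 h2] := IHd rho (eval c rho R) wd.
    by move=> x hx; apply: hb; rewrite mem_cat hx orbT.
  by exists (k1 + k2); [rewrite /=; lia | apply: runs_seq h1 h2].
case/and3P => xX xc wc hb.
have rx : rho x = None by apply: hb; rewrite mem_head.
have bc v y : y \in bound c -> setv rho x v y = None.
  move=> yc; rewrite /setv; case: eqP => [exy|_]; first by rewrite -exy yc in xc.
  by apply: hb; rewrite inE yc orbT.
pose W : prg := while_prog m00 (f_alive x) test1 (seq_prog (compile c) (sweep_prog m00 (f_inc x))).
have loop k j R0 : k + j = n ->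
    exists2 l, l <= 1 + j * (cost n c + 2) & runs W l (tape (setv rho x (ord_at n k)) R0)
      (tape rho (foldl (fun R i => eval c (setv rho x (Some i)) R) R0 (drop k (enum 'I_n)))).
  elim: j k R0 => [|j IH] k R0 kn.
    rewrite addn0 in kn; exists 1 => //.
    have e0 : ord_at n k = None by rewrite /ord_at insubF // kn ltnn.
    rewrite e0 drop_oversize ?size_enum_ord ?kn // [foldl _ _ _]/=.
    (* Losing the mark restores the environment, because [x] was unbound before the loop. *)
    have ee : tape (setv rho x None) R0 = tape rho R0.
      by apply: tape_ext => y _; rewrite /setv; case: eqP => // ->.
    rewrite ee; have [m e et] := scan_alive rho R0 xX.
    by apply: runs_while_exit e _; rewrite et rx.
  have kn' : k < n by lia.
  pose i := Ordinal kn'.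
  have ei : ord_at n k = Some i by apply/eqP; rewrite ord_atE.
  have [m e et] := scan_alive (setv rho x (Some i)) R0 xX.
  have [l1 le1 h1] := IHc (setv rho x (Some i)) R0 wc (bc _).
  have [l2 le2 h2] := IH k.+1 (eval c (setv rho x (Some i)) R0) (etrans (addSnnS _ _) kn).
  have [|m3 e3] := @scan_inc n x (setv rho x (Some i)) (eval c (setv rho x (Some i)) R0) k xX _ kn'.
    by rewrite /setv eqxx ei.
  have ee : tape (setv (setv rho x (Some i)) x (ord_at n k.+1)) (eval c (setv rho x (Some i)) R0)
          = tape (setv rho x (ord_at n k.+1)) (eval c (setv rho x (Some i)) R0).
    by apply: tape_ext => y _; rewrite /setv; case: eqP.
  rewrite ee in e3.
  exists ((l1 + 1) + l2).+1; first by rewrite mulSn; lia.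
  rewrite ei (drop_nth i) ?size_enum_ord //= (_ : nth i (enum 'I_n) k = i); last first.
    by apply: val_inj; rewrite /= nth_enum_ord.
  apply: (runs_while_loop e _ (runs_seq h1 (runs_sweep e3)) h2).
  by rewrite et /setv eqxx.
have [l le h] := loop 0 n R (add0n n).
rewrite drop0 in h; have [m e] := scan_reset rho R xX.
exists (1 + l); first by rewrite /=; lia.
exact: runs_seq (runs_sweep e) h.
Qed.
End CompileCorrect.

(** * Conversion of the input word into cells, and output *)

Definition f_mark (m : mem4) (a : G) : mem4 * G :=
  if a is inl b then
    if test1 m then (m, inr (Un b))
    else if b then (m, inr (Hd false false)) else ((true, false, false, false), inr Sep)
  else (m, a).

(** As long as there are no cells, the row and column counters of the setup loops live as marks on
    the unary prefix: [c = false] selects the row, [c = true] the column. *)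
Definition hget (c : bool) p q : bool := if c then q else p.
Definition hput (c : bool) b p q : sym := if c then Hd p b else Hd b q.

Definition f_hreset c (m : mem4) (a : G) : mem4 * G :=
  if a is inr (Hd p q) then
    ((true, false, false, false), inr (hput c (~~ test1 m) p q))
  else (m, a).
Definition f_halive c (m : mem4) (a : G) : mem4 * G :=
  if a is inr (Hd p q) then ((test1 m || hget c p q, false, false, false), a) else (m, a).
Definition f_hinc c (m : mem4) (a : G) : mem4 * G :=
  if a is inr (Hd p q) then
    ((hget c p q, false, false, false), inr (hput c (test1 m) p q))
  else (m, a).

(* Memory: header seen, first row, first column, cell already written. *)
Definition f_assign b (m : mem4) (a : G) : mem4 * G :=
  let: (h, r, c, d) := m in
  match a with
  | inr (Hd p q) => (if h then m else (true, p, q, d), a)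
  | inr (Un x) => if d then (m, a) else ((h, r, c, true),
      inr (Cell b c (r && c) [ffun k : 'I_K => (val k == b) && x] [ffun=> false] [ffun=> false]))
  | _ => (m, a)
  end.

Definition hloop c (P : prg) : prg :=
  seq_prog (sweep_prog m00 (f_hreset c))
    (while_prog m00 (f_halive c) test1 (seq_prog P (sweep_prog m00 (f_hinc c)))).

(** The loops run in the row-major order of [enc], so the bit for the current pair is always the
    leftmost unconverted one, and no position has to be computed. *)
Definition setup : prg :=
  seq_prog (sweep_prog m00 f_mark)
   (seq_prog (hloop false (hloop true (sweep_prog m00 (f_assign false))))
             (hloop false (hloop true (sweep_prog m00 (f_assign true))))).

(** Row 0 of relation [k] is output negated, which suits both uses: the complement of the computed
    set, and the absence of a violation. With no header letter there is no cell either; then the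
    separator itself becomes the answer bit true, which is correct for the empty graph. *)
Definition f_out one k (m : mem4) (a : G) : mem4 * G :=
  match a with
  | inr (Hd _ _) => ((false, true, false, false), inr Cut)
  | inr Sep => (m, if one && ~~ m.1.1.2 then inl true else inr Cut)
  | inr (Cell b rs bs t _ _) =>
      let r := if rs then bs && ~~ b else test1 m in
      ((r, true, false, false), if r && (one ==> rs) then inl (~~ bget t k) else inr Junk)
  | _ => (m, a)
  end.

Definition full_prog one k c : prg :=
  seq_prog setup (seq_prog (compile c) (sweep_prog m00 (f_out one k))).

Lemma scan_fix (f : mem4 -> G -> mem4 * G) m w :
  all (fun a => f m a == (m, a)) w -> scan f m w = (m, w).
Proof. by elim: w => //= a w IH /andP[/eqP-> /IH->]. Qed.

Definition is_hd (a : G) := if a is inr (Hd _ _) then true else false.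

Section Setup.
Variable n : nat.
Implicit Types (M : bool -> option 'I_n).

Definition hdr M : seq G :=
  [seq inr (Hd (M false == Some i) (M true == Some i)) | i <- enum 'I_n].
Definition setm M c v : bool -> option 'I_n := fun c' => if c' == c then v else M c'.

Lemma scan_hdr f M M' m0 (Inv : nat -> mem4 -> Prop) w : Inv 0 m0 ->
  (forall (i : 'I_n) m, Inv i m -> exists2 m', Inv i.+1 m' &
     f m (inr (Hd (M false == Some i) (M true == Some i))) =
     (m', inr (Hd (M' false == Some i) (M' true == Some i)))) ->
  (forall m, all (fun a => f m a == (m, a)) w) ->
  exists2 m, Inv n m & scan f m0 (hdr M ++ w) = (m, hdr M' ++ w).
Proof.
move=> h0 hi hw; rewrite scan_cat; case: (posnP n) => [n0|npos].
  have e0 : enum 'I_n = [::] by apply: size0nil; rewrite size_enum_ord.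
  by exists m0; rewrite ?n0 // /hdr e0 /= scan_fix.
have [|m hm e] := @scan_seq 'I_n mem4 f
    (fun i => [:: inr (Hd (M false == Some i) (M true == Some i))])
    (fun i => [:: inr (Hd (M' false == Some i) (M' true == Some i))])
    (enum 'I_n) (Ordinal npos) Inv _ m0 h0.
  move=> k m ks hm; rewrite size_enum_ord in ks; set i := nth _ _ _.
  have vi : val i = k by rewrite /= nth_enum_ord.
  have [|m' h' e'] := hi i m; first by rewrite [nat_of_ord i]vi.
  by exists m'; rewrite -?vi //= e'.
rewrite !flatten_seq1 size_enum_ord in e hm.
by exists m => //; rewrite e scan_fix.
Qed.

Lemma hput_set M c (v : option 'I_n) (i : 'I_n) (b : bool) : b = (v == Some i) ->
  hput c b (M false == Some i) (M true == Some i) =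
  Hd (setm M c v false == Some i) (setm M c v true == Some i).
Proof. by move=> ->; case: c. Qed.

Lemma hget_set M c (i : 'I_n) : hget c (M false == Some i) (M true == Some i) = (M c == Some i).
Proof. by case: c. Qed.

Lemma fix_nohd (f : mem4 -> G -> mem4 * G) w : (forall m a, ~~ is_hd a -> f m a = (m, a)) -> all (predC is_hd) w ->
  forall m, all (fun a => f m a == (m, a)) w.
Proof. by move=> hf /allP hw m; apply/allP => a /hw /hf ->. Qed.

Lemma scan_hreset M c w : all (predC is_hd) w ->
  exists m, scan (f_hreset c) m00 (hdr M ++ w) = (m, hdr (setm M c (ord_at n 0)) ++ w).
Proof.
move=> hw; have [|||m _ e] := @scan_hdr (f_hreset c) M (setm M c (ord_at n 0)) m00
  (fun i m => test1 m = (i != 0)) w; last by exists m.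
- by [].
- move=> i m hm; exists (true, false, false, false) => //=.
  by rewrite hm negbK (@hput_set M c (ord_at n 0)) // ord_atE eq_sym.
- by apply: fix_nohd hw => m [|[]].
Qed.

Lemma scan_halive M c w : all (predC is_hd) w ->
  exists2 m, scan (f_halive c) m00 (hdr M ++ w) = (m, hdr M ++ w) & test1 m = (M c : bool).
Proof.
move=> hw; have [|||m hm e] := @scan_hdr (f_halive c) M M m00
  (fun i m => test1 m = if M c is Some i0 then i0 < i else false) w.
- by case: (M c).
- move=> i m hm; exists (test1 m || (M c == Some i), false, false, false).
    rewrite /test1 /= -/(test1 m) hm; case: (M c) => // i0.
    by rewrite some_ord_eq /=; lia.
  by rewrite /= hget_set.
- by apply: fix_nohd hw => m [|[]].
- by exists m => //; rewrite hm; case: (M c) => // i0; rewrite ltn_ord.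
Qed.

Lemma scan_hinc M c k w : all (predC is_hd) w -> M c = ord_at n k ->
  exists m, scan (f_hinc c) m00 (hdr M ++ w) = (m, hdr (setm M c (ord_at n k.+1)) ++ w).
Proof.
move=> hw eM; have [|||m _ e] := @scan_hdr (f_hinc c) M (setm M c (ord_at n k.+1)) m00
  (fun i m => test1 m = (i == k.+1)) w; last by exists m.
- by [].
- move=> i m hm; exists (M c == Some i, false, false, false) => /=.
    by rewrite /test1 /= eM ord_atE eqSS eq_sym.
  rewrite hget_set hm (@hput_set M c (ord_at n k.+1)) // ord_atE; exact: eq_sym.
- by apply: fix_nohd hw => m [|[]].
Qed.

Lemma hdr_ext M M' : M =1 M' -> hdr M = hdr M'.
Proof. by move=> e; rewrite /hdr !e. Qed.

Lemma runs_hloop c P M N (F : nat -> seq G) : M c = None ->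
  (forall k, all (predC is_hd) (F k)) ->
  (forall k : 'I_n, exists2 l, l <= N & runs P l
     (hdr (setm M c (Some k)) ++ F k) (hdr (setm M c (Some k)) ++ F k.+1)) ->
  exists2 l, l <= 2 + n * (N + 2) & runs (hloop c P) l (hdr M ++ F 0) (hdr M ++ F n).
Proof.
move=> Mc hF hP.
pose W : prg := while_prog m00 (f_halive c) test1 (seq_prog P (sweep_prog m00 (f_hinc c))).
have loop k j : k + j = n ->
    exists2 l, l <= 1 + j * (N + 2) & runs W l (hdr (setm M c (ord_at n k)) ++ F k) (hdr M ++ F n).
  elim: j k => [|j IH] k kn.
    rewrite addn0 in kn; exists 1 => //.
    have e0 : ord_at n k = None by rewrite /ord_at insubF // kn ltnn.
    have eM : hdr (setm M c (ord_at n k)) = hdr M.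
      by apply: hdr_ext => d; rewrite e0 /setm; case: eqP => // ->.
    rewrite eM kn; have [m e et] := scan_halive M c (hF n).
    by apply: runs_while_exit e _; rewrite et Mc.
  have kn' : k < n by lia.
  pose i := Ordinal kn'.
  have ei : ord_at n k = Some i by apply/eqP; rewrite ord_atE.
  have [m e et] := scan_halive (setm M c (Some i)) c (hF k).
  have [l1 le1 h1] := hP i.
  have [l2 le2 h2] := IH k.+1 (etrans (addSnnS _ _) kn).
  have [|m3 e3] := @scan_hinc (setm M c (Some i)) c k _ (hF k.+1).
    by rewrite /setm eqxx ei.
  have ee : hdr (setm (setm M c (Some i)) c (ord_at n k.+1)) = hdr (setm M c (ord_at n k.+1)).
    by apply: hdr_ext => d; rewrite /setm; case: eqP.
  rewrite ee in e3.
  exists ((l1 + 1) + l2).+1; first by rewrite mulSn; lia.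
  rewrite ei; apply: (runs_while_loop e _ (runs_seq h1 (runs_sweep e3)) h2).
  by rewrite et /setm eqxx.
have [l le h] := loop 0 n (add0n n).
have [m e] := scan_hreset M c (hF 0).
by exists (1 + l); [lia | exact: runs_seq (runs_sweep e) h].
Qed.
End Setup.

Section Input.
Variables (n : nat) (e m : rel 'I_n).

Definition env0 : env n := fun _ => None.
Definition store0 : store n := fun k =>
  if k == 0 then e else if k == 1 then m else fun _ _ => false.

Notation cell0 := (cell env0 store0).
Notation M0 := (fun _ : bool => None : option 'I_n).
Definition is_un (a : G) := if a is inr (Un _) then true else false.
Definition fixed_by_assign (a : G) := ~~ is_hd a && ~~ is_un a.
Definition un_cell b (i j : 'I_n) : G := inr (Un (store0 (b : bool) i j)).

Lemma cell0E b i j : cell0 b i j = inr (Cell b (val j == 0) ((val i == 0) && (val j == 0))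
  [ffun k : 'I_K => (val k == b) && store0 b i j] [ffun=> false] [ffun=> false]).
Proof.
rewrite /cell; congr (inr (Cell _ _ _ _ _ _)).
apply/ffunP => k; rewrite !ffunE /blk /store0.
by case: (val k) => [|[|k']]; case: b.
Qed.

Lemma scan_assign M (i j : 'I_n) b pre post : M false = Some i -> M true = Some j ->
  all fixed_by_assign pre -> all (predC is_hd) post ->
  exists l, scan (f_assign b) m00 (hdr M ++ pre ++ un_cell b i j :: post) =
            (l, hdr M ++ pre ++ cell0 b i j :: post).
Proof.
move=> Mi Mj hpre hpost; rewrite !(catA (hdr M)) scan_cat scan_cat.
have [|||l hl e1] := @scan_hdr n (f_assign b) M M m00
  (fun k l => l = if k == 0 then m00 else (true, val i == 0, val j == 0, false)) [::].
- by [].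
- move=> k l ->; rewrite Mi Mj !some_ord_eq; exists (true, val i == 0, val j == 0, false) => //.
  by case: eqP => [k0|k0] //=; rewrite [nat_of_ord k]k0.
- by [].
rewrite !cats0 in e1; rewrite e1 {e1} hl (_ : (n == 0) = false); last first.
  by apply/negbTE; rewrite -lt0n (leq_ltn_trans (leq0n i)).
set l1 := (true, _, _, _).
rewrite scan_fix; last first.
  apply: sub_all hpre => a; rewrite /fixed_by_assign.
  by case: a => [x|[p q||x|b' r s t u v||]] //= _; rewrite eqxx.
rewrite [scan _ _ (_ :: _)]/= scan_fix; last first.
  by apply: sub_all hpost => a; case: a => [x|[p q||x|b' r s t u v||]] //= _; rewrite eqxx.
by exists (true, val i == 0, val j == 0, true); rewrite cell0E.
Qed.

Lemma runs_assign_row M (i : 'I_n) b pre post : M false = Some i -> M true = None ->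
  all fixed_by_assign pre -> all (predC is_hd) post ->
  exists2 l, l <= 2 + n * 3 & runs (hloop true (sweep_prog m00 (f_assign b))) l
    (hdr M ++ pre ++ [seq un_cell b i j | j <- enum 'I_n] ++ post)
    (hdr M ++ pre ++ [seq cell0 b i j | j <- enum 'I_n] ++ post).
Proof.
move=> Mi Mj hpre hpost.
pose F k := pre ++ [seq cell0 b i j | j <- take k (enum 'I_n)] ++
                   [seq un_cell b i j | j <- drop k (enum 'I_n)] ++ post.
have hF k : all (predC is_hd) (F k).
  rewrite !all_cat hpost !all_map; apply/and4P; split=> //; try exact/allP.
  by apply: sub_all hpre => a /andP[].
have [|l hl] := @runs_hloop n true (sweep_prog m00 (f_assign b)) M 1 F Mj hF.
- move=> k; exists 1 => //; rewrite /F (drop_nth k) ?size_enum_ord // (take_nth k) ?size_enum_ord //.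
  rewrite nth_ord_enum map_rcons cat_rcons /= !(catA pre).
  have [||||l e1] := @scan_assign (setm M true (Some k)) i k b
      (pre ++ [seq cell0 b i j | j <- take k (enum 'I_n)])
      ([seq un_cell b i j | j <- drop k.+1 (enum 'I_n)] ++ post); rewrite /setm //.
  + by rewrite all_cat hpre all_map; apply/allP => j _; rewrite /= cell0E.
  + by rewrite all_cat hpost andbT all_map; apply/allP.
  + by apply: runs_sweep e1.
- rewrite /F take0 drop0 take_oversize ?size_enum_ord // drop_oversize ?size_enum_ord //.
  by exists l.
Qed.

Lemma runs_assign_block b pre post :
  all fixed_by_assign pre -> all (predC is_hd) post ->
  exists2 l, l <= 2 + n * (4 + n * 3) & runs (hloop false (hloop true (sweep_prog m00 (f_assign b)))) l
    (hdr M0 ++ pre ++ [seq un_cell b i j | i <- enum 'I_n, j <- enum 'I_n] ++ post)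
    (hdr M0 ++ pre ++ block env0 store0 b ++ post).
Proof.
move=> hpre hpost.
pose F k := pre ++ [seq cell0 b i j | i <- take k (enum 'I_n), j <- enum 'I_n] ++
                   [seq un_cell b i j | i <- drop k (enum 'I_n), j <- enum 'I_n] ++ post.
have hc s : all fixed_by_assign [seq cell0 b i j | i <- s, j <- enum 'I_n].
  by apply/allP => a /allpairsP[[i j] [_ _ ->]]; rewrite /= cell0E.
have hu s : all (predC is_hd) [seq un_cell b i j | i <- s, j <- enum 'I_n].
  by apply/allP => a /allpairsP[[i j] [_ _ ->]].
have sub s : all fixed_by_assign s -> all (predC is_hd) s by apply: sub_all => a /andP[].
have hF k : all (predC is_hd) (F k) by rewrite !all_cat hpost hu !sub.
have [|l hl] := @runs_hloop n false (hloop true (sweep_prog m00 (f_assign b))) M0 (2 + n * 3) F erefl hF.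
- move=> k; rewrite /F (drop_nth k) ?size_enum_ord // (take_nth k) ?size_enum_ord //.
  rewrite nth_ord_enum allpairs_rcons allpairs_cons -!catA !(catA pre).
  by apply: runs_assign_row => //; rewrite all_cat ?hpre ?hc // hu hpost.
- rewrite /F take0 drop0 take_oversize ?size_enum_ord // drop_oversize ?size_enum_ord //.
  by exists l => //; lia.
Qed.

Lemma hdr_none : hdr M0 = nseq n (inr (Hd false false)).
Proof.
rewrite /hdr -[in RHS](size_enum_ord n); set h := fun i => _.
rewrite -(size_map h); apply/all_pred1P.
by rewrite all_map; apply/allP => i _ /=.
Qed.

Lemma runs_setup : exists2 l, l <= 1 + 2 * (2 + n * (4 + n * 3)) &
  runs setup l (map inl (enc e m)) (tape env0 store0).
Proof.
have e1 : scan f_mark m00 (map inl (enc e m)) = ((true, false, false, false),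
    hdr M0 ++ [:: inr Sep] ++ [seq un_cell false i j | i <- enum 'I_n, j <- enum 'I_n] ++
    [seq un_cell true i j | i <- enum 'I_n, j <- enum 'I_n]).
  rewrite hdr_none.
  rewrite /enc !map_cat map_nseq.
  have seen bs : scan f_mark (true, false, false, false) (map inl bs) =
      ((true, false, false, false), [seq inr (Un b) | b <- bs]) by elim: bs => //= x bs ->.
  have -> : [seq un_cell false i j | i <- enum 'I_n, j <- enum 'I_n] ++
      [seq un_cell true i j | i <- enum 'I_n, j <- enum 'I_n] =
      [seq inr (Un b) | b <- [seq e i j | i <- enum 'I_n, j <- enum 'I_n] ++
                             [seq m i j | i <- enum 'I_n, j <- enum 'I_n]].
    by rewrite map_cat !map_allpairs.
  rewrite -map_cat; pose bs := [seq e i j | i <- enum 'I_n, j <- enum 'I_n] ++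
                            [seq m i j | i <- enum 'I_n, j <- enum 'I_n].
  rewrite -/bs.
  have gen k : scan f_mark m00 (nseq k (inl true) ++ [:: inl false] ++ map inl bs) =
      ((true, false, false, false),
       nseq k (inr (Hd false false)) ++ [:: inr Sep] ++ [seq inr (Un b) | b <- bs]).
    by elim: k => [|k IH] /=; rewrite ?seen // IH.
  exact: gen.
have fs b : all fixed_by_assign (block env0 store0 b).
  by apply/allP => a /allpairsP[[i j] [_ _ ->]]; rewrite /= cell0E.
have [||l2 le2 h2] := @runs_assign_block false [:: inr Sep]
  [seq un_cell true i j | i <- enum 'I_n, j <- enum 'I_n] => //.
  by apply/allP => a /allpairsP[[i j] [_ _ ->]].
have [||l3 le3 h3] := @runs_assign_block true ([:: inr Sep] ++ block env0 store0 false) [::] => //.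
  by rewrite all_cat fs.
exists (1 + (l2 + l3)); first by lia.
apply: (runs_seq (runs_sweep e1)); apply: (runs_seq h2).
rewrite -!catA !cats0 in h3.
have -> : tape env0 store0 = hdr M0 ++ [:: inr Sep] ++ block env0 store0 false ++ block env0 store0 true.
  by rewrite hdr_none.
exact: h3.
Qed.
End Input.

Definition out_bit n (R : store n) k (j : 'I_n) :=
  [forall i : 'I_n, (val i == 0) ==> ~~ R k i j].
Definition out_bits (one : bool) n (R : store n) k : seq bool :=
  if one then [:: [forall j : 'I_n, (val j == 0) ==> out_bit R k j]]
  else [seq out_bit R k j | j <- enum 'I_n].

Definition is_cut (a : G) := if a is inr Cut then true else false.

Definition out_cell (one : bool) k n (R : store n) (b : bool) (i j : 'I_n) : G :=
  if [&& ~~ b, val i == 0 & one ==> (val j == 0)] then inl (~~ R k i j) else inr Junk.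

Lemma out_cell_first one k n (R : store n) : 0 < n -> exists w,
  [seq out_cell one k R false i j | i <- enum 'I_n, j <- enum 'I_n] =
    map inl (out_bits one R k) ++ w /\ forall a, a \in w -> a = inr Junk.
Proof.
case: n R => // n R _.
have oE j : out_bit R k j = ~~ R k ord0 j.
  apply/forallP/idP => [/(_ ord0)|h i]; first by [].
  by apply/implyP => /eqP i0; rewrite (_ : i = ord0) //; apply: val_inj.
pose w' := [seq out_cell one k R false i j | i <- [seq lift ord0 i | i <- enum 'I_n], j <- enum 'I_n.+1].
have hw' a : a \in w' -> a = inr Junk.
  by case/allpairsP => -[i j] [/= /mapP[i' _ ->] _ ->].
have -> : [seq out_cell one k R false i j | i <- enum 'I_n.+1, j <- enum 'I_n.+1] =
    [seq out_cell one k R false ord0 j | j <- enum 'I_n.+1] ++ w'.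
  by rewrite -(allpairs_cons _ ord0) -enum_ordSl.
case: one @w' hw' => w' hw'; last first.
  exists w'; split=> //; congr (_ ++ _); rewrite [RHS]/= -map_comp; apply: eq_map => j.
  by rewrite /out_cell /= oE.
exists ([seq out_cell true k R false ord0 j | j <- [seq lift ord0 i | i <- enum 'I_n]] ++ w'); split.
  rewrite enum_ordSl /=; congr (_ :: _); rewrite /out_cell /=; congr inl.
  apply/idP/forallP => [h j|/(_ ord0)]; last by rewrite /= oE.
  by apply/implyP => /eqP j0; rewrite oE (_ : j = ord0) //; apply: val_inj.
move=> a; rewrite mem_cat => /orP[/mapP[j /mapP[j' _ ->] ->] //|]; exact: hw'.
Qed.

Lemma scan_out one k n (rho : env n) (R : store n) : k < K -> blk k = false -> exists w1 w2 l,
  [/\ scan (f_out one k) m00 (tape rho R) = (l, w1 ++ map inl (out_bits one R k) ++ w2),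
      all (predC is_cut) (map inl (out_bits one R k) ++ w2), cut_at is_cut w1 & no_bit w2].
Proof.
move=> kK kb.
pose c' := @out_cell one k n R.
pose Inv (b : bool) i j (l : mem4) := 0 < j -> test1 l = ~~ b && (i == 0).
have hc b (i j : 'I_n) l : Inv b i j l -> exists2 l', Inv b i j.+1 l' &
    f_out one k l (cell rho R b i j) = (l', c' b i j).
  move=> hl; exists (~~ b && (val i == 0), true, false, false) => //.
  have er : (if val j == 0 then (val i == 0) && (val j == 0) && ~~ b else test1 l) = ~~ b && (val i == 0).
    case e0: (val j == 0); first by rewrite andbT andbC.
    by apply: hl; rewrite lt0n [_ == _]e0.
  rewrite /f_out /cell er (bgetE (fun l => (blk l == b) && R l i j)) // kb /c' /out_cell andbA.
  by case: ifP => // /andP[/andP[/negbTE-> _] _].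
have hrow b (i : 'I_n) l : Inv b i n l -> Inv b i.+1 0 l by [].
have nbj (w : seq G) : (forall a, a \in w -> a = inr Junk) -> no_bit w.
  by case: w => // a w hw; rewrite (hw a (mem_head _ _)).
have hj2 a : a \in [seq c' true i j | i <- enum 'I_n, j <- enum 'I_n] -> a = inr Junk.
  by case/allpairsP => -[i j] [_ _ ->]; rewrite /c' /out_cell.
have junk2 : all (predC is_cut) [seq c' true i j | i <- enum 'I_n, j <- enum 'I_n].
  by apply/allP => a /hj2 ->.
case: (posnP n) => [n0|npos].
  have e0 : enum 'I_n = [::] by apply: size0nil; rewrite size_enum_ord.
  have -> : tape rho R = [:: inr Sep].
    by rewrite /tape /block {1}n0 e0.
  have eb : out_bits one R k = if one then [:: true] else [::].
    rewrite /out_bits e0; case: (one) => //=; congr [:: _]; apply/forallP => j.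
    by have := leq_ltn_trans (leq0n j) (ltn_ord j); move=> h; have := leq_trans h (eq_leq n0).
  rewrite eb; case: (one).
    by exists [::], [::], m00.
  by exists [:: inr Cut], [::], m00.
have [l1 _ e1] := @scan_block n _ (cell rho R false) (c' false) _ (hc false) (hrow false)
   (false, true, false, false) (fun h => match notF h with end).
have [l2 _ e2] := @scan_block n _ (cell rho R true) (c' true) _ (hc true) (hrow true)
   l1 (fun h => match notF h with end).
have eH : scan (f_out one k) m00 (nseq n (inr (Hd false false))) =
    ((false, true, false, false), nseq n (inr Cut)).
  have eH' j : scan (f_out one k) (false, true, false, false) (nseq j (inr (Hd false false))) =
    ((false, true, false, false), nseq j (inr Cut)) by elim: j => //= j ->.
  by rewrite -(prednK npos) /= eH'.
have [w [ew hw]] := out_cell_first one k R npos.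
exists (nseq n (inr Cut) ++ [:: inr Cut]), (w ++ [seq c' true i j | i <- enum 'I_n, j <- enum 'I_n]), l2.
split.
- rewrite /tape scan_cat eH [scan _ _ (_ :: _)]/= scan_cat.
  have -> : (if one && ~~ true then inl true else inr Cut) = inr Cut :> G by rewrite andbF.
  by rewrite /block e1 e2 ew -!catA.
- rewrite !all_cat junk2 andbT; apply/andP; split; first by rewrite all_map; apply/allP.
  by apply/allP => a /hw ->.
- by rewrite /cut_at rev_cat.
- by apply: nbj => a; rewrite mem_cat => /orP[/hw|/hj2].
Qed.
Theorem lang_computable (one : bool) k c : k < K -> blk k = false -> wf c ->
  exists (T : TM) (a d : nat), forall n (e m : rel 'I_n),
    computes_within T (enc e m) (a * (size (enc e m)).+1 ^ d)
      (out_bits one (eval c (@env0 n) (store0 e m)) k).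
Proof.
move=> kK kb wc.
have [a [d hcost]] := cost_poly c.
(* Setup and output take at most 20 (n+1)^2 sweeps and the program a (n+1)^d, together at most (20 +
   a) (n+1)^(d+2). A sweep costs at most 3 (size + 1) steps, whence the factor 3 and one more
   power. *)
exists (TM_of (full_prog one k c) is_cut), ((20 + a) * 3), (d + 3) => n e m.
set R := eval c _ _.
have [l1 le1 h1] := runs_setup e m.
have [l2 le2 h2] := @runs_compile n c (@env0 n) (store0 e m) wc (fun _ _ => erefl).
have [w1 [w2 [l3 [h3 hns hcut hnb]]]] := @scan_out one k n (@env0 n) R kK kb.
have hr : runs (full_prog one k c) (l1 + (l2 + 1)) (map inl (enc e m))
    (w1 ++ map inl (out_bits one R k) ++ w2).
  exact: runs_seq h1 (runs_seq h2 (runs_sweep h3)).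
have sz : n.+1 <= size (enc e m) by rewrite /enc !size_cat size_nseq /=; lia.
apply: (runs_computes _ hr hns hcut hnb); first by case: (enc e m) sz.
have hp : l1 + (l2 + 1) <= (20 + a) * n.+1 ^ (d + 2).
  have q1 : l2 <= a * n.+1 ^ d by exact: leq_trans le2 (hcost n).
  have q2 : 0 < n.+1 ^ d by rewrite expn_gt0.
  rewrite expnD; move: (n.+1 ^ d) q1 q2 => q q1 q2.
  have : l1 + 1 <= 20 * n.+1 ^ 2 by nia.
  nia.
have : n.+1 ^ (d + 2) <= (size (enc e m)).+1 ^ (d + 2).
  by rewrite leq_exp2r ?addn2 // ltnW.
rewrite (_ : d + 3 = (d + 2).+1) ?expnS; last by lia.
move: (n.+1 ^ (d + 2)) ((size (enc e m)).+1 ^ (d + 2)) hp => p q hp hpq.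
move: (size (enc e m)) (l1 + (l2 + 1)) hp => s t hp.
have {}hp : t <= (20 + a) * q by apply: leq_trans hp _; rewrite leq_mul2l hpq orbT.
by rewrite mulnA -(mulnA (20 + a)) mulnAC; apply: leq_mul => //; lia.
Qed.
End Lang.

(** * The auction algorithm *)

Section Loops.
Variables (T : eqType) (U : Type).
Implicit Types (f : U -> T -> U) (s : seq T).

(** For loops used as searches: the body idles until the first hit, and its action there disables
    all later rounds. The condition [c] refers to the initial state, which is unchanged up to the
    hit. *)
Lemma foldl_first f (c : pred T) u s :
  (forall x, x \in s -> ~~ c x -> f u x = u) ->
  (forall x y, x \in s -> c x -> y \in s -> f (f u x) y = f u x) ->
  (foldl f u s = u /\ forall x, x \in s -> ~~ c x) \/
  exists s1 x s2, [/\ s = s1 ++ x :: s2, {in s1, forall y, ~~ c y}, c x & foldl f u s = f u x].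
Proof.
elim: s => [|x s IH] hn hc; first by left.
case cx: (c x).
  right; exists [::], x, s; split=> //=.
  have : {in s, forall y, f (f u x) y = f u x}.
    by move=> y ys; apply: hc; rewrite ?mem_head // inE ys orbT.
  elim: s {IH hn hc} => //= y s IH h; rewrite h ?mem_head // IH // => z zs.
  by apply: h; rewrite inE zs orbT.
have ex : f u x = u by apply: hn; rewrite ?mem_head ?cx.
have [||[e h]|[s1 [y [s2 [es h1 cy e]]]]] := IH.
- by move=> y ys; apply: hn; rewrite inE ys orbT.
- by move=> y z ys cy zs; apply: hc => //; rewrite inE ?ys ?zs orbT.
- left; split; first by rewrite /= ex.
  by move=> y; rewrite inE => /orP[/eqP-> | /h //]; rewrite cx.
right; exists (x :: s1), y, s2; split; rewrite /= ?es ?ex -?es //.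
by move=> z; rewrite inE => /orP[/eqP-> | /h1 //]; rewrite cx.
Qed.

Lemma foldl_inv f (P : seq T -> U -> Prop) s u :
  (forall s1 x s2 u, s = s1 ++ x :: s2 -> P s1 u -> P (rcons s1 x) (f u x)) ->
  P [::] u -> P s (foldl f u s).
Proof.
move=> hf hu; suff gen s1 s2 v : s = s1 ++ s2 -> P s1 v -> P s (foldl f v s2).
  exact: (gen [::] s u).
elim: s2 s1 v => [|x s2 IH] s1 v; first by rewrite cats0 => ->.
move=> es hv; apply: (IH (rcons s1 x)); first by rewrite cat_rcons.
exact: hf es hv.
Qed.

Lemma foldl_inv1 f (P : U -> Prop) s u :
  (forall x u, x \in s -> P u -> P (f u x)) -> P u -> P (foldl f u s).
Proof.
move=> h; apply: (@foldl_inv f (fun _ => P)) => s1 x s2 v es; apply: h.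
by rewrite es mem_cat mem_head orbT.
Qed.

Lemma foldl_count f (P : nat -> U -> Prop) d s k u :
  (forall x k u, P k u -> P (k + d) (f u x)) -> P k u -> P (k + size s * d) (foldl f u s).
Proof.
move=> h; elim: s k u => [|x s IH] k u hk /=; first by rewrite mul0n addn0.
by rewrite mulSn addnA; apply: IH; apply: h.
Qed.
End Loops.

Lemma enum_ord_before n (s1 s2 : seq 'I_n) (i j : 'I_n) :
  enum 'I_n = s1 ++ i :: s2 -> j < i -> j \in s1.
Proof.
move=> e ji; have := index_enum_ord j; have := index_enum_ord i; rewrite e.
have u : uniq (s1 ++ i :: s2) by rewrite -e enum_uniq.
have ni : i \notin s1 by move: u; rewrite cat_uniq /= => /and3P[_ /norP[]].
rewrite !index_cat (negbTE ni) /= eqxx addn0 => ei.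
by case: (j \in s1) => // ej; move: ji; rewrite -ej -ei; lia.
Qed.

(** * Commands that only enlarge one relation *)

Section Adds.
Variable n : nat.
Implicit Types (rho : env n) (R : store n).

Definition addr R k (Q : rel 'I_n) : store n := setr R k (fun a b => R k a b || Q a b).

Lemma relext (Q Q' : rel 'I_n) : (forall a b, Q a b = Q' a b) -> Q = Q'.
Proof. by move=> h; do 2! apply: functional_extensionality => ?. Qed.

Lemma setr_eq R k Q : setr R k Q k = Q.
Proof. by rewrite /setr eqxx. Qed.

Lemma setr_ne R k l Q : l != k -> setr R k Q l = R l.
Proof. by rewrite /setr => /negbTE->. Qed.

Lemma addr_addr R k Q Q' : addr (addr R k Q) k Q' = addr R k (fun a b => Q a b || Q' a b).
Proof.
apply: functional_extensionality => l; rewrite /addr /setr.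
by case: eqP => // _; rewrite eqxx; apply: relext => a b; rewrite orbA.
Qed.

Lemma addr0 R k : addr R k (fun _ _ => false) = R.
Proof.
apply: functional_extensionality => l; rewrite /addr /setr.
by case: eqP => [->|//]; apply: relext => a b; rewrite orbF.
Qed.

(** The second clause makes the pairs added independent of those added to [k] before; therefore a
    loop accumulates the union over its rounds. *)
Definition adds c k (Q : env n -> store n -> rel 'I_n) :=
  (forall rho R, eval c rho R = addr R k (Q rho R)) /\
  (forall rho R Z, Q rho (addr R k Z) = Q rho R).

Fixpoint batoms E :=
  match E with
  | Atom k _ _ => [:: k]
  | Not E => batoms E
  | And E F | Or E F => batoms E ++ batoms F
  end.

Lemma beval_addr E rho R k Z : k \notin batoms E -> beval E rho (addr R k Z) = beval E rho R.
Proof.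
elim: E => [l x y|E IH|E IHE F IHF|E IHE F IHF] /=.
- by rewrite inE eq_sym => kl; rewrite /addr setr_ne.
- by move=> /IH ->.
- by rewrite mem_cat => /norP[/IHE-> /IHF->].
- by rewrite mem_cat => /norP[/IHE-> /IHF->].
Qed.

Lemma adds_set E k x y : k \notin batoms E ->
  adds (If E (Set_ k x y true) Skip) k
    (fun rho R a b => [&& beval E rho R, rho x == Some a & rho y == Some b]).
Proof.
move=> kE; split=> rho R; last by move=> Z; apply: relext => a b; rewrite beval_addr.
rewrite /=; case: (beval E rho R); last by rewrite addr0.
case: (rho x) => [i|]; last by rewrite addr0.
case: (rho y) => [j|]; last by rewrite -[LHS](addr0 R k); congr addr; apply: relext => a b; rewrite andbF.
congr setr; apply: relext => a b; rewrite /= !(inj_eq Some_inj) (eq_sym i) (eq_sym j).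
by case: (_ && _); rewrite ?orbT ?orbF.
Qed.

Lemma adds_set1 k x y : adds (Set_ k x y true) k
    (fun rho R a b => (rho x == Some a) && (rho y == Some b)).
Proof.
split=> rho R //=.
case: (rho x) => [i|]; last by rewrite addr0.
case: (rho y) => [j|]; last by rewrite -[LHS](addr0 R k); congr addr; apply: relext => a b; rewrite andbF.
congr setr; apply: relext => a b; rewrite /= !(inj_eq Some_inj) (eq_sym i) (eq_sym j).
by case: (_ && _); rewrite ?orbT ?orbF.
Qed.

Lemma adds_for x c k Q : adds c k Q ->
  adds (For x c) k (fun rho R a b => [exists i, Q (setv rho x (Some i)) R a b]).
Proof.
move=> [e h]; split=> rho R; last first.
  by move=> Z; apply: relext => a b; apply: eq_existsb => i; rewrite h.
have gen s Z : foldl (fun R i => eval c (setv rho x (Some i)) R) (addr R k Z) s =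
    addr R k (fun a b => Z a b || has (fun i => Q (setv rho x (Some i)) R a b) s).
  elim: s Z => [|i s IH] Z /=; first by congr addr; apply: relext => a b; rewrite orbF.
  by rewrite e addr_addr h IH; congr addr; apply: relext => a b; rewrite orbA.
rewrite /= -{1}(addr0 R k) gen; congr addr; apply: relext => a b /=.
apply/hasP/existsP => [[i _ hi]|[i hi]]; first by exists i.
by exists i; rewrite ?mem_enum.
Qed.
End Adds.

(* [N] is a matching from the rows to the columns of the matrix [h], together with a
   vertex cover of the same size. *)
Definition konig (T : finType) (h N : rel T) :=
  [/\ (forall x y z, N x y -> N x z -> y = z) /\ (forall x y z, N x z -> N y z -> x = y),
      subrel N h &
      exists A B : {set T}, (forall x y, h x y -> (x \in A) || (y \in B)) /\
        #|A| + #|B| <= npairs N].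

(** * Bids, prices and the resulting vertex cover *)

Section Auction.

Definition seqs (s : seq cmd) : cmd := foldr Seq Skip s.

(* Vertex [x] (variable 2) without partner bids for a neighbour [y] of least price, and
   is matched to [y] in place of the former partner of [y]; the price of [y] goes up by
   one. Relation [P y l] means that [l] is below the price of [y]. *)
Definition bid h N P F : cmd :=
  seqs [:: Set_ F 2 2 true;
    For 3 (If (Atom N 2 3) (Set_ F 2 2 false) Skip);
    For 4 (For 3 (If (And (Atom F 2 2) (And (Atom h 2 3) (Not (Atom P 3 4))))
      (seqs [:: Set_ F 2 2 false; For 5 (Set_ N 5 3 false); Set_ N 2 3 true; Set_ P 3 4 true])
      Skip))].

(** The variables 0 and 1 only count n * n rounds. A round that changes anything raises the sum of
    the n prices, each of which is at most n. *)
Definition auction h N P F : cmd := For 0 (For 1 (For 2 (bid h N P F))).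

Variables (h N P F : nat).
Hypothesis hNPF : uniq [:: h; N; P; F].
Variable n : nat.
Implicit Types (rho : env n) (R : store n) (x y z l : 'I_n).

Definition frame3 R R' := forall k, k \notin [:: N; P; F] -> R' k = R k.

Lemma frame3_trans R1 R2 R3 : frame3 R1 R2 -> frame3 R2 R3 -> frame3 R1 R3.
Proof. by move=> h1 h2 k hk; rewrite h2 // h1. Qed.

Let neqs : [/\ h != N, h != P & h != F] /\ [/\ N != P, N != F & P != F].
Proof.
by move: hNPF; rewrite /= !inE !negb_or => /and4P[/and3P[-> -> ->] /andP[-> ->] ->].
Qed.

Definition no_bid R R' x :=
  [/\ R' N = R N, R' P = R P & [exists y, R N x y] || [forall y, forall l, R h x y ==> R P y l]].
Definition good_bid R R' x := exists y l,
  [/\ (forall z, ~~ R N x z) /\ R h x y, ~~ R P y l,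
      (forall z l', R h x z -> l' < l -> R P z l'),
      R' N = (fun a b => if b == y then a == x else R N a b) &
      R' P = (fun a b => R P a b || (a == y) && (b == l))].

Lemma upd_eq R k i j b a c : upd R k i j b k a c = if (a == i) && (c == j) then b else R k a c.
Proof. by rewrite /upd setr_eq. Qed.
Lemma upd_ne R k i j b k' : k' != k -> upd R k i j b k' = R k'.
Proof. by move=> kk; rewrite /upd setr_ne. Qed.

Lemma upd_idem R k i j b : upd (upd R k i j b) k i j b = upd R k i j b.
Proof.
apply: functional_extensionality => k'; rewrite {1}/upd /setr; case: eqP => [->|//].
by apply: relext => a c; rewrite !upd_eq; case: (_ && _).
Qed.

Lemma eval_bid rho R x :
  let R' := eval (bid h N P F) (setv rho 2 (Some x)) R in frame3 R R' /\ (no_bid R R' x \/ good_bid R R' x).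
Proof.
have [[hN hP hF] [NP NF PF]] := neqs.
rewrite /bid /setv /=.
set R1 := upd R F x x true.
have r1 : R1 N = R N by rewrite /R1 upd_ne.
set R2 := foldl _ R1 _.
have [f2 n2 p2 fl2] : [/\ frame3 R R2, R2 N = R N, R2 P = R P & R2 F x x = ~~ [exists y, R N x y]].
  have [||[e hn]|[s1 [y [s2 [_ _ cy e]]]]] := @foldl_first 'I_n (store n)
     (fun R0 i => if R0 N x i then upd R0 F x x false else R0) (R N x) R1 (enum 'I_n).
  - by move=> y _ /negbTE; rewrite r1 => ->.
  - move=> y z _ cy _; rewrite r1 cy upd_ne // r1.
    by rewrite upd_idem if_same.
  - have -> : R2 = R1 by exact: e.
    rewrite /R1; split; [|by rewrite upd_ne|by rewrite upd_ne|rewrite upd_eq !eqxx /=].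
      by move=> k; rewrite !inE !negb_or => /and3P[_ _ kF]; rewrite upd_ne.
    by apply/esym/existsPn => y; apply: hn; rewrite mem_enum.
  - have -> : R2 = upd R1 F x x false by rewrite [R2]e r1 cy.
    rewrite /R1; split; [|by rewrite !upd_ne|by rewrite !upd_ne|rewrite upd_eq !eqxx /=].
      by move=> k; rewrite !inE !negb_or => /and3P[_ _ kF]; rewrite !upd_ne.
    by apply/esym/negbTE; rewrite negbK; apply/existsP; exists y.
(* A successful bid on [y] at level [l]. It clears the flag [F] at [x], so the search condition [c]
   fails from then on and [foldl_first] applies to both nested loops. *)
pose act R0 y l := upd (upd (foldl (fun R1 i => upd R1 N i y false) (upd R0 F x x false)
   (enum 'I_n)) N x y true) P y l true.
pose c R0 l y := R0 F x x && (R0 h x y && ~~ R0 P y l).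
set g := (X in frame3 R (foldl X _ _)).
have eg R0 l : g R0 l = foldl (fun R1 y => if c R1 l y then act R1 y l else R1) R0 (enum 'I_n).
  by [].
have actN R0 y l : act R0 y l N = (fun a b => if b == y then a == x else R0 N a b).
  apply: relext => a b; rewrite /act upd_ne // upd_eq.
  have -> Z : foldl (fun R1 i => upd R1 N i y false) Z (enum 'I_n) N a b = (b != y) && Z N a b.
    have gen s : foldl (fun R1 i => upd R1 N i y false) Z s N a b = ~~ ((a \in s) && (b == y)) && Z N a b.
      elim: s Z => [|i s IH] Z //=; rewrite IH upd_eq inE.
      by case: (a == i); case: (b == y); rewrite /= ?andbF ?andbT.
    by rewrite gen mem_enum.
  by rewrite upd_ne //; case: (b == y); case: (a == x).
have act_ne R0 y l k : k != N -> k != P -> k != F -> act R0 y l k = R0 k.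
  move=> kN kP kF; rewrite /act !upd_ne //.
  have -> Z : foldl (fun R1 i => upd R1 N i y false) Z (enum 'I_n) k = Z k.
    by apply: (foldl_inv1 (P := fun Z' => Z' k = Z k)) => // i Z' _ <-; rewrite upd_ne.
  by rewrite upd_ne.
have actF R0 y l : act R0 y l F x x = false.
  rewrite /act (upd_ne _ _ _ _ (_ : F != P)) ?(eq_sym F) // (upd_ne _ _ _ _ (_ : F != N)) ?(eq_sym F) //.
  have -> Z : foldl (fun R1 i => upd R1 N i y false) Z (enum 'I_n) F = Z F.
    by apply: (foldl_inv1 (P := fun Z' => Z' F = Z F)) => // i Z' _ <-; rewrite upd_ne // eq_sym.
  by rewrite upd_eq !eqxx.
have actP R0 y l : act R0 y l P = (fun a b => R0 P a b || (a == y) && (b == l)).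
  have PN : P != N by rewrite eq_sym.
  apply: relext => a b; rewrite /act upd_eq upd_ne //.
  have -> Z : foldl (fun R1 i => upd R1 N i y false) Z (enum 'I_n) P = Z P.
    by apply: (foldl_inv1 (P := fun Z' => Z' P = Z P)) => // i Z' _ <-; rewrite upd_ne // eq_sym.
  by rewrite upd_ne //; case: (_ && _); rewrite ?orbT ?orbF.
have inner R0 l : (g R0 l = R0 /\ forall y, ~~ c R0 l y) \/
    exists2 y, c R0 l y & g R0 l = act R0 y l.
  rewrite eg; have [||[e hn]|[s1 [y [s2 [_ _ cy e]]]]] := @foldl_first 'I_n (store n)
     (fun R1 y => if c R1 l y then act R1 y l else R1) (c R0 l) R0 (enum 'I_n).
  - by move=> y _ /negbTE->.
  - by move=> y z _ cy _; rewrite cy {1}/c actF.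
  - by left; split=> // y; apply: hn; rewrite mem_enum.
  - by right; exists y; rewrite // e cy.
have fact R0 y l : frame3 R0 (act R0 y l).
  by move=> k; rewrite !inE !negb_or => /and3P[kN kP kF]; rewrite act_ne.
(* Levels are tried in increasing order, so the first hit is the least price among the neighbours of
   [x]. *)
have [||[-> hn]|[s1 [l [s2 [es hs cl e]]]]] := @foldl_first 'I_n (store n) g
   (fun l => [exists y, c R2 l y]) R2 (enum 'I_n).
- by move=> l _ /existsPn hn; case: (inner R2 l) => [[]|[y cy]] //; rewrite (negbTE (hn y)) in cy.
- move=> l l' _ /existsP[y cy] _; case: (inner R2 l) => [[_ /(_ y)]|[z cz e]]; first by rewrite cy.
  case: (inner (g R2 l) l') => [[]|[t]] //.
  by rewrite e {1}/c actF.
- split=> //; left; split=> //.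
  case ex: [exists y, R N x y] => //=; apply/forallP => y; apply/forallP => l.
  have /existsPn/(_ y) := hn l (mem_enum _ l); rewrite /c fl2 ex p2 f2 ?inE ?negb_or ?hN ?hP ?hF //=.
  by rewrite negb_and negbK implybE.
have [[_ hn]|[y cy e']] := inner R2 l; first by case/existsP: cl => y; rewrite (negbTE (hn y)).
rewrite e e'; split; first exact: frame3_trans f2 (fact _ _ _).
right; exists y, l; move: cy; rewrite /c fl2 p2 f2 ?inE ?negb_or ?hN ?hP ?hF //.
case/andP => /existsPn nx /andP[hxy nP]; split=> //.
- move=> z l' hxz l'l; have l's := enum_ord_before es l'l.
  have /existsPn/(_ z) := hs l' l's; rewrite /c fl2 p2 f2 ?inE ?negb_or ?hN ?hP ?hF //.
  have -> : ~~ [exists y, R N x y] by apply/existsPn.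
  by rewrite hxz negbK.
- by rewrite actN n2.
- by rewrite actP p2.
Qed.
Definition stuck R x := [exists y, R N x y] || [forall y, forall l, R h x y ==> R P y l].

(** The last two clauses are complementary slackness with bid increment one: a column of positive
    price is taken, and a matched row holds a column at most one above its cheapest neighbour. *)
Definition auction_inv R (p : 'I_n -> nat) :=
  [/\ (forall y l, R P y l = (l < p y)) /\ (forall y, p y <= n),
      (forall x y z, R N x y -> R N x z -> y = z) /\ (forall x y z, R N x z -> R N y z -> x = y),
      subrel (R N) (R h),
      (forall y, 0 < p y -> exists x, R N x y) &
      (forall x y z, R N x y -> R h x z -> p y <= (p z).+1)].

Lemma auction_inv_frame R R' p : frame3 R R' -> R' N = R N -> R' P = R P ->
  auction_inv R p -> auction_inv R' p.
Proof.
have [[hN hP hF] _] := neqs.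
by move=> f eN eP; rewrite /auction_inv eN eP f // !inE !negb_or hN hP hF.
Qed.

Lemma good_bid_inv R R' x p : frame3 R R' -> good_bid R R' x -> auction_inv R p ->
  exists2 p', auction_inv R' p' & \sum_y p y < \sum_y p' y.
Proof.
have [[hN hP hF] _] := neqs.
move=> f [y [l [[nx hxy] nP hl eN eP]]] [[Pp pn] [fN iN] sN aN cN].
have eh : R' h = R h by rewrite f // !inE !negb_or hN hP hF.
(* If the price were below [l], the search would have succeeded at that lower level. *)
have py : p y = l.
  apply/eqP; rewrite eqn_leq leqNgt -Pp nP /= leqNgt; apply/negP => pl.
  have pn' : p y < n by exact: ltn_trans pl (ltn_ord l).
  by have := hl y (Ordinal pn') hxy pl; rewrite Pp ltnn.
exists (fun z => if z == y then (p z).+1 else p z); last first.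
  rewrite (bigD1 y) //= [X in _ < X](bigD1 y) //= eqxx addSn ltnS.
  by rewrite leq_add2l leq_eqVlt; apply/orP; left; apply/eqP/eq_bigr => z /negbTE->.
rewrite /auction_inv eh eN eP; split.
- split=> [z l'|z]; last by case: eqP => [->|//]; rewrite py.
  rewrite Pp; case: eqP => [->|_]; rewrite ?orbF // ?py.
  by rewrite ltnS [RHS]leq_eqVlt orbC.
- split=> [a b c|a b c].
    case: (b =P y) => [->|_]; case: (c =P y) => [-> //|_].
    + by move=> /eqP-> /(negP (nx c)).
    + by move=> hab /eqP ax; move: hab; rewrite ax => /(negP (nx b)).
    + exact: fN.
  by case: (c =P y) => [_ /eqP-> /eqP->|_] //; exact: iN.
- by move=> a b; case: (b =P y) => [-> /eqP->|_] //; exact: sN.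
- move=> b; case: (b =P y) => [->|_]; first by exists x.
  exact: aN.
move=> a b c; case: (b =P y) => [-> /eqP->|_].
  move=> hxc; case: (c =P y) => [->|_]; first by rewrite leqnSn.
  rewrite py ltnS leqNgt; apply/negP => pl.
  have pn' : p c < n by exact: ltn_trans pl (ltn_ord l).
  by have := hl c (Ordinal pn') hxc pl; rewrite Pp ltnn.
move=> hab hac; apply: leq_trans (cN _ _ _ hab hac) _.
by case: eqP.
Qed.

Lemma good_bid_stuck R R' x : good_bid R R' x -> ~~ stuck R x.
Proof.
move=> [y [l [[nx hxy] nP _ _ _]]]; rewrite /stuck negb_or; apply/andP; split.
  by apply/existsPn.
by apply/forallPn; exists y; apply/forallPn; exists l; rewrite hxy.
Qed.

Lemma stuck_frame R R' x : frame3 R R' -> R' N = R N -> R' P = R P -> stuck R' x = stuck R x.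
Proof.
have [[hN hP hF] _] := neqs.
by move=> f eN eP; rewrite /stuck eN eP f // !inE !negb_or hN hP hF.
Qed.

Lemma eval_round rho R p : auction_inv R p ->
  let R' := eval (For 2 (bid h N P F)) rho R in frame3 R R' /\
  ([/\ R' N = R N, R' P = R P & forall x, stuck R x] \/
   (exists x, ~~ stuck R x) /\ exists2 p', auction_inv R' p' & \sum_y p y < \sum_y p' y).
Proof.
move=> hp R'; rewrite {}/R' [eval _ _ _]/=.
pose Q (s : seq 'I_n) R' := frame3 R R' /\
  ([/\ R' N = R N, R' P = R P & {in s, forall x, stuck R x}] \/
   (exists x, ~~ stuck R x) /\ exists2 p', auction_inv R' p' & \sum_y p y < \sum_y p' y).
suff : Q (enum 'I_n) (foldl (fun R0 i => eval (bid h N P F) (setv rho 2 (Some i)) R0) R (enum 'I_n)).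
  move=> [f [[eN eP hs]|hh]]; split=> //; [left | by right].
  by split=> // x; apply: hs; rewrite mem_enum.
apply: foldl_inv => [s x s2 R' _ [f hq]|]; last by split=> //; left.
have [f' hb] := eval_bid rho R' x; have ft := frame3_trans f f'.
split=> //; case: hb => [[eN' eP' hs]|hg].
  case: hq => [[eN eP hs']|[nst [p' hp' lt]]]; last first.
    by right; split=> //; exists p' => //; apply: auction_inv_frame f' eN' eP' hp'.
  left; split; rewrite ?eN' ?eP' // => y; rewrite mem_rcons inE => /orP[/eqP->|/hs' //].
  by rewrite -(stuck_frame x f eN eP).
right; case: hq => [[eN eP hs']|[nst [p' hp' lt]]].
  split; first by exists x; rewrite -(stuck_frame x f eN eP); apply: good_bid_stuck hg.
  exact: good_bid_inv f' hg (auction_inv_frame f eN eP hp).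
split=> //; have [p2 h2 lt2] := good_bid_inv f' hg hp'.
by exists p2 => //; apply: ltn_trans lt lt2.
Qed.

(** The n prices miss some level g among 0, ..., n. The cover consists of the rows matched to
    columns below g and of the columns above g. Slackness one cannot jump over the gap: a matched
    row with a neighbour below g holds a column of price at most g, hence below g. An unmatched
    stuck row sees only price n, which is not below g. The two parts of the cover use disjoint sets
    of pairs of N. *)
Lemma auction_konig R p : auction_inv R p -> (forall x, stuck R x) -> konig (R h) (R N).
Proof.
move=> [[Pp pn] [fN iN] sN aN cN] st; split=> //.
have [g hg] : exists g : 'I_n.+1, forall y, p y != g.
  pose q y : 'I_n.+1 := inord (p y).
  have : #|[set q y | y in 'I_n]| < #|'I_n.+1|.
    by rewrite card_ord ltnS; apply: leq_trans (leq_imset_card _ _) _; rewrite card_ord.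
  rewrite -cardsT => hc; have /subsetPn[g _ hg] : ~~ ([set: 'I_n.+1] \subset [set q y | y in 'I_n]).
    by apply/negP => /subset_leq_card; rewrite leqNgt hc.
  exists g => y; apply: contraNneq hg => e; apply/imsetP; exists y => //.
  by apply: val_inj; rewrite /= inordK ?ltnS // e.
exists [set x | [exists y, R N x y && (p y < g)]], [set y | g < p y]; split.
  move=> x y hxy; rewrite !inE; case: (ltngtP (p y) g) => [lt|_|e];
    [|by rewrite orbT|by have := hg y; rewrite e eqxx].
  rewrite orbF; case/orP: (st x) => [/existsP[y' hy']|/forallP/(_ y)/forallP full].
    apply/existsP; exists y'; rewrite hy' /=.
    have := cN _ _ _ hy' hxy; have := hg y'; lia.
  have pn' : p y < n by have := ltn_ord g; lia.
  by have := full (Ordinal pn'); rewrite hxy Pp ltnn.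
rewrite /npairs -(cardsID [set q | p q.2 < g] [set q : _ * _ | _ q.1 q.2]); apply: leq_add.
  apply: leq_trans (leq_imset_card fst _); apply: subset_leq_card; apply/subsetP => x.
  rewrite inE => /existsP[y /andP[hxy lt]]; apply/imsetP; exists (x, y) => //.
  by rewrite !inE /= hxy.
apply: leq_trans (leq_imset_card snd _); apply: subset_leq_card; apply/subsetP => y.
rewrite inE => lt; have [x hxy] := aN y (leq_ltn_trans (leq0n g) lt).
by apply/imsetP; exists (x, y) => //; rewrite !inE /= hxy -leqNgt ltnW.
Qed.

Theorem eval_auction rho R : R N = (fun _ _ => false) -> R P = (fun _ _ => false) ->
  let R' := eval (auction h N P F) rho R in frame3 R R' /\ konig (R' h) (R' N).
Proof.
move=> eN eP R'.
pose Q k R' := frame3 R R' /\ exists2 p, auction_inv R' p &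
  k <= \sum_y p y \/ forall x, stuck R' x.
have : Q (0 + size (enum 'I_n) * (size (enum 'I_n) * 1)) R'.
  apply: foldl_count => [i k R1 hk|]; last first.
    split=> //; exists (fun _ => 0); last by left.
    by rewrite /auction_inv eN eP; split.
  apply: foldl_count => [j k' R2 [f [p hp hk']]|//].
  have [f' hr] := eval_round (setv (setv rho 0 (Some i)) 1 (Some j)) hp.
  split; first exact: frame3_trans f f'.
  case: hr => [[eN' eP' st]|[[x nst] [p' hp' lt]]].
    exists p; first exact: auction_inv_frame f' eN' eP' hp.
    by right=> x; rewrite (stuck_frame x f' eN' eP').
  exists p' => //; left; case: hk' => [le|/(_ x)]; last by rewrite (negbTE nst).
  by rewrite addn1; apply: leq_ltn_trans le lt.
rewrite add0n muln1 size_enum_ord => -[f [p hp hk]]; split=> //.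
apply: (auction_konig hp) => x; case: hk => // hk.
have [[Pp pn] _ _ _ _] := hp.
(* If no stuck state was reached, the price sum is at least n * n, so every price has its maximal
   value. *)
have pE y : p y = n.
  apply/eqP; rewrite eqn_leq pn /= leqNgt; apply/negP => lt.
  suff : \sum_y p y < n * n by rewrite ltnNge hk.
  rewrite -[X in X * _](card_ord n) -sum_nat_const (bigD1 y) //= [X in _ < X](bigD1 y) //=.
  by rewrite -addSn leq_add // leq_sum.
by apply/orP; right; apply/forallP => y; apply/forallP => l; rewrite Pp pE ltn_ord implybT.
Qed.
End Auction.

(** * Structure of extremal dissociation sets *)

Section PartialInjections.
Variable T : finType.
Implicit Types (r : rel T) (X Y : {set T}).

Definition functional r := forall x y z, r x y -> r x z -> y = z.
Definition injective_rel r := forall x y z, r x z -> r y z -> x = y.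
Definition source r := [set x | [exists y, r x y]].

Lemma card_pre_le r X Y : injective_rel r ->
  #|[set v in Y | [exists u in X, r v u]]| <= #|[set u in X | [exists v in Y, r v u]]|.
Proof.
move=> inj; set Z := [set u in X | _].
pose f u := odflt u [pick v in Y | r v u].
apply: leq_trans (leq_imset_card f Z); apply: subset_leq_card; apply/subsetP => v.
rewrite inE => /andP[vY /existsP[u /andP[uX rvu]]]; apply/imsetP; exists u.
  by rewrite inE uX; apply/existsP; exists v; rewrite vY.
rewrite /f; case: pickP => [v' /andP[_ rv']|/(_ v)]; first exact: inj rvu rv'.
by rewrite vY rvu.
Qed.

Lemma card_pre r X Y : functional r -> injective_rel r ->
  #|[set v in Y | [exists u in X, r v u]]| = #|[set u in X | [exists v in Y, r v u]]|.
Proof.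
move=> fr ir; apply/eqP; rewrite eqn_leq card_pre_le //=.
by apply: (@card_pre_le (fun x y => r y x)) => x y z; apply: fr.
Qed.

Lemma npairs_source r : functional r -> npairs r = #|source r|.
Proof.
move=> fr; rewrite /npairs.
rewrite -(@card_in_imset _ _ fst [set q | r q.1 q.2]) => [|[x y] [x' y']]; last first.
  by rewrite !inE /= => h h' e; move: h'; rewrite -e => h'; rewrite (fr _ _ _ h h').
apply: eq_card => x; rewrite inE; apply/imsetP/existsP => [[[a b]]|[y hy]].
  by rewrite inE /= => h ->; exists b.
by exists (x, y); rewrite ?inE.
Qed.

Lemma npairs_target r : injective_rel r -> npairs r = #|source (fun x y => r y x)|.
Proof.
move=> ir; rewrite -npairs_source => [|x y z]; last exact: ir.
have swap_inj : injective (fun q : T * T => (q.2, q.1)) by case=> a b [c d] [-> ->].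
rewrite /npairs -(card_imset _ swap_inj); apply: eq_card => -[x y].
rewrite inE /=; apply/imsetP/idP => [[[a b]]|h]; first by rewrite inE => h [-> ->].
by exists (y, x); rewrite ?inE.
Qed.
End PartialInjections.

(** * Independent sets and Koenig's theorem in the double cover *)

Section Independence.
Variables (T : finType) (h : rel T).
Implicit Types (N : rel T) (I : {set T}).

Lemma independent_le_alpha I : independent h I -> #|I| <= alpha h.
Proof. by move=> hI; apply: leq_bigmax_cond. Qed.

Lemma alpha_witness : exists2 I, independent h I & #|I| = alpha h.
Proof.
have h0 : independent h set0 by apply/forall_inP => x; rewrite inE.
have [I hI e] := @eq_bigmax_cond _ [pred I | independent h I] (fun I : {set T} => #|I|)
  (ltac:(by apply/card_gt0P; exists set0)).
by exists I.
Qed.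

Lemma card_source_independent N I : independent h I -> subrel N h -> injective_rel N ->
  #|source N| <= #|source N :\: I| + #|[set v in ~: I | [exists u in I, N u v]]|.
Proof.
move=> hI sN iN; rewrite -(cardsID I (source N)) addnC leq_add2l.
apply: leq_trans (_ : #|[set u in I | [exists v in ~: I, N u v]]| <= _).
  apply: subset_leq_card; apply/subsetP => u; rewrite !inE => /andP[/existsP[v huv] uI].
  rewrite uI; apply/existsP; exists v; rewrite inE huv andbT.
  by apply: contraL (sN _ _ huv) => vI; move/forall_inP/(_ u uI)/forall_inP/(_ v vI): hI.
exact: card_pre_le.
Qed.

(** No pair of N lies inside I. Pairs with source outside I, and pairs from I to the outside, each
    number at most the size of the complement. *)
Lemma independent_npairs N I : independent h I -> subrel N h ->
  functional N -> injective_rel N -> npairs N + 2 * #|I| <= 2 * #|T|.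
Proof.
move=> hI sN fN iN; rewrite npairs_source //.
have := card_source_independent hI sN iN.
have : #|source N :\: I| <= #|~: I| by apply: subset_leq_card; rewrite setDE subsetIr.
have : #|[set v in ~: I | [exists u in I, N u v]]| <= #|~: I|.
  by apply: subset_leq_card; apply/subsetP => v; rewrite inE => /andP[].
by have := cardsC I; lia.
Qed.

(** Equality makes both counts of the previous bound tight, so the targets reached from I exhaust
    the complement. *)
Lemma independent_tight_in N I : independent h I -> subrel N h ->
  functional N -> injective_rel N -> npairs N + 2 * #|I| = 2 * #|T| ->
  forall v, v \notin I -> exists2 u, u \in I & N u v.
Proof.
move=> hI sN fN iN; rewrite npairs_source // => e v vI.
have h1 := card_source_independent hI sN iN.
have h2 : #|source N :\: I| <= #|~: I| by apply: subset_leq_card; rewrite setDE subsetIr.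
have h3 : [set v in ~: I | [exists u in I, N u v]] \subset ~: I.
  by apply/subsetP => w; rewrite inE => /andP[].
have h4 : [set v in ~: I | [exists u in I, N u v]] = ~: I.
  by apply/eqP; rewrite eqEcard h3; have := cardsC I; lia.
have : v \in ~: I by rewrite inE.
by rewrite -h4 inE => /andP[_ /existsP[u /andP[]]]; exists u.
Qed.

Hypothesis hsym : symmetric h.

Lemma independent_tight_out N I : independent h I -> subrel N h ->
  functional N -> injective_rel N -> npairs N + 2 * #|I| = 2 * #|T| ->
  forall v, v \notin I -> exists2 w, w \in I & N v w.
Proof.
move=> hI sN fN iN e v vI.
have [||||w wI hw] := @independent_tight_in (fun x y => N y x) I hI _ _ _ _ v vI.
- by move=> x y /sN; rewrite hsym.
- by move=> x y z; apply: iN.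
- by move=> x y z; apply: fN.
- by rewrite npairs_source -?e ?(npairs_target iN) // => x y z; apply: iN.
- by exists w.
Qed.

Variable side : T -> bool.
Hypothesis hside : forall x y, h x y -> side x != side y.

(** Reading [A] on one side and [B] on the other turns the cover of the double cover into a vertex
    cover of h; exchanging the sides gives a second one. Their sizes add up to |A| + |B|, so one of
    the complementary independent sets is large enough. *)
Lemma alpha_konig N : konig h N -> 2 * alpha h + npairs N = 2 * #|T|.
Proof.
case=> [[fN iN] sN [A [B [hc le]]]].
pose I s := [set v | if side v == s then v \notin A else v \notin B].
have indI s : independent h (I s).
  apply/forall_inP => x; rewrite inE => hx; apply/forall_inP => y; rewrite inE => hy.
  apply/negP => hxy; have := hside hxy; have := hc _ _ hxy.
  have : (y \in A) || (x \in B) by apply: hc; rewrite hsym.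
  by case: (side x) hx; case: (side y) hy; case: s => /=; do ! [case: (_ \in _) => //].
have cardI s : #|~: I s| = #|[set v in A | side v == s]| + #|[set v in B | side v != s]|.
  rewrite -(cardsID [set v | side v == s] (~: I s)); congr (_ + _); apply: eq_card => v; rewrite !inE.
    by case: (side v == s); rewrite /= ?negbK ?andbT ?andbF.
  by case: (side v == s); rewrite /= ?negbK ?andbT ?andbF.
have splitX (X : {set T}) : #|[set v in X | side v == true]| + #|[set v in X | side v != true]| = #|X|.
  by rewrite -(cardsID [set v | side v == true] X); congr (_ + _); apply: eq_card => v;
  rewrite !inE // andbC.
have splitX' (X : {set T}) : #|[set v in X | side v == false]| = #|[set v in X | side v != true]|.
  by apply: eq_card => v; rewrite !inE; case: (side v).
have splitX'' (X : {set T}) : #|[set v in X | side v != false]| = #|[set v in X | side v == true]|.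
  by apply: eq_card => v; rewrite !inE; case: (side v).
have l1 := independent_le_alpha (indI true); have l2 := independent_le_alpha (indI false).
have c1 := cardsC (I true); have c2 := cardsC (I false).
rewrite !cardI splitX' splitX'' in c1 c2.
have := splitX A; have := splitX B.
have [J hJ eJ] := alpha_witness; have := independent_npairs hJ sN fN iN.
by rewrite eJ; lia.
Qed.
End Independence.

Lemma edge_minus_sub (T : finType) (e m : rel T) : subrel (edge_minus e m) e.
Proof. by move=> x y /andP[]. Qed.

(** * Extremal dissociation sets as solutions of a constraint system *)

Section Solutions.
Variables (T : finType) (e m N : rel T).
Notation h := (edge_minus e m).

Definition has_out v := [exists u, N v u].
Definition has_in v := [exists u, N u v].
Definition has_m v := [exists u, m v u].
Definition Nsym u v := N u v || N v u.

(* [C] is to be the complement of the dissociation set. *)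
Record solution (C : {set T}) : Prop := Solution {
  sol_in : forall v, v \in C -> [/\ has_m v, has_out v & has_in v];
  sol_window : forall u v w, m u v -> Nsym v w -> (u \in C) + (v \in C) + (w \in C) = 1;
  sol_end : forall v, ~~ (has_out v && has_in v) ->
    v \notin C /\ exists2 u, m v u & u \notin C;
  sol_unm : forall v, ~~ has_m v ->
    [/\ v \notin C, has_out v & forall w, Nsym v w -> w \notin C];
  sol_clause : forall u v, e u v -> ~~ m u v -> ~~ (N u v && N v u) ->
    (u \in C) || (v \in C) }.

Hypothesis Hsimple : simple_graph e.
Hypothesis Hbip : bipartite e.
Hypothesis Hmax : max_matching e m.
Hypothesis HN : konig h N.
Hypothesis Hkonig : exists N', konig e N'.

Let esym : symmetric e. Proof. by case: Hsimple. Qed.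
Let msym : symmetric m. Proof. by case: Hmax => -[]. Qed.
Let sm : subrel m e. Proof. by case: Hmax => -[_ []]. Qed.
Let fm : functional m.
Proof.
move=> x y z hy hz; case: Hmax => -[_ [_ /(_ x) c1]] _.
by apply: (card_le1_eqP c1); rewrite inE.
Qed.
Let im : injective_rel m.
Proof. by move=> x y z; rewrite !(msym _ z); apply: fm. Qed.
Let fN : functional N. Proof. by case: HN => -[]. Qed.
Let iN : injective_rel N. Proof. by case: HN => -[]. Qed.
Let sN : subrel N h. Proof. by case: HN. Qed.
Let hsym : symmetric h. Proof. by move=> x y; rewrite /edge_minus esym msym. Qed.
Let Ne u v : Nsym u v -> e u v && ~~ m u v.
Proof. by case/orP => /sN; rewrite ?(hsym v). Qed.

Lemma alpha_edge_minus : alpha e <= alpha h.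
Proof.
have [I hI <-] := alpha_witness e; apply: independent_le_alpha.
apply/forall_inP => x xI; apply/forall_inP => y yI; apply/negP => /edge_minus_sub.
by apply/negP; move/forall_inP/(_ x xI)/forall_inP: hI; apply.
Qed.

(** Sorting the pairs by the side of their source splits N' into two matchings of G. The factor 2
    cancels because [npairs] counts every matching edge in both directions. *)
Lemma konig_le_matching N' : konig e N' -> npairs N' <= npairs m.
Proof.
case=> [[fN' iN'] sN' _]; have [side hside] := Hbip.
pose ms s : rel T := fun x y => (N' x y && (side x == s)) || (N' y x && (side y == s)).
have sideE x y s : N' x y -> side x == s -> side y != s.
  by move/sN'/hside => ne /eqP <-; rewrite eq_sym.
have mms s : is_matching e (ms s).
  split; [|split].
  - by move=> x y; rewrite /ms orbC.
  - by move=> x y /orP[] /andP[/sN' // ]; rewrite esym.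
  - move=> x; apply/card_le1_eqP => y z; rewrite !inE /ms.
    case/orP => /andP[hy sy]; case/orP => /andP[hz sz].
    + by rewrite (fN' _ _ _ hy hz).
    + by have := sideE _ _ _ hz sz; rewrite sy.
    + by have := sideE _ _ _ hy sy; rewrite sz.
    + by rewrite (iN' _ _ _ hy hz).
have c s : npairs (ms s) = 2 * #|[set q : T * T | N' q.1 q.2 && (side q.1 == s)]|.
  have swap_inj : injective (fun q : T * T => (q.2, q.1)) by case=> a b [c d] [-> ->].
  rewrite /npairs mul2n -addnn -[X in _ = _ + X](card_imset _ swap_inj).
  rewrite -cardsUI (_ : _ :&: _ = set0) ?cards0 ?addn0.
    apply: eq_card => -[x y]; rewrite !inE /= /ms; congr (_ || _).
    apply/idP/imsetP => [hq|[[a b]]]; first by exists (y, x); rewrite ?inE.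
    by rewrite inE => hab [-> ->].
  apply/setP => -[x y]; rewrite !inE; apply/negbTE/negP => /andP[/andP[/= hxy sx]].
  case/imsetP => -[a b]; rewrite inE /= => /andP[hab sa] [ex ey].
  by have := sideE _ _ _ hab sa; rewrite -ex sx.
have : npairs N' = #|[set q : T * T | N' q.1 q.2 && (side q.1 == true)]| +
                   #|[set q : T * T | N' q.1 q.2 && (side q.1 == false)]|.
  rewrite /npairs -(cardsID [set q | side q.1 == true]); congr (_ + _); apply: eq_card => q;
  by rewrite !inE 1?andbC //; case: (side _); rewrite ?andbT ?andbF.
by case: Hmax => _ hmx; have := hmx _ (mms true); have := hmx _ (mms false); rewrite !c; lia.
Qed.

(** Koenig's theorem in G itself, followed by alpha(G) <= alpha(G - M). *)
Lemma alpha_lower : 2 * #|T| <= 2 * alpha h + npairs m.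
Proof.
have [N' hN'] := Hkonig; have [side hside] := Hbip.
have := alpha_konig esym hside hN'; have := konig_le_matching hN'.
by have := alpha_edge_minus; lia.
Qed.

Lemma alpha_exact : 2 * alpha h + npairs N = 2 * #|T|.
Proof.
have [side hside] := Hbip; apply: (alpha_konig hsym (side := side)) => // x y.
by move/edge_minus_sub; apply: hside.
Qed.

Section Dissociation.
Variable D : {set T}.
Hypothesis HD : dissociation e D.

Lemma diss_unique v x y : v \in D -> x \in D -> y \in D -> e v x -> e v y -> x = y.
Proof.
move=> vD xD yD vx vy; move/forall_inP/(_ v vD): HD => c1.
by apply: (card_le1_eqP c1); rewrite inE ?xD ?yD.
Qed.

Definition pairM := [set v in D | [exists u in D, m v u]].
Definition pairH := [set v in D | [exists u in D, h v u]].

Lemma pairMH : [disjoint pairM & pairH].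
Proof.
rewrite disjoint_subset; apply/subsetP => v; rewrite !inE => /andP[vD /existsP[u /andP[uD vu]]].
rewrite vD /=; apply/existsPn => w; apply/negP => /andP[wD /andP[evw nvw]].
by move: nvw; rewrite -(diss_unique vD uD wD (sm vu) evw) vu.
Qed.

(** Covered vertices of D outside [pairM] have partners in the complement, so there are at most |C|
    of them; covered vertices of C are at most |C| again. Both are tight exactly when all of C is
    matched into D. *)
Lemma card_matched : npairs m <= #|pairM| + 2 * #|~: D| ?= iff
  [forall v in ~: D, exists u in D, m v u].
Proof.
rewrite npairs_source //.
set C := ~: D; pose X := [set v in D | [exists u in C, m v u]].
pose Y := [set u in C | [exists v in D, m v u]].
have cXY : #|X| = #|Y| by apply: card_pre.
have sY : Y \subset C by apply/subsetP => v; rewrite inE => /andP[].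
have sC : source m :&: C \subset C by apply: subsetIr.
have eD : #|source m :&: D| = #|pairM| + #|X|.
  rewrite -cardsUI (_ : pairM :&: X = set0) ?cards0 ?addn0.
    apply: eq_card => v; rewrite !inE; case: (v \in D); rewrite ?andbT ?andbF //=.
    apply/existsP/orP => [[u vu]|[]/existsP[u /andP[_ vu]]]; try by exists u.
    case uD : (u \in D); [left|right]; apply/existsP; exists u; rewrite ?inE ?uD //.
  apply/setP => v; rewrite !inE; apply/negbTE/negP => /andP[/andP[_ /existsP[u /andP[uD vu]]]].
  case/andP => _ /existsP[w /andP[]]; rewrite inE => wD vw.
  by rewrite -(fm vu vw) uD in wD.
have eS : #|source m| = #|source m :&: D| + #|source m :&: C|.
  by rewrite -(cardsID D (source m)) setDE.
have lY := subset_leqif_cards sY; have lC := subset_leqif_cards sC.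
split; first by have := lY.1; have := lC.1; lia.
apply/eqP/forall_inP => [eq v vC|hC].
  have e1 : #|Y| = #|C| by have := lY.1; have := lC.1; lia.
  have /eqP eYC : Y == C by rewrite -lY.2 e1.
  have : v \in Y by rewrite eYC.
  by rewrite inE => /andP[_ /existsP[u /andP[uD vu]]]; apply/existsP; exists u; rewrite uD msym.
have eYC : Y = C.
  apply/setP => v; rewrite inE andbC; case vC : (v \in C); rewrite ?andbF // andbT.
  by have /existsP[u /andP[uD vu]] := hC v vC; apply/existsP; exists u; rewrite uD msym.
have eSC : source m :&: C = C.
  apply/setP => v; rewrite inE andbC; case vC : (v \in C) => //=.
  by have /existsP[u /andP[uD vu]] := hC v vC; rewrite inE; apply/existsP; exists u.
by rewrite eS eD cXY eYC eSC /C; lia.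
Qed.

Lemma card_D : #|D| = #|pairM| + #|pairH| + #|D :\: (pairM :|: pairH)|.
Proof.
rewrite -(cardsID (pairM :|: pairH) D) -(cardsUI pairM); congr (_ + _).
rewrite (_ : pairM :&: pairH = set0) ?cards0 ?addn0; last first.
  by apply/eqP; rewrite setI_eq0; exact: pairMH.
by apply: eq_card => v; rewrite !inE; case: (v \in D).
Qed.

Variable side : T -> bool.
Hypothesis hside : forall x y, e x y -> side x != side y.

(** Destroys every H-edge inside D by keeping only its end on side [s]; all other vertices of D stay
    in both halves. *)
Definition half s := [set v in D | (v \in pairH) ==> (side v == s)].

Lemma half_independent s : independent h (half s).
Proof.
apply/forall_inP => x; rewrite inE => /andP[xD hx].
apply/forall_inP => y; rewrite inE => /andP[yD hy]; apply/negP => hxy.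
have xH : x \in pairH by rewrite inE xD; apply/existsP; exists y; rewrite yD.
have yH : y \in pairH by rewrite inE yD; apply/existsP; exists x; rewrite xD hsym.
have := hside (edge_minus_sub hxy).
by rewrite xH /= in hx; rewrite yH /= in hy; rewrite (eqP hx) (eqP hy) eqxx.
Qed.

Lemma card_half : #|half true| + #|half false| = 2 * #|D| - #|pairH|.
Proof.
have sH : pairH \subset D by apply/subsetP => v; rewrite inE => /andP[].
have c s : #|half s| = #|D :\: pairH| + #|[set v in pairH | side v == s]|.
  have hE v : (v \in half s) = (v \in D) && ((v \in pairH) ==> (side v == s)) by rewrite in_set.
  rewrite -(cardsID pairH (half s)) addnC; congr (_ + _); apply: eq_card => v.
    by rewrite !in_setD hE; case: (v \in pairH) => //=; rewrite andbT.
  rewrite in_setI hE in_set; case vH: (v \in pairH); rewrite ?andbF //= andbT.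
  by rewrite (subsetP sH).
have cH : #|[set v in pairH | side v == true]| + #|[set v in pairH | side v == false]| = #|pairH|.
  rewrite -(cardsID [set v | side v == true] pairH); congr (_ + _); apply: eq_card => v.
    by rewrite in_set in_setI in_set.
  by rewrite in_set in_setD in_set andbC; case: (side v).
have := cardsID pairH D; rewrite (setIidPr sH) !c; lia.
Qed.
End Dissociation.

(** The two halves give 2|D| - |pairH| <= 2 alpha, and [alpha_lower] with [card_matched] gives 2|D|
    - |pairM| <= 2 alpha. Their sum is the claim, by [card_D]. *)
Lemma diss_bound_aux D : dissociation e D -> 3 * #|D| + #|D :\: (pairM D :|: pairH D)| <= 4 * alpha h.
Proof.
move=> HD; have [side hside] := Hbip.
have := card_matched HD; case=> cm _; have cD := card_D HD; have := card_half HD side.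
have := independent_le_alpha (half_independent D hside true).
have := independent_le_alpha (half_independent D hside false).
by have := alpha_lower; have := cardsC D; lia.
Qed.

Lemma diss_witness : exists2 D, dissociation e D & #|D| = diss e.
Proof.
have h0 : dissociation e set0 by apply/forall_inP => x; rewrite inE.
have [D hD eD] := @eq_bigmax_cond _ [pred I | dissociation e I] (fun I : {set T} => #|I|)
  (ltac:(by apply/card_gt0P; exists set0)).
by exists D.
Qed.

Lemma diss_le D : dissociation e D -> #|D| <= diss e.
Proof. by move=> hD; apply: leq_bigmax_cond. Qed.

Theorem diss_le_alpha : 3 * diss e <= 4 * alpha h.
Proof. by have [D hD <-] := diss_witness; have := diss_bound_aux hD; lia. Qed.

(** Equality makes every estimate of [diss_bound_aux] tight. In particular both halves are maximum
    independent sets of H, so every vertex missing from a half has N-partners in that half, in both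
    directions. *)
Lemma solution_of_diss D : dissociation e D -> 3 * #|D| = 4 * alpha h ->
  npairs m <= npairs N /\ solution (~: D).
Proof.
move=> HD eD; have [side hside] := Hbip.
have b := diss_bound_aux HD.
have [cm cmi] := card_matched HD; have cD := card_D HD.
have ch := card_half HD side.
have lt := independent_le_alpha (half_independent D hside true).
have lf := independent_le_alpha (half_independent D hside false).
have al := alpha_lower; have ae := alpha_exact; have cC := cardsC D.
have hle : #|pairH D| <= #|D|.
  by apply: subset_leq_card; apply/subsetP => v; rewrite inE => /andP[].
have d0 : #|D :\: (pairM D :|: pairH D)| = 0 by lia.
have np : npairs m <= npairs N by lia.
have eqm : npairs m = #|pairM D| + 2 * #|~: D| by lia.
have eht s : #|half D side s| = alpha h by case: s; lia.
have tin s := independent_tight_in (half_independent D hside s) sN fN iN (ltac:(rewrite eht; lia)).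
have tout s := independent_tight_out hsym (half_independent D hside s) sN fN iN (ltac:(rewrite eht; lia)).
have halfE s v : (v \in half D side s) = (v \in D) && ((v \in pairH D) ==> (side v == s)) by rewrite in_set.
have mC v : v \notin D -> exists2 u, u \in D & m v u.
  move=> vD; move/eqP: eqm; rewrite cmi => /forall_inP/(_ v).
  by rewrite inE => /(_ vD) /existsP[u /andP[]]; exists u.
have AB v : v \in D -> v \notin pairM D -> v \in pairH D.
  move=> vD vM; move/eqP: d0; rewrite cards_eq0 => /eqP/setP/(_ v).
  by rewrite in_set0 in_setD in_setU vD andbT (negbTE vM) /= => /negbT; rewrite negbK.
have inA v : v \in half D side true -> v \in half D side false -> v \in pairM D.
  rewrite !halfE => /andP[vD ht] /andP[_ hf]; apply: contraT => /(AB _ vD) vH.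
  by move: ht hf; rewrite vH; case: (side v).
(* A vertex outside D misses both halves, and its single N-image serves both, so that image lies in
   the two halves at once. *)
have outC v : v \notin D -> exists2 w, w \in pairM D & N v w.
  move=> vD; have nv s : v \notin half D side s by rewrite halfE (negbTE vD).
  have [w1 h1 n1] := tout true v (nv _); have [w2 h2 n2] := tout false v (nv _).
  by rewrite (fN n2 n1) in h2; exists w1 => //; apply: inA.
have inC v : v \notin D -> exists2 w, w \in pairM D & N w v.
  move=> vD; have nv s : v \notin half D side s by rewrite halfE (negbTE vD).
  have [w1 h1 n1] := tin true v (nv _); have [w2 h2 n2] := tin false v (nv _).
  by rewrite (iN n2 n1) in h2; exists w1 => //; apply: inA.
have AD v : v \in pairM D -> v \in D by rewrite in_set => /andP[].
(* Here v misses only the half of the opposite side; both its N-partners lie in D, where v has at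
   most one neighbour, so they coincide. *)
have hB v : v \in pairH D -> exists z, [/\ z \in D, N v z & N z v].
  move=> vH; have vD : v \in D by move: vH; rewrite in_set => /andP[].
  have nv : v \notin half D side (~~ side v) by rewrite halfE vD vH /=; case: (side v).
  have [w hw nw] := tout _ v nv; have [u hu nu] := tin _ v nv.
  have wD : w \in D by move: hw; rewrite halfE => /andP[].
  have uD : u \in D by move: hu; rewrite halfE => /andP[].
  exists w; split=> //; rewrite (diss_unique HD vD wD uD) //; first by have /andP[] := sN nw.
  by have /andP[] := sN nu; rewrite esym.
have uniq2 v u w : v \in D -> u \in D -> w \in D -> m v u -> e v w -> ~~ m v w -> False.
  move=> vD uD wD vu vw /negP; apply.
  by rewrite -(diss_unique HD vD uD wD (sm vu) vw).
have NsD v z : N v z -> N z v -> forall w, Nsym v w -> w = z.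
  by move=> h1 h2 w /orP[h3|h3]; [apply: fN h3 h1 | apply: iN h3 h2].
have in1 v : v \in ~: D -> [/\ has_m v, has_out v & has_in v].
  rewrite inE => vD; have [u _ hu] := mC v vD; have [w _ hw] := outC v vD.
  by have [z _ hz] := inC v vD; split; apply/existsP; [exists u|exists w|exists z].
split=> //; split=> //.
- move=> u v w uv vw; have /andP[evw nvw] := Ne vw; rewrite !in_setC.
  case vD : (v \in D) => /=; last first.
    have [u' u'D vu'] := mC v (negbT vD); rewrite msym in uv.
    rewrite (fm uv vu') u'D.
    suff -> : w \in D by [].
    have [w1 w1A n1] := outC v (negbT vD); have [w2 w2A n2] := inC v (negbT vD).
    by case/orP: vw => hw; [rewrite (fN hw n1) | rewrite (iN hw n2)]; exact: AD.
  case vM : (v \in pairM D).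
    move: (vM); rewrite in_set vD /= => /existsP[u' /andP[u'D vu']].
    rewrite msym in uv; rewrite (fm uv vu') u'D /=.
    by case wD : (w \in D) => //; case: (uniq2 _ _ _ vD u'D wD vu' evw nvw).
  have vH := AB v vD (negbT vM); have [z [zD vz zv]] := hB v vH.
  rewrite (NsD v z vz zv w vw) zD /=.
  case uD : (u \in D) => //; rewrite in_set vD /= in vM.
  by move/existsP: vM; case; exists u; rewrite uD msym.
- move=> v hv; rewrite in_setC negbK; case vD : (v \in D); last first.
    have [_ ho hi] : [/\ has_m v, has_out v & has_in v] by apply: in1; rewrite inE vD.
    by rewrite ho hi in hv.
  split=> //; case vM : (v \in pairM D).
    move: vM; rewrite in_set vD /= => /existsP[u /andP[uD vu]]; exists u => //.
    by rewrite in_setC negbK.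
  have [z [_ vz zv]] := hB v (AB v vD (negbT vM)).
  by case/negP: hv; apply/andP; split; apply/existsP; exists z.
- move=> v hv; rewrite in_setC negbK; case vD : (v \in D); last first.
    have [hm _ _] : [/\ has_m v, has_out v & has_in v] by apply: in1; rewrite inE vD.
    by rewrite hm in hv.
  have vH : v \in pairH D.
    apply: AB => //; apply: contra hv; rewrite in_set => /andP[_ /existsP[u /andP[_ vu]]].
    by apply/existsP; exists u.
  have [z [zD vz zv]] := hB v vH; split=> //; first by apply/existsP; exists z.
  by move=> w /(NsD v z vz zv) ->; rewrite in_setC negbK.
move=> u v euv nm; rewrite !in_setC -negb_and; apply: contra => /andP[uD vD].
have uH : u \in pairH D.
  by rewrite in_set uD; apply/existsP; exists v; rewrite vD /edge_minus euv nm.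
have [z [zD uz zu]] := hB u uH.
by rewrite (diss_unique HD uD vD zD) ?uz ?zu //; have /andP[] := sN uz.
Qed.

(** The complement of C is the disjoint union of A, paired by M, and B, paired by N; moreover |M|
    and |N|, as numbers of ordered pairs, are |A| + 2|C| and |B| + 2|C|. Since |N| <= |M| always
    holds here, |A| = |B|, and [alpha_exact] gives 2 alpha = 3|A| against |A| + |B| = 2|A|
    vertices. *)
Lemma diss_of_solution C : npairs m <= npairs N -> solution C ->
  dissociation e (~: C) /\ 3 * #|~: C| = 4 * alpha h.
Proof.
move=> np sC; have ae := alpha_exact; have al := alpha_lower.
have nbr v y : v \notin C -> y \notin C -> e v y -> m v y \/ N v y /\ N y v.
  move=> vC yC vy; case vm : (m v y); [by left | right].
  have := sol_clause sC vy (negbT vm); rewrite (negbTE vC) (negbTE yC).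
  by case: (N v y); case: (N y v) => //= /(_ isT).
have wm v x y : v \notin C -> x \notin C -> y \notin C -> m v x -> N v y -> False.
  move=> vC xC yC vx vy; have := @sol_window _ sC x v y.
  rewrite msym vx /Nsym vy (negbTE vC) (negbTE xC) (negbTE yC) => h'.
  by have := h' isT isT.
split.
  apply/forall_inP => v; rewrite inE => vC; apply/card_le1_eqP => x y; rewrite !inE.
  case/andP => xC vx /andP[yC vy].
  case: (nbr v x vC xC vx) => [mx|[nx _]]; case: (nbr v y vC yC vy) => [my|[ny _]].
  - by rewrite (fm my mx).
  - by case: (wm v x y).
  - by case: (wm v y x).
  - by rewrite (fN ny nx).
(* Used for both m and N: C is counted once as a set of sources and once through the outside sources
   pointing into it. *)
have card_part (r : rel T) : functional r -> injective_rel r ->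
    (forall u, u \in C -> exists2 v, v \notin C & r v u) -> C \subset source r ->
    #|source r| = #|[set v in ~: C | [exists u in ~: C, r v u]]| + 2 * #|C|.
  move=> fr ir hr sr; pose X := [set v in ~: C | [exists u in C, r v u]].
  have cX : #|X| = #|C|.
    rewrite card_pre //; apply: eq_card => u; rewrite in_set; case uC: (u \in C) => //=.
    by have [v vC vu] := hr u uC; apply/existsP; exists v; rewrite inE vC.
  rewrite -(cardsID C (source r)) (setIidPr sr) addnC mul2n -addnn addnA; congr (_ + _).
  rewrite -cX -cardsUI (_ : _ :&: X = set0) ?cards0 ?addn0; last first.
    apply/setP => v; rewrite !inE; apply/negbTE/negP => /andP[/andP[_ /existsP[u /andP[]]]].
    rewrite inE => uC vu /andP[_ /existsP[w /andP[wC vw]]].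
    by rewrite (fr _ _ _ vu vw) wC in uC.
  apply: eq_card => v; rewrite !inE; case: (v \in C) => //=.
  apply/existsP/orP => [[u vu]|[]/existsP[u /andP[_ vu]]]; try by exists u.
  by case uC : (u \in C); [right|left]; apply/existsP; exists u; rewrite ?inE uC.
pose A := [set v in ~: C | [exists u in ~: C, m v u]].
pose B := [set v in ~: C | [exists u in ~: C, N v u]].
have cm : npairs m = #|A| + 2 * #|C|.
  rewrite npairs_source //; apply: card_part => // [u uC|].
    have [/existsP[v uv] /existsP[w uw] _] := sol_in sC uC; exists v; last by rewrite msym.
    have := @sol_window _ sC v u w; rewrite msym uv /Nsym uw uC => h'.
    by have := h' isT isT; case: (v \in C).
  by apply/subsetP => u uC; rewrite inE; have [] := sol_in sC uC.
have cn : npairs N = #|B| + 2 * #|C|.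
  rewrite npairs_source //; apply: card_part => // [u uC|].
    have [/existsP[v uv] _ /existsP[w wu]] := sol_in sC uC; exists w => //.
    have := @sol_window _ sC v u w; rewrite msym uv /Nsym wu uC orbT => h'.
    by have := h' isT isT; case: (w \in C); case: (v \in C).
  by apply/subsetP => u uC; rewrite inE; have [] := sol_in sC uC.
have dAB : A :&: B = set0.
  apply/setP => v; rewrite !inE; apply/negbTE/negP => /andP[/andP[vC /existsP[u /andP[uC vu]]]].
  case/andP => _ /existsP[w /andP[wC vw]]; rewrite !inE in uC wC.
  exact: wm vC uC wC vu vw.
have uAB : ~: C = A :|: B.
  apply/setP => v; rewrite !inE; case vC : (v \in C) => //=; symmetry.
  case ho : (has_out v && has_in v); last first.
    have [_ [u vu uC]] := sol_end sC (negbT ho).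
    by apply/orP; left; apply/existsP; exists u; rewrite inE uC.
  have /andP[/existsP[z vz] _] := ho.
  have vz' : Nsym v z by rewrite /Nsym vz.
  case hm : (has_m v); last first.
    have [_ _ hw] := sol_unm sC (negbT hm); have zC := hw z vz'.
    by apply/orP; right; apply/existsP; exists z; rewrite inE zC.
  have /existsP[u vu] := hm.
  have := @sol_window _ sC u v z; rewrite msym vu vz' vC => h'.
  have := h' isT isT; case uC : (u \in C); case zC : (z \in C) => //= _.
    by apply/orP; right; apply/existsP; exists z; rewrite inE zC.
  by apply/orP; left; apply/existsP; exists u; rewrite inE uC.
have := cardsUI A B; rewrite -uAB dAB cards0 addn0; have := cardsC C.
by lia.
Qed.

(** * Constraint propagation and greedy choice *)

Definition base a b c := m a b && Nsym b c.
(** Closed under all permutations, because the exactly-one condition on a triple is symmetric. *)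
Definition window a b c :=
  [|| base a b c, base b a c, base a c b, base c a b, base b c a | base c b a].
Definition conflict a b := [exists c, window a b c].
Definition equal1 a b := [exists c, exists d, window a c d && window b c d].
Definition clause a b := [&& e a b, ~~ m a b & ~~ (N a b && N b a)].
(** The binary consequences of a in C: a vertex completing the same pair to a window behaves like a,
    and a excludes q, which leaves b to satisfy the clause on q and b. *)
Definition implies1 a b := equal1 a b || [exists q, conflict a q && clause q b].
(** The last two cases come from [sol_end] and [sol_unm]: a vertex lacking an N-partner in some
    direction keeps its M-partner out of C, and an unmatched vertex keeps out its N-neighbours. *)
Definition forbidden v := [|| ~~ has_m v, ~~ has_out v, ~~ has_in v,
  [exists u, m v u && (~~ has_out u || ~~ has_in u)] | [exists w, Nsym v w && ~~ has_m w]].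
(** Links stop at vertices not covered by M: such a vertex occurs in a window only as the far end of
    an N-edge, so nothing propagates beyond it. *)
Definition linked1 a b := m a b || [&& Nsym a b, has_m a & has_m b].

(** The reflexive transitive closure, with minimality stated for Prop-valued relations so that it
    serves directly as an induction principle. *)
Definition closure_of (r rs : rel T) :=
  [/\ reflexive rs, transitive rs, subrel r rs &
      forall Q : T -> T -> Prop, (forall x, Q x x) -> (forall x y z, Q x y -> Q y z -> Q x z) ->
        (forall x y, r x y -> Q x y) -> forall x y, rs x y -> Q x y].

Variables (implies linked : rel T).
Hypothesis Himplies : closure_of implies1 implies.
Hypothesis Hlinked : closure_of linked1 linked.

Definition consistent v := [forall w, implies v w ==> ~~ forbidden w] &&
  [forall w, forall w', implies v w && implies v w' ==> ~~ conflict w w'].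

Definition greedy_step (S : {set T}) v : {set T} :=
  if [exists z in S, linked z v] || ~~ consistent v then S else S :|: [set w | implies v w].

Lemma Nsym_sym : symmetric Nsym. Proof. by move=> a b; rewrite /Nsym orbC. Qed.

Lemma window_213 a b c : window a b c = window b a c.
Proof.
rewrite /window; move: (base a b c) (base b a c) (base a c b).
by move: (base c a b) (base b c a) (base c b a); do 6! case.
Qed.
Lemma window_132 a b c : window a b c = window a c b.
Proof.
rewrite /window; move: (base a b c) (base b a c) (base a c b).
by move: (base c a b) (base b c a) (base c b a); do 6! case.
Qed.
Lemma window_231 a b c : window a b c = window b c a.
Proof. by rewrite window_213 window_132. Qed.
Lemma baseW a b c : m a b -> Nsym b c -> window a b c.
Proof. by move=> h1 h2; rewrite /window /base h1 h2. Qed.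

Lemma windowP a b c (P : T -> T -> T -> Prop) :
  (forall x y z, P x y z -> P y x z) -> (forall x y z, P x y z -> P x z y) ->
  (forall x y z, m x y -> Nsym y z -> P x y z) -> window a b c -> P a b c.
Proof.
move=> h1 h2 hb; have hb' x y z : base x y z -> P x y z by case/andP; apply: hb.
case/or4P => [/hb'|/hb'/h1|/hb'/h2|] //.
by case/or3P => /hb'; [move/h1/h2 | move/h2/h1 | move/h1/h2/h1].
Qed.

Lemma conflictC a b : conflict a b = conflict b a.
Proof. by apply: eq_existsb => c; apply: window_213. Qed.
Lemma clauseC a b : clause a b = clause b a.
Proof. by rewrite /clause esym msym (andbC (N a b)). Qed.

Lemma conflictW a b c : window a b c -> conflict a b.
Proof. by move=> hw; apply/existsP; exists c. Qed.
Lemma equal1W a b c d : window a c d -> window b c d -> equal1 a b.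
Proof. by move=> h1 h2; apply/existsP; exists c; apply/existsP; exists d; rewrite h1. Qed.

Lemma linkedC a b : linked a b -> linked b a.
Proof.
have [lr lt ls lmin] := Hlinked.
apply: (lmin (fun a b => linked b a)) => [x|x y z h1 h2|x y hxy] //.
  exact: lt h2 h1.
by apply: ls; move: hxy; rewrite /linked1 msym Nsym_sym => /orP[->|/and3P[-> -> ->]] //; rewrite orbT.
Qed.

Lemma nforb_m v : ~~ forbidden v -> has_m v.
Proof. by rewrite /forbidden !negb_or => /and3P[/negPn]. Qed.

Lemma has_mW v u : m v u -> has_m v. Proof. by move=> h1; apply/existsP; exists u. Qed.

Lemma linked_window a b c : window a b c -> has_m a -> has_m b -> linked a b.
Proof.
have [lr lt ls lmin] := Hlinked.
have l1 x y : m x y -> linked x y by move=> h1; apply: ls; rewrite /linked1 h1.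
have l2 x y : Nsym x y -> has_m x -> has_m y -> linked x y.
  by move=> h1 hx hy; apply: ls; rewrite /linked1 h1 hx hy orbT.
have m' x y : m x y -> m y x by rewrite msym.
have n' x y : Nsym x y -> Nsym y x by rewrite Nsym_sym.
move=> hw ha hb; case/or4P: hw; last case/or3P; case/andP => h1 h2.
- exact: l1.
- by apply: l1; apply: m'.
- by apply: lt (l1 _ _ h1) _; apply: l2 => //; apply: has_mW (m' _ _ h1).
- by apply: l2.
- apply: linkedC; apply: lt (l1 _ _ h1) _; apply: l2 => //; exact: has_mW (m' _ _ h1).
- by apply: l2 => //; apply: n'.
Qed.

Definition inv (S : {set T}) :=
  [/\ forall x y, x \in S -> implies x y -> y \in S,
      forall x, x \in S -> ~~ forbidden x &
      forall x y, x \in S -> y \in S -> ~~ conflict x y].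

Definition hit (S : {set T}) a b c := [|| a \in S, b \in S | c \in S].

Lemma inv_equal1 S x y : inv S -> x \in S -> equal1 x y -> y \in S.
Proof.
move=> [hc _ _] xS exy; apply: hc xS _; have [_ _ hs _] := Himplies.
by apply: hs; rewrite /implies1 exy.
Qed.

Lemma inv_clause S x q y : inv S -> x \in S -> conflict x q -> clause q y -> y \in S.
Proof.
move=> [hc _ _] xS cxq cqy; apply: hc xS _; have [_ _ hs _] := Himplies.
by apply: hs; apply/orP; right; apply/existsP; exists q; rewrite cxq.
Qed.

(** It suffices to carry along the links the property that the windows containing a vertex and its
    M-partner are hit; neighbouring windows share two vertices, so [equal1] transports the hit. *)
Lemma linked_hit S z y : inv S -> z \in S -> linked z y -> has_m y ->
  forall a b, window y a b -> hit S y a b.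
Proof.
move=> hS zS lzy my.
pose good a := forall u c, m a u -> window a u c -> hit S a u c.
have m' x x' : m x x' -> m x' x by rewrite msym.
have n' x x' : Nsym x x' -> Nsym x' x by rewrite Nsym_sym.
have [_ _ _ lmin] := Hlinked.
have gy : good y.
  have gz : good z by move=> u c _ _; rewrite /hit zS.
  apply: (lmin (fun a b => good a -> good b)) lzy gz => // [a b c h1 h2 /h1/h2 //|a b hab ga].
  case/orP: hab => [mab u c mbu hw|/and3P[nab /existsP[a' maa'] /existsP[b' mbb']]].
    have eu := fm mbu (m' _ _ mab); subst u.
    have := ga b c mab; rewrite window_213 => /(_ hw).
    by rewrite /hit; case: (a \in S); case: (b \in S).
  (* Across the N-edge a b, the windows a', a, b and a, b, b' share a and b, so membership passes
     from a' to b'. *)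
  have w1 : window a a' b by rewrite window_213; apply: baseW => //; apply: m'.
  have w2 : window b b' a by rewrite window_213; apply: baseW; [apply: m' | apply: n'].
  have h2 : hit S b b' a.
    case/or3P: (ga _ _ maa' w1) => h3; rewrite /hit; first by rewrite h3 !orbT.
      suff -> : b' \in S by rewrite orbT.
      apply: inv_equal1 hS h3 _; apply: (@equal1W _ _ a b).
        by rewrite window_213.
      by rewrite -window_231.
    by rewrite h3.
  move=> u c mbu hw; rewrite (fm mbu mbb') in hw *.
  case/or3P: h2 => h3; rewrite /hit ?h3 ?orbT //.
  suff -> : c \in S by rewrite !orbT.
  apply: inv_equal1 hS h3 _; apply: (@equal1W _ _ b b').
    by rewrite window_231 .
  by rewrite window_231.
move=> a b hw; have /existsP[y' myy'] := my.
have key p q : m p q -> Nsym q y -> window y p q -> hit S y p q.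
  move=> mpq nqy hw'.
  have w1 : window y y' q by rewrite window_213; apply: baseW; [apply: m' | apply: n'].
  case/or3P: (gy _ _ myy' w1) => h3; rewrite /hit ?h3 ?orbT //.
  suff -> : p \in S by rewrite orbT.
  apply: inv_equal1 hS h3 _; apply: (@equal1W _ _ y q); first by rewrite window_213.
  by rewrite window_213.
have hitC p q : hit S y p q = hit S y q p by rewrite /hit [(p \in S) || _]orbC.
case/or4P: (hw); last case/or3P; case/andP => h1 h2.
- exact: gy.
- by apply: gy => //; apply: m'.
- by rewrite hitC; apply: gy => //; rewrite window_132.
- by rewrite hitC; apply: gy; [apply: m' | rewrite window_132].
- exact: key.
- by rewrite hitC; apply: key => //; rewrite window_132.
Qed.

Lemma nforb_window y : ~~ forbidden y -> exists a b, window y a b.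
Proof.
rewrite /forbidden !negb_or !negbK => /and3P[/existsP[a ya] /existsP[b yb] _].
by exists a, b; rewrite window_213; apply: baseW; rewrite 1?msym // /Nsym yb.
Qed.

(** The danger is a clash between S and the consequences of v. A clashing vertex is [bad]: outside S
    but linked to it. Badness travels backwards along implications, so v itself would be linked to
    S, and such v are skipped. *)
Lemma inv_step S v : inv S -> inv (greedy_step S v).
Proof.
move=> hS; have [hc hf hn] := hS; rewrite /greedy_step.
case: ifPn => // /norP[/exists_inPn nt]; rewrite negbK => /andP[/forallP ok1 /forallP ok2].
have [ir it is_ imin] := Himplies.
have nf w : implies v w -> ~~ forbidden w by move=> hw; move: (ok1 w); rewrite hw.
have nc w w' : implies v w -> implies v w' -> ~~ conflict w w'.
  by move=> hw hw'; have /forallP/(_ w') := ok2 w; rewrite hw hw'.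
pose bad y := y \notin S /\ exists2 z, z \in S & linked z y.
have [_ ltr _ _] := Hlinked.
have back x y : implies v x -> implies1 x y -> bad y -> bad x.
  move=> vx h1 [yS [z zS lzy]].
  have vy : implies v y by apply: it vx (is_ _ _ h1).
  have mx := nforb_m (nf _ vx); have my := nforb_m (nf _ vy).
  case/orP: h1 => [exy|/existsP[q /andP[cxq cqy]]].
    have xS : x \notin S by apply: contra yS => xS; apply: inv_equal1 hS xS exy.
    split=> //; exists z => //; apply: (ltr _ _ _ lzy).
    move/existsP: exy => [c /existsP[d /andP[wx wy]]].
    have hcd : has_m c || has_m d.
      move: wx; rewrite /window /base => /or4P[||| /or3P[]] /andP[h1 h2];
      by rewrite ?(has_mW h1) ?orbT // (has_mW (etrans (msym _ _) h1)) ?orbT.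
    case/orP: hcd => hm.
      by apply: ltr (linked_window wy my hm) (linkedC (linked_window wx mx hm)).
    rewrite window_132 in wx; rewrite window_132 in wy.
    by apply: ltr (linked_window wy my hm) (linkedC (linked_window wx mx hm)).
  (* S hits a window of y but not in y, so it contains a vertex excluding y. The clause on q and y
     then puts q into S, and x, which excludes q, is linked to S. *)
  have [a [b wy]] := nforb_window (nf _ vy).
  have qS : q \in S.
    have := linked_hit hS zS lzy my wy; rewrite /hit (negbTE yS) /= => /orP[aS|bS].
      apply: inv_clause hS aS _ _; last by rewrite clauseC; exact: cqy.
      by rewrite conflictC; apply: conflictW wy.
    apply: inv_clause hS bS _ _; last by rewrite clauseC; exact: cqy.
    by rewrite conflictC; apply: (@conflictW _ _ a); rewrite window_132.
  have xS : x \notin S by apply/negP => xS; move: cxq; apply/negP; apply: hn.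
  split=> //; exists q => //.
  move/existsP: cxq => [t wt]; apply: linkedC; apply: linked_window wt mx _.
  exact: nforb_m (hf _ qS).
have nbad w : implies v w -> ~ bad w.
  move=> vw hb.
  have : bad v.
    apply: (proj2 (imin (fun x y => implies v x -> implies v y /\ (bad y -> bad x)) _ _ _ v w vw (ir v))) => //.
      move=> x y z h1 h2 vx; have [vy b1] := h1 vx; have [vz b2] := h2 vy.
      by split=> // /b2/b1.
    move=> x y hxy vx; split; [exact: it vx (is_ _ _ hxy) | exact: back].
  by case=> _ [z zS lzv]; move: (nt z zS); rewrite lzv.
have cross x y : x \in S -> implies v y -> ~~ conflict x y.
  move=> xS vy; apply/negP => cxy; apply: (nbad y vy); split.
    by apply/negP => yS; move: cxy; apply/negP; apply: hn.
  exists x => //; move/existsP: cxy => [t wt]; apply: linked_window wt _ _.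
    exact: nforb_m (hf _ xS).
  exact: nforb_m (nf _ vy).
split.
- move=> x y; rewrite !inE => /orP[xS|vx] xy; first by rewrite (hc x y).
  by rewrite (it _ _ _ vx xy) orbT.
- by move=> x; rewrite !inE => /orP[/hf|/nf].
move=> x y; rewrite !inE => /orP[xS|vx] /orP[yS|vy]; [exact: hn|exact: cross| |exact: nc].
by rewrite conflictC; apply: cross.
Qed.

Lemma solution_forbidden C v : solution C -> v \in C -> ~~ forbidden v.
Proof.
move=> sC vC; have [h1 h2 h3] := sol_in sC vC; rewrite /forbidden h1 h2 h3 /= negb_or.
apply/andP; split; apply/existsPn => u; apply/negP => /andP[vu].
  rewrite -negb_and => /(sol_end sC)[_ [w uw wC]].
  by rewrite msym in vu; rewrite (fm uw vu) vC in wC.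
by move/(sol_unm sC) => [_ _ /(_ v)]; rewrite Nsym_sym vC => /(_ vu).
Qed.

Lemma solution_window C : solution C -> forall a b c, window a b c ->
  (a \in C) + (b \in C) + (c \in C) = 1.
Proof.
move=> sC a b c; apply: (windowP (P := fun a b c => (a \in C) + (b \in C) + (c \in C) = 1)).
- by move=> x y z <-; rewrite (addnC (_ \in _)).
- by move=> x y z <-; rewrite addnAC.
- by move=> x y z; apply: sol_window.
Qed.

Lemma solution_implies C x y : solution C -> x \in C -> implies x y -> y \in C.
Proof.
move=> sC xC xy; have [_ _ _ imin] := Himplies.
apply: (imin (fun x y => x \in C -> y \in C)) xy xC => // [a b c h1 h2 /h1/h2 //|a b].
case/orP => [/existsP[c /existsP[d /andP[w1 w2]]] aC|/existsP[q /andP[/existsP[t wt] cl]] aC].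
  by have := solution_window sC w1; have := solution_window sC w2; rewrite aC; case: (b \in C) => //; lia.
have := solution_window sC wt; rewrite aC; case/and3P: cl => h1 h2 h3.
by have := sol_clause sC h1 h2 h3; case: (q \in C) => //=.
Qed.

Lemma solution_consistent C v : solution C -> v \in C -> consistent v.
Proof.
move=> sC vC; apply/andP; split; apply/forallP => w.
  by apply/implyP => vw; apply: (solution_forbidden sC); apply: solution_implies vw.
apply/forallP => w'; apply/implyP => /andP[vw vw']; apply/negP => /existsP[t wt].
have := solution_window sC wt.
by rewrite (solution_implies sC vC vw) (solution_implies sC vC vw').
Qed.

Definition greedy := foldl greedy_step set0 (enum T).

(** The result need not equal C. Each vertex of C is consistent, hence chosen or linked to a chosen
    vertex; so every window, which meets C, is hit by S, and the invariant forbids a second hit. *)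
Theorem greedy_solution : (exists C, solution C) -> solution greedy.
Proof.
case=> C sC.
pose Q (s : seq T) S := inv S /\
  {in s, forall v, [\/ v \in S, exists2 z, z \in S & linked z v | ~~ consistent v]}.
have [hS hcase] : Q (enum T) greedy.
  apply: foldl_inv => [s v s2 S _ [hS hs]|]; last first.
    by split=> //; split=> x; rewrite inE.
  split; first exact: inv_step.
  have sub : S \subset greedy_step S v.
    by rewrite /greedy_step; case: ifP => // _; apply: subsetUl.
  move=> w; rewrite mem_rcons inE => /orP[/eqP->|/hs[]].
  - rewrite {1}/greedy_step; case: ifPn => [/orP[/exists_inP[z zS lz]|nc]|_].
    + by constructor 2; exists z => //; apply: (subsetP sub).
    + by constructor 3.
    + by constructor 1; rewrite !inE; have [-> _ _ _] := Himplies; rewrite orbT.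
  - by move=> wS; constructor 1; apply: (subsetP sub).
  - by case=> z zS lz; constructor 2; exists z => //; apply: (subsetP sub).
  - by constructor 3.
move: (greedy) hS hcase => S hS hcase; have [hc hf hn] := hS.
have dicho u : u \in C -> u \in S \/ exists2 z, z \in S & linked z u.
  move=> uC; have /hcase : u \in enum T by rewrite mem_enum.
  by case; [left | right | rewrite (solution_consistent sC uC)].
have hitS a b c : window a b c -> a \in C -> hit S a b c.
  move=> hw aC; case: (dicho a aC) => [aS|[z zS lz]]; first by rewrite /hit aS.
  by apply: linked_hit lz _ _ _ hw => //; have [] := sol_in sC aC.
have forb v : forbidden v -> v \notin S by move=> h1; apply/negP => /hf; rewrite h1.
have winS a b c : window a b c -> (a \in S) + (b \in S) + (c \in S) = 1.
  move=> hw.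
  have c1 : ~~ ((a \in S) && (b \in S)).
    by apply/andP => -[aS bS]; move: (conflictW hw); apply/negP; apply: hn.
  have c2 : ~~ ((a \in S) && (c \in S)).
    rewrite window_132 in hw.
    by apply/andP => -[aS bS]; move: (conflictW hw); apply/negP; apply: hn.
  have c3 : ~~ ((b \in S) && (c \in S)).
    rewrite window_231 in hw.
    by apply/andP => -[aS bS]; move: (conflictW hw); apply/negP; apply: hn.
  have : hit S a b c.
    have := solution_window sC hw; case aC : (a \in C); first by move=> _; apply: hitS.
    case bC : (b \in C).
      rewrite window_213 in hw; have := hitS _ _ _ hw bC.
      by rewrite /hit orbCA.
    case cC : (c \in C) => // _; rewrite window_231 window_231 in hw.
    by have := hitS _ _ _ hw cC; rewrite /hit; case: (a \in S); case: (b \in S); case: (c \in S).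
  by rewrite /hit; move: c1 c2 c3; case: (a \in S); case: (b \in S); case: (c \in S).
split.
- by move=> v /hf; rewrite /forbidden !negb_or !negbK => /and4P[-> -> -> _].
- by move=> u v w uv vw; apply: winS; apply: baseW.
- move=> v hv; have [vC [u vu _]] := sol_end sC hv; split.
    by apply: forb; rewrite /forbidden; move: hv; rewrite negb_and => /orP[->|->]; rewrite ?orbT.
  exists u => //; apply: forb; rewrite /forbidden; apply/or4P; constructor 4; apply/orP; left.
  apply/existsP; exists v; rewrite msym vu /=.
  by move: hv; rewrite negb_and.
- move=> v hv; have [vC hv2 hv3] := sol_unm sC hv; split=> //; first by apply: forb; rewrite /forbidden hv.
  move=> w vw; apply: forb; rewrite /forbidden; apply/or4P; constructor 4; apply/orP; right.
  by apply/existsP; exists v; rewrite Nsym_sym vw.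
move=> u v euv nm nb.
(* If a window at x is hit by S elsewhere than in x, the vertex hit excludes x and so implies y. *)
have main x y : x \in C -> clause x y -> (x \in S) || (y \in S).
  move=> xC cl; case: (dicho x xC) => [->//|[z zS lz]].
  have [mx _ _] := sol_in sC xC.
  have [a [b wx]] := nforb_window (solution_forbidden sC xC).
  case/or3P: (linked_hit hS zS lz mx wx) => [->//|aS|bS].
    apply/orP; right; apply: inv_clause hS aS _ cl.
    by rewrite conflictC; apply: conflictW wx.
  apply/orP; right; apply: inv_clause hS bS _ cl.
  by rewrite conflictC; apply: (@conflictW _ _ a); rewrite window_132.
case/orP: (sol_clause sC euv nm nb) => hC; first by apply: main => //; rewrite /clause euv nm.
by rewrite orbC; apply: main => //; rewrite clauseC /clause euv nm.
Qed.
End Solutions.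

(** * The decision program *)

Fixpoint fors (xs : seq nat) (c : cmd) : cmd :=
  if xs is x :: xs' then For x (fors xs' c) else c.

Definition compr xs E k x y : cmd := fors xs (If E (Set_ k x y true) Skip).

Fixpoint writes c : seq nat :=
  match c with
  | Skip => [::]
  | Set_ k _ _ _ => [:: k]
  | If _ c d | Seq c d => writes c ++ writes d
  | For _ c => writes c
  end.

Section Stages.
Variable n : nat.
Implicit Types (rho : env n) (R : store n).

Lemma eval_frame c rho R k : k \notin writes c -> eval c rho R k = R k.
Proof.
elim: c rho R => [|l x y b|E c IHc d IHd|c IHc d IHd|x c IHc] rho R //=.
- by rewrite inE => kl; case: (rho x) => // i; case: (rho y) => // j; rewrite upd_ne.
- by rewrite mem_cat => /norP[hc hd]; case: ifP => _; [apply: IHc | apply: IHd].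
- by rewrite mem_cat => /norP[hc hd]; rewrite IHd ?IHc.
- move=> hc; apply: (foldl_inv1 (P := fun R' => R' k = R k)) => // i R' _ <-.
  exact: IHc.
Qed.

Fixpoint exs (xs : seq nat) (p : env n -> bool) rho : bool :=
  if xs is x :: xs' then [exists i, exs xs' p (setv rho x (Some i))] else p rho.

Lemma eval_compr xs E k x y rho R a b : k \notin batoms E ->
  eval (compr xs E k x y) rho R k a b = R k a b ||
    exs xs (fun rho => [&& beval E rho R, rho x == Some a & rho y == Some b]) rho.
Proof.
move=> kE; suff : adds (compr xs E k x y) k (fun rho R a b =>
    exs xs (fun rho => [&& beval E rho R, rho x == Some a & rho y == Some b]) rho).
  by case=> -> _; rewrite /addr setr_eq.
elim: xs => [|z xs IH]; first exact: adds_set.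
exact: (adds_for z IH).
Qed.

Lemma exists_at (Q : 'I_n -> bool) a : (forall i, Q i -> i = a) -> [exists i, Q i] = Q a.
Proof.
move=> h; apply/existsP/idP => [[i hi]|]; last by exists a.
by rewrite -(h i hi).
Qed.

Lemma some_eq (i j : 'I_n) : (Some i == Some j) = (i == j).
Proof. by rewrite (inj_eq Some_inj). Qed.

Lemma exs_const xs (p : env n -> bool) x a rho : x \notin xs ->
  exs xs (fun rho => p rho && (rho x == Some a)) rho = exs xs p rho && (rho x == Some a).
Proof.
elim: xs rho => [|z xs IH] rho //=; rewrite inE negb_or => /andP[xz /IH h].
under eq_existsb => i do rewrite h /setv (negbTE xz).
apply/existsP/andP => [[i /andP[h1 h2]]|[/existsP[i h1] h2]]; last by exists i; rewrite h1.
by split=> //; apply/existsP; exists i.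
Qed.

Lemma eq_exs xs (p q : env n -> bool) rho : p =1 q -> exs xs p rho = exs xs q rho.
Proof. by move=> e; elim: xs rho => [|z xs IH] rho //=; apply: eq_existsb => i; apply: IH. Qed.

Lemma exs_pair xs (p : env n -> bool) x y a b rho : x != y -> x \notin xs -> y \notin xs ->
  exs [:: x, y & xs] (fun rho => [&& p rho, rho x == Some a & rho y == Some b]) rho =
  exs xs p (setv (setv rho x (Some a)) y (Some b)).
Proof.
move=> xy xxs yxs; have e rho' : exs xs (fun rho => [&& p rho, rho x == Some a & rho y == Some b]) rho' =
    [&& exs xs p rho', rho' x == Some a & rho' y == Some b].
  under eq_exs => r do rewrite andbA.
  by rewrite (exs_const (fun r => p r && (r x == Some a))) // exs_const // andbA.
rewrite /=; under eq_existsb => i do under eq_existsb => j do rewrite e.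
rewrite (@exists_at _ a); last first.
  by move=> i /existsP[j /and3P[_]]; rewrite /setv (negbTE xy) eqxx some_eq => /eqP.
rewrite (@exists_at _ b); last by move=> j /and3P[_ _]; rewrite /setv eqxx some_eq => /eqP.
by rewrite /setv (negbTE xy) !eqxx !andbT.
Qed.

Lemma beval_ext E rho R R' : {in batoms E, forall k, R k = R' k} -> beval E rho R = beval E rho R'.
Proof.
elim: E => [l x y|E IH|E IHE F IHF|E IHE F IHF] /= h.
- by case: (rho x) => // i; case: (rho y) => // j; rewrite h ?mem_head.
- by rewrite IH.
- by rewrite IHE ?IHF // => k hk; apply: h; rewrite mem_cat hk ?orbT.
- by rewrite IHE ?IHF // => k hk; apply: h; rewrite mem_cat hk ?orbT.
Qed.

(** Warshall's algorithm in place, with the pivot as outermost loop variable. *)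
Definition closure k : cmd :=
  For 0 (For 1 (For 2 (If (And (Atom k 1 0) (Atom k 0 2)) (Set_ k 1 2 true) Skip))).

(** Updating in place is harmless: a pass with pivot v adds nothing to row v or column v, the only
    entries that it tests. *)
Lemma closure_pass k rho R v :
  eval (For 1 (For 2 (If (And (Atom k 1 0) (Atom k 0 2)) (Set_ k 1 2 true) Skip)))
    (setv rho 0 (Some v)) R = addr R k (fun a b => R k a v && R k v b).
Proof.
rewrite /= /setv /=; pose P a b := R k a v && R k v b.
pose f i (R0 : store n) j := if R0 k i v && R0 k v j then upd R0 k i j true else R0.
have inner i s (Q : rel 'I_n) : (forall a b, Q a b -> P a b) ->
    foldl (f i) (addr R k Q) s =
    addr R k (fun a b => Q a b || [&& a == i, b \in s & P a b]).
  elim: s Q => [|j s IH] Q hQ /=.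
    by congr addr; apply: relext => a b; rewrite andbF orbF.
  have -> : f i (addr R k Q) j = addr R k (fun a b => Q a b || [&& a == i, b == j & P a b]).
    have hiv : addr R k Q k i v = R k i v.
      rewrite /addr setr_eq; case hq : (Q i v); last by rewrite orbF.
      by have /andP[->] := hQ _ _ hq.
    have hvj : addr R k Q k v j = R k v j.
      rewrite /addr setr_eq; case hq : (Q v j); last by rewrite orbF.
      by have /andP[_ ->] := hQ _ _ hq.
    rewrite /f hiv hvj; case: ifPn => hP.
      apply: functional_extensionality => l; rewrite /addr /upd /setr.
      case: eqP => // _; rewrite eqxx; apply: relext => a b.
      case: eqP => [->|_] /=; last by rewrite orbF.
      by case: eqP => [->|_] /=; rewrite ?orbF // /P hP !orbT.
    congr addr; apply: relext => a b; case: eqP => [->|_] /=; last by rewrite orbF.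
    by case: eqP => [->|_] /=; rewrite ?orbF // /P (negbTE hP) orbF.
  rewrite IH => [|a b /orP[/hQ // | /and3P[] //]].
  congr addr; apply: relext => a b; rewrite inE.
  by case: (Q a b); case: (a == i); case: (b == j); case: (P a b); case: (b \in s).
have outer s (Q : rel 'I_n) : (forall a b, Q a b -> P a b) ->
    foldl (fun R0 i => foldl (f i) R0 (enum 'I_n)) (addr R k Q) s =
    addr R k (fun a b => Q a b || (a \in s) && P a b).
  elim: s Q => [|i s IH] Q hQ /=.
    by congr addr; apply: relext => a b; rewrite orbF.
  rewrite inner // IH => [|a b /orP[/hQ // | /and3P[] //]].
  congr addr; apply: relext => a b; rewrite inE mem_enum.
  by case: (Q a b); case: (a == i); case: (P a b); case: (a \in s).
have := @outer (enum 'I_n) (fun _ _ => false); rewrite addr0 => -> //.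
by congr addr; apply: relext => a b; rewrite mem_enum.
Qed.

Lemma eval_closure k rho R (r : rel 'I_n) : (forall a b, R k a b = (a == b) || r a b) ->
  closure_of r (eval (closure k) rho R k).
Proof.
move=> hR; rewrite /closure [eval _ _ _]/=.
pose Q (s : seq 'I_n) (R' : store n) := [/\ forall a, R' k a a, subrel r (R' k),
  forall Q : 'I_n -> 'I_n -> Prop, (forall x, Q x x) ->
    (forall x y z, Q x y -> Q y z -> Q x z) ->
    (forall x y, r x y -> Q x y) -> forall x y, R' k x y -> Q x y &
  {in s, forall v a b, R' k a v -> R' k v b -> R' k a b}].
set body := (X in foldl X).
suff : Q (enum 'I_n) (foldl body R (enum 'I_n)).
  case=> h1 h2 h3 h4; split=> //.
  by move=> y x z; apply: h4; rewrite mem_enum.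
apply: foldl_inv => [s v s2 R' _ [h1 h2 h3 h4]|]; last first.
  split=> [a|a b h|P p1 p2 p3 x y|v]; last by rewrite in_nil.
  - by rewrite hR eqxx.
  - by rewrite hR h orbT.
  - by rewrite hR => /orP[/eqP->|/p3].
have -> : body R' v = addr R' k (fun a b => R' k a v && R' k v b).
  exact: (closure_pass k rho R' v).
rewrite /Q /addr setr_eq; split=> [a|a b h|P p1 p2 p3 x y|u].
- by rewrite h1.
- by rewrite h2.
- case/orP => [|/andP[xv vy]]; first exact: h3.
  by apply: (p2 _ v); apply: (h3 P p1 p2 p3).
rewrite mem_rcons inE => /orP[/eqP->|us] a b.
  by rewrite h1 andbT orbb => -> /=; rewrite orbb => ->; rewrite orbT.
have h4u := h4 u us.
case/orP => [au|/andP[av vu]]; case/orP => [ub|/andP[uv vb]].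
- by rewrite (h4u _ _ au ub).
- by rewrite (h4u _ _ au uv) vb orbT.
- by rewrite av (h4u _ _ vu ub) orbT.
- by rewrite av vb orbT.
Qed.

(** The auction used as a proof of Koenig's theorem. Applied to the edge relation of G, it
    discharges [Hkonig] although the program never runs that auction. *)
Lemma konig_exists (h : rel 'I_n) : exists N, konig h N.
Proof.
pose R : store n := fun k => if k == 0 then h else fun _ _ => false.
have [f hk] := @eval_auction 0 1 2 3 isT n (@env0 n) R erefl erefl.
by move: hk; rewrite f //; exists (eval (auction 0 1 2 3) (@env0 n) R 1).
Qed.
End Stages.

(** * The relations and the stages of the program *)

Notation tE := 0 (only parsing).
Notation tM := 1 (only parsing).
Notation tH := 2 (only parsing).
Notation tN := 3 (only parsing).
Notation tP := 4 (only parsing).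
Notation tF := 5 (only parsing).
Notation tHM := 6 (only parsing).
Notation tHO := 7 (only parsing).
Notation tHI := 8 (only parsing).
Notation tG := 9 (only parsing).
Notation tN2 := 10 (only parsing).
Notation tP2 := 11 (only parsing).
Notation tF2 := 12 (only parsing).
Notation tNS := 13 (only parsing).
Notation tCL := 14 (only parsing).
Notation tCF := 15 (only parsing).
Notation tFB := 16 (only parsing).
Notation tL := 17 (only parsing).
Notation tI := 18 (only parsing).
Notation tNOK := 19 (only parsing).
Notation tS := 20 (only parsing).
Notation tTT := 21 (only parsing).
Notation tBAD := 22 (only parsing).
Notation tOUT := 23 (only parsing).
Notation tA2 := 24 (only parsing).
Notation tEQ := 25 (only parsing).
Notation tSS := 26 (only parsing).

Definition b_base x y z := And (Atom tM x y) (Atom tNS y z).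
Definition b_window x y z :=
  Or (b_base x y z) (Or (b_base y x z) (Or (b_base x z y)
    (Or (b_base z x y) (Or (b_base y z x) (b_base z y x))))).

Definition b_one x y z :=
  let s t := Atom tSS t t in
  Or (And (s x) (And (Not (s y)) (Not (s z))))
     (Or (And (Not (s x)) (And (s y) (Not (s z)))) (And (Not (s x)) (And (Not (s y)) (s z)))).

(** The listed disjuncts are the violations of the fields of [solution], in order, with [sol_end]
    and [sol_unm] taking two each. The base case of the fold is a failure of the comparison of |M|
    with |N|. *)
Definition b_bad :=
  let hm t := Atom tHM t t in let ho t := Atom tHO t t in let hi t := Atom tHI t t in
  let s t := Atom tSS t t in
  foldr Or (And (hm 0) (Not (Atom tA2 0 0))) [::
    And (s 0) (Not (And (hm 0) (And (ho 0) (hi 0))));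
    And (Atom tM 0 1) (And (Atom tNS 1 2) (Not (b_one 0 1 2)));
    And (Not (And (ho 0) (hi 0))) (Or (s 0) (Not (hm 0)));
    And (Not (And (ho 0) (hi 0))) (And (Atom tM 0 1) (s 1));
    And (Not (hm 0)) (Or (s 0) (Not (ho 0)));
    And (Not (hm 0)) (And (Atom tNS 0 1) (s 1));
    And (Atom tCL 0 1) (And (Not (s 0)) (Not (s 1)))].

(** Whether the current vertex is linked to the set is frozen in [tTT] before [tS] grows, so that
    the test refers to the set at the start of the round. *)
Definition greedy_cmd :=
  For 0 (Seq (compr [:: 1] (And (Atom tS 1 1) (Atom tL 1 0)) tTT 0 0)
             (compr [:: 1] (And (Not (Atom tTT 0 0)) (And (Not (Atom tNOK 0 0)) (Atom tI 0 1))) tS 1 1)).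

(* A unary predicate is stored as a matrix with constant rows. *)
Definition stages : seq cmd := [::
  compr [:: 0; 1] (And (Atom tE 0 1) (Not (Atom tM 0 1))) tH 0 1;
  auction tH tN tP tF;
  For 0 (Set_ tEQ 0 0 true);
  compr [:: 0; 7; 1] (Atom tM 0 1) tHM 0 7;
  compr [:: 0; 7; 1] (Atom tN 0 1) tHO 0 7;
  compr [:: 0; 7; 1] (Atom tN 1 0) tHI 0 7;
  compr [:: 0; 1] (And (Atom tHM 0 0) (Atom tHO 1 1)) tG 0 1;
  auction tG tN2 tP2 tF2;
  compr [:: 0; 7; 1] (Atom tN2 0 1) tA2 0 7;
  compr [:: 0; 1] (Or (Atom tN 0 1) (Atom tN 1 0)) tNS 0 1;
  compr [:: 0; 1] (And (Atom tE 0 1) (And (Not (Atom tM 0 1))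
    (Not (And (Atom tN 0 1) (Atom tN 1 0))))) tCL 0 1;
  compr [:: 0; 1; 2] (b_window 0 1 2) tCF 0 1;
  compr [:: 0; 7; 1] (Or (Not (Atom tHM 0 0)) (Or (Not (Atom tHO 0 0)) (Or (Not (Atom tHI 0 0))
    (Or (And (Atom tM 0 1) (Or (Not (Atom tHO 1 1)) (Not (Atom tHI 1 1))))
        (And (Atom tNS 0 1) (Not (Atom tHM 1 1))))))) tFB 0 7;
  compr [:: 0; 1] (Or (Atom tEQ 0 1) (Or (Atom tM 0 1)
    (And (Atom tNS 0 1) (And (Atom tHM 0 0) (Atom tHM 1 1))))) tL 0 1;
  closure tL;
  compr [:: 0; 1; 2; 3] (Or (Atom tEQ 0 1) (Or (And (b_window 0 2 3) (b_window 1 2 3))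
    (And (Atom tCF 0 2) (Atom tCL 2 1)))) tI 0 1;
  closure tI;
  compr [:: 0; 7; 1; 2] (Or (And (Atom tI 0 1) (Atom tFB 1 1))
    (And (Atom tI 0 1) (And (Atom tI 0 2) (Atom tCF 1 2)))) tNOK 0 7;
  greedy_cmd;
  compr [:: 0; 7] (Atom tS 0 0) tSS 0 7;
  compr [:: 6; 7; 0; 1; 2] b_bad tBAD 6 7;
  compr [:: 0; 1] (Atom tSS 1 1) tOUT 0 1].

Definition program := seqs stages.

Section Program.
Variables (n : nat) (e m : rel 'I_n).

Definition st i := foldl (fun R c => eval c (@env0 n) R) (store0 e m) (take i stages).
Definition fin := st (size stages).
Definition wr (s : seq cmd) := flatten (map writes s).

Lemma eval_program : eval program (@env0 n) (store0 e m) = fin.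
Proof.
rewrite /fin /st take_size /program; move: (store0 e m).
by elim: stages => //= c s IH R; rewrite IH.
Qed.

Lemma foldl_frame s R k : k \notin wr s ->
  foldl (fun R c => eval c (@env0 n) R) R s k = R k.
Proof.
elim: s R => [|c s IH] R //=; rewrite /wr /= mem_cat => /norP[hc hs].
by rewrite IH // eval_frame.
Qed.

Lemma fin_st i k : k \notin wr (drop i stages) -> fin k = st i k.
Proof.
move=> h; rewrite /fin /st take_size -{1}(cat_take_drop i stages) foldl_cat.
exact: foldl_frame.
Qed.

Lemma st0 i k : k \notin wr (take i stages) -> st i k = store0 e m k.
Proof. exact: foldl_frame. Qed.

Lemma stS i : i < size stages -> st i.+1 = eval (nth Skip stages i) (@env0 n) (st i).
Proof. by move=> h; rewrite /st (take_nth Skip) // foldl_rcons. Qed.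

Definition fresh i k := [&& 1 < k, i < size stages, k \notin wr (drop i.+1 stages) & k \notin wr (take i stages)].

Lemma fresh_st i k : fresh i k -> st i k = (fun _ _ => false) /\
  fin k = eval (nth Skip stages i) (@env0 n) (st i) k.
Proof.
case/and4P => k1 hi h1 h2; rewrite (fin_st h1) stS // (st0 h2); split=> //.
by case: k k1 {h1 h2} => [|[]].
Qed.

Lemma st_compr i xs E k x y :
  nth Skip stages i = compr [:: x, y & xs] E k x y ->
  [&& 1 < k, i < size stages, k \notin wr (take i stages) &
   [&& x != y, x \notin xs, y \notin xs, k \notin batoms E &
      all (fun t => t \notin wr (drop i stages)) (batoms E)]] ->
  st i.+1 k = fun a b => exs xs (fun rho => beval E rho fin)
                       (setv (setv (@env0 n) x (Some a)) y (Some b)).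
Proof.
move=> hi /and4P[k1 lt hk /and5P[xy xxs yxs kE /allP hE]].
rewrite stS // hi; apply: relext => a b; rewrite eval_compr // st0 // exs_pair //.
have -> : store0 e m k a b = false by case: k k1 {hi hk kE} => [|[]].
by apply: eq_exs => rho; apply: beval_ext => t /hE /fin_st.
Qed.

(** The program is essentially single-assignment: whatever a stage reads is already final. Hence the
    comprehension may be evaluated in [fin], and the side conditions are closed Booleans settled by
    computation. *)
Lemma stage_compr i xs E k x y :
  nth Skip stages i = compr [:: x, y & xs] E k x y ->
  [&& 1 < k, i < size stages, k \notin wr (take i stages) &
   [&& x != y, x \notin xs, y \notin xs, k \notin batoms E &
      all (fun t => t \notin wr (drop i stages)) (batoms E)]] ->
  k \notin wr (drop i.+1 stages) ->
  fin k = fun a b => exs xs (fun rho => beval E rho fin)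
                       (setv (setv (@env0 n) x (Some a)) y (Some b)).
Proof. by move=> hi hc hk; rewrite (fin_st hk) (st_compr hi hc). Qed.

Lemma fin_E : fin tE = e. Proof. by rewrite (@fin_st 0) // st0. Qed.
Lemma fin_M : fin tM = m. Proof. by rewrite (@fin_st 0) // st0. Qed.

Ltac stage i :=
  let c := eval cbv beta iota delta [nth stages] in (nth Skip stages i) in
  lazymatch c with
  | compr [:: _, _ & ?xs] ?E ?k ?x ?y => rewrite (@stage_compr i xs E k x y erefl isT isT)
  end; apply: relext => a b; rewrite /= /setv /=.

Ltac stage_st i :=
  let c := eval cbv beta iota delta [nth stages] in (nth Skip stages i) in
  lazymatch c with
  | compr [:: _, _ & ?xs] ?E ?k ?x ?y => rewrite (@st_compr i xs E k x y erefl isT)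
  end; rewrite /= /setv /=.

Lemma fin_H : fin tH = edge_minus e m.
Proof. by stage 0; rewrite fin_E fin_M. Qed.

Lemma fin_N : konig (edge_minus e m) (fin tN).
Proof.
have h1 : fresh 1 tN by [].
have [e0 eN] := fresh_st h1.
have [f hk] := @eval_auction tH tN tP tF isT n (@env0 n) (st 1) e0 (proj1 (@fresh_st 1 tP isT)).
by move: hk; rewrite f // -eN -(@fin_st 1 tH) // fin_H.
Qed.

Notation N := (fin tN).

Lemma fin_EQ : fin tEQ = eq_op.
Proof.
have [e0 ->] := @fresh_st 2 tEQ isT; apply: relext => a b.
have [-> _] := adds_for (n := n) 0 (@adds_set1 n tEQ 0 0).
rewrite /addr setr_eq e0 /=; apply/existsP/eqP => [[i]|->].
  by rewrite /setv /= !some_eq => /andP[/eqP<- /eqP].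
by exists b; rewrite /setv /= eqxx.
Qed.

Lemma fin_HM : fin tHM = fun a _ => has_m m a.
Proof. by stage 3; rewrite fin_M. Qed.
Lemma fin_HO : fin tHO = fun a _ => has_out N a.
Proof. by stage 4. Qed.
Lemma fin_HI : fin tHI = fun a _ => has_in N a.
Proof. by stage 5. Qed.
Lemma fin_G : fin tG = fun a b => has_m m a && has_out N b.
Proof. by stage 6; rewrite fin_HM fin_HO. Qed.

Lemma fin_N2 : konig (fun a b => has_m m a && has_out N b) (fin tN2).
Proof.
have [e0 eN] := @fresh_st 7 tN2 isT.
have [f hk] := @eval_auction tG tN2 tP2 tF2 isT n (@env0 n) (st 7) e0 (proj1 (@fresh_st 7 tP2 isT)).
by move: hk; rewrite f // -eN -(@fin_st 7 tG) // fin_G.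
Qed.

Lemma fin_A2 : fin tA2 = fun a _ => [exists b, fin tN2 a b].
Proof. by stage 8. Qed.
Lemma fin_NS : fin tNS = Nsym N.
Proof. by stage 9. Qed.
Lemma fin_CL : fin tCL = clause e m N.
Proof. by stage 10; rewrite fin_E fin_M. Qed.
Lemma fin_CF : fin tCF = conflict m N.
Proof. by stage 11; rewrite fin_M fin_NS. Qed.

(** The loops of a comprehension also range over variables that a disjunct does not mention; [a]
    shows that such a range is nonempty. *)
Lemma exists_or (p : bool) (q : pred 'I_n) (a : 'I_n) : [exists x, p || q x] = p || [exists x, q x].
Proof.
apply/existsP/orP => [[x /orP[->|h]]|[h|/existsP[x h]]]; first by left.
- by right; apply/existsP; exists x.
- by exists a; rewrite h.
by exists x; rewrite h orbT.
Qed.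

Lemma exists_or2 (p q : pred 'I_n) : [exists x, p x || q x] = [exists x, p x] || [exists x, q x].
Proof.
apply/existsP/orP => [[x /orP[h|h]]|[/existsP[x h]|/existsP[x h]]].
- by left; apply/existsP; exists x.
- by right; apply/existsP; exists x.
- by exists x; rewrite h.
by exists x; rewrite h orbT.
Qed.

Lemma fin_FB : fin tFB = fun a _ => forbidden m N a.
Proof.
stage 12; rewrite fin_M fin_NS fin_HM fin_HO fin_HI.
by rewrite !(exists_or _ _ a) exists_or2.
Qed.

Lemma fin_L : closure_of (linked1 m N) (fin tL).
Proof.
have f14 : tL \notin wr (drop 15 stages) by [].
rewrite (fin_st f14) stS //; apply: eval_closure => a b.
by stage_st 13; rewrite fin_EQ fin_M fin_NS fin_HM.
Qed.

Lemma fin_I : closure_of (implies1 e m N) (fin tI).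
Proof.
have f16 : tI \notin wr (drop 17 stages) by [].
rewrite (fin_st f16) stS //; apply: eval_closure => a b.
stage_st 15; rewrite fin_EQ fin_M fin_NS fin_CF fin_CL.
under eq_existsb => c do rewrite (exists_or _ _ a) exists_or2.
rewrite (exists_or _ _ a) exists_or2 /implies1; congr (_ || (_ || _)).
apply: eq_existsb => q; apply/existsP/idP => [[_ ->]//|h]; by exists a.
Qed.

Lemma fin_NOK : fin tNOK = fun a _ => ~~ consistent m N (fin tI) a.
Proof.
stage 17; rewrite fin_FB fin_CF /consistent negb_and !negb_forall.
under eq_existsb => c do rewrite (exists_or _ _ a).
rewrite exists_or2; congr (_ || _); apply: eq_existsb => c.
  by rewrite negb_imply negbK.
by rewrite negb_forall; apply: eq_existsb => d; rewrite negb_imply negbK andbA.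
Qed.

Definition chosen := greedy m N (fin tI) (fin tL).

Lemma fin_S x : fin tS x x = (x \in chosen).
Proof.
have [e0 ->] := @fresh_st 18 tS isT.
have [t0 _] : st 18 tTT = (fun _ _ => false) /\ True by split=> //; rewrite st0.
(* The flags [tTT] are never reset; it is enough that those of untreated vertices are clear, as each
   is read only in its own round. *)
pose Q (s : seq 'I_n) R := [/\ forall x, R tS x x = (x \in foldl (greedy_step m N (fin tI) (fin tL)) set0 s),
  forall v, v \notin s -> R tTT v v = false & {in [:: tL; tI; tNOK], forall k, R k = fin k}].
suff [h _ _] : Q (enum 'I_n) (eval greedy_cmd (@env0 n) (st 18)) by exact: h.
pose c2 := compr [:: 1] (And (Not (Atom tTT 0 0)) (And (Not (Atom tNOK 0 0)) (Atom tI 0 1))) tS 1 1.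
pose f R i := eval c2 (setv (@env0 n) 0 (Some i))
  (eval (compr [:: 1] (And (Atom tS 1 1) (Atom tL 1 0)) tTT 0 0) (setv (@env0 n) 0 (Some i)) R).
have -> : eval greedy_cmd (@env0 n) (st 18) = foldl f (st 18) (enum 'I_n) by [].
apply: foldl_inv => [s v s2 R es [hS hT hk]|]; last first.
  split=> [y|v _|k]; rewrite ?e0 ?t0 ?in_nil ?inE //.
  by case/or3P => /eqP->; rewrite -(@fin_st 18).
have vs : v \notin s.
  have : uniq (s ++ v :: s2) by rewrite -es enum_uniq.
  by rewrite cat_uniq /= => /and3P[_ /norP[]].
pose rho := setv (@env0 n) 0 (Some v).
have r0 : rho 0 = Some v by [].
pose R1 := eval (compr [:: 1] (And (Atom tS 1 1) (Atom tL 1 0)) tTT 0 0) rho R.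
have fR1 k : k != tTT -> R1 k = R k by move=> kT; rewrite /R1 eval_frame //= inE.
have hL : fin tL = R tL by rewrite hk.
have hI : fin tI = R tI by rewrite hk.
have hNOK : R tNOK = fin tNOK by rewrite hk.
have T1 a : R1 tTT a a = R tTT a a || (v == a) &&
    [exists z in foldl (greedy_step m N (fin tI) (fin tL)) set0 s, fin tL z v].
  rewrite /R1 eval_compr //; congr (_ || _); rewrite /= /setv /= hL r0.
  case: (altP (v =P a)) => [->|va]; last first.
    by apply/negbTE/existsPn => z; rewrite some_eq (negbTE va) /= andbF.
  by apply: eq_existsb => z; rewrite eqxx !andbT hS hL.
have step_eq : foldl (greedy_step m N (fin tI) (fin tL)) set0 (rcons s v) =
    greedy_step m N (fin tI) (fin tL) (foldl (greedy_step m N (fin tI) (fin tL)) set0 s) v.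
  by rewrite foldl_rcons.
have ef : f R v = eval c2 rho R1 by [].
rewrite /Q step_eq ef; split=> [y|u|k kin].
- rewrite eval_compr // fR1 // hS.
  rewrite /= /setv /= T1 hT // eqxx /= !fR1 // hNOK fin_NOK -hI.
  rewrite (@exists_at _ _ y); last by move=> z /and3P[_]; rewrite some_eq => /eqP.
  rewrite eqxx !andbT; move: (foldl _ _ _) => S0; rewrite /greedy_step.
  case: [exists z in S0, _]; first by rewrite /= orbF.
  by case: (consistent _ _ _ _); rewrite /= ?orbF // !inE.
- rewrite mem_rcons inE negb_or => /andP[uv us].
  rewrite eval_frame // T1 hT // eq_sym (negbTE uv) //.
- rewrite eval_frame ?fR1 ?hk //; move: kin; rewrite !inE;
  by case/or3P => /eqP->.
Qed.

Lemma fin_SS : fin tSS = fun a _ => a \in chosen.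
Proof. by stage 19; rewrite fin_S. Qed.

Lemma fin_OUT : fin tOUT = fun _ b => b \in chosen.
Proof. by stage 21; rewrite fin_SS. Qed.

Lemma fin_BADP i j : functional m ->
  ~~ fin tBAD i j <-> (forall x, has_m m x -> [exists b, fin tN2 x b]) /\ solution e m N chosen.
Proof.
move=> fm.
rewrite (@stage_compr 20 [:: 0; 1; 2] b_bad tBAD 6 7 erefl isT isT) /= /setv /=.
rewrite fin_HM fin_HO fin_HI fin_SS fin_NS fin_M fin_CL fin_A2; split.
  move/existsPn => hb.
  have {}hb x y z := existsPn (existsPn (hb x) y) z.
  have one (s t u : bool) : [|| s && (~~ t && ~~ u), ~~ s && (t && ~~ u) | ~~ s && (~~ t && u)] ->
    s + t + u = 1 by case: s; case: t; case: u.
  have h1 x y z : [/\ (x \in chosen -> [/\ has_m m x, has_out N x & has_in N x]),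
      (m x y -> Nsym N y z -> (x \in chosen) + (y \in chosen) + (z \in chosen) = 1),
      (~~ (has_out N x && has_in N x) -> [/\ x \notin chosen, has_m m x & m x y -> y \notin chosen]),
      (~~ has_m m x -> [/\ x \notin chosen, has_out N x & Nsym N x y -> y \notin chosen]) &
      (clause e m N x y -> (x \in chosen) || (y \in chosen)) /\
      (has_m m x -> [exists b, fin tN2 x b])].
    have /norP[b1 /norP[b2 /norP[b3 /norP[b4 /norP[b5 /norP[b6 /norP[b7 b8]]]]]]] := hb x y z.
    split.
    - by move=> xC; move: b1; rewrite xC /= negbK => /and3P.
    - by move=> xy yz; apply: one; move: b2; rewrite xy yz /= negbK.
    - move=> ho; move: b3 b4; rewrite ho /= negb_or negbK => /andP[-> ->] h4.
      by split=> // xy; move: h4; rewrite xy.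
    - move=> hm; move: b5 b6; rewrite hm /= negb_or negbK => /andP[-> ->] h4.
      by split=> // xy; move: h4; rewrite xy.
    split=> [xy|hm]; first by move: b7; rewrite xy /= -negb_or negbK.
    by move: b8; rewrite hm /= negbK.
  split=> [x|]; first by have [_ _ _ _ []] := h1 x x x.
  split.
  - by move=> v; have [] := h1 v v v.
  - by move=> u v w; have [] := h1 u v w.
  - move=> v hv; have [_ _ /(_ hv) [vC hm _] _ _] := h1 v v v; split=> //.
    by have /existsP[u vu] := hm; exists u => //; have [_ _ /(_ hv) [_ _ ->]] := h1 v u u.
  - move=> v hv; have [_ _ _ /(_ hv) [vC ho _] _] := h1 v v v; split=> // w vw.
    by have [_ _ _ /(_ hv) [_ _ ->]] := h1 v w w.
  move=> u v euv nm nb; have [_ _ _ _ [hc _]] := h1 u v v; apply: hc.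
  by rewrite /clause euv nm nb.
case=> hA sC; apply/existsPn => x; apply/existsPn => y; apply/existsPn => z.
apply/norP; split.
  by apply/negP => /andP[xC]; have [-> -> ->] := sol_in sC xC.
apply/norP; split.
  apply/negP => /andP[xy /andP[yz]]; have := sol_window sC xy yz.
  by case: (x \in _); case: (y \in _); case: (z \in _).
apply/norP; split.
  apply/negP => /andP[/(sol_end sC)[/negbTE-> [u xu _]]] /=.
  by rewrite (has_mW xu).
apply/norP; split.
  apply/negP => /andP[/(sol_end sC)[_ [u xu uC]] /andP[xy yC]].
  by rewrite (fm _ _ _ xu xy) yC in uC.
apply/norP; split.
  by apply/negP => /andP[/(sol_unm sC)[/negbTE-> -> _]].
apply/norP; split.
  by apply/negP => /andP[/(sol_unm sC)[_ _ h] /andP[/h/negbTE->]].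
apply/norP; split.
  apply/negP => /andP[/and3P[h1 h2 h3]].
  by have /orP[->|->] := sol_clause sC h1 h2 h3; rewrite ?andbF.
by apply/negP => /andP[/hA ->].
Qed.

(** * Correctness of the computed answer *)

Hypothesis Hvalid : valid_input e m.
Let Hsimple : simple_graph e. Proof. by case: Hvalid. Qed.
Let Hbip : bipartite e. Proof. by case: Hvalid => _ []. Qed.
Let Hmax : max_matching e m. Proof. by case: Hvalid => _ []. Qed.

Lemma matching_functional : functional m.
Proof.
move=> x y z hy hz; case: Hmax => -[_ [_ /(_ x) c1]] _.
by apply: (card_le1_eqP c1); rewrite inE.
Qed.

(** Cardinalities are compared through the complete bipartite relation between M-covered vertices
    and N-sources: a vertex cover of it contains all rows or all columns, so the second auction
    saturates the rows as soon as there are enough columns. *)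
Lemma matched_le : (forall x, has_m m x -> [exists b, fin tN2 x b]) <-> npairs m <= npairs N.
Proof.
have [[fN iN] _ _] := fin_N; have [[f2 i2] s2 [A [B [hc le]]]] := fin_N2.
rewrite (npairs_source matching_functional) (npairs_target iN); split=> [h|h].
  apply: leq_trans (_ : #|source (fin tN2)| <= _).
    by apply: subset_leq_card; apply/subsetP => x; rewrite !inE => /h.
  rewrite -npairs_source // npairs_target // -(npairs_target iN) npairs_source //.
  apply: subset_leq_card; apply/subsetP => y; rewrite !inE => /existsP[x /s2 /andP[_]].
  by [].
have s2m : source (fin tN2) \subset source m.
  by apply/subsetP => x; rewrite !inE => /existsP[y /s2 /andP[]].
have cm : #|source m| <= #|source (fin tN2)|.
  rewrite -(npairs_source f2); apply: leq_trans le.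
  case: (boolP (source m \subset A)) => [/subset_leq_card sA|/subsetPn[x0 x0m x0A]].
    exact: leq_trans sA (leq_addr _ _).
  have sB : source N \subset B.
    apply/subsetP => y yO; have : (x0 \in A) || (y \in B).
      by apply: hc; rewrite inE in x0m; rewrite inE in yO; rewrite /has_m /has_out x0m.
    by rewrite (negbTE x0A).
  apply: leq_trans h _; rewrite -npairs_target // npairs_source //.
  exact: leq_trans (subset_leq_card sB) (leq_addl _ _).
have e2 : source (fin tN2) = source m by apply/eqP; rewrite eqEcard s2m.
move=> x hx; have : x \in source m by rewrite inE.
by rewrite -e2 inE.
Qed.

(** From left to right a verified solution is a certificate in itself; the completeness of the
    greedy choice serves only the converse. *)
Lemma chosen_correct : (npairs m <= npairs N /\ solution e m N chosen) <->
  3 * diss e = 4 * alpha (edge_minus e m).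
Proof.
split=> [[np sC]|eq].
  have [hD eD] := diss_of_solution Hsimple Hbip Hmax fin_N (konig_exists e) np sC.
  have := diss_le_alpha Hsimple Hbip Hmax (konig_exists e).
  by have := diss_le hD; lia.
have [D hD eD] := diss_witness e.
have [|np sC] := solution_of_diss Hsimple Hbip Hmax fin_N (konig_exists e) hD; first by rewrite eD.
split=> //; apply: (greedy_solution Hsimple Hmax fin_I fin_L).
by exists (~: D).
Qed.

Lemma out_decide : out_bits true fin tBAD = [:: 3 * diss e == 4 * alpha (edge_minus e m)].
Proof.
rewrite /out_bits; congr [:: _]; apply/forallP/eqP => [h|eq j].
  apply/chosen_correct; rewrite -matched_le.
  (* For n = 0 there is no entry of [tBAD] to consult, and both conditions hold vacuously. *)
  case: (posnP n) => [n0|npos].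
    have no (x : 'I_n) : False by have := leq_ltn_trans (leq0n x) (ltn_ord x); rewrite lt0n; lia.
    split; first by move=> x; case: (no x).
    by split=> v; case: (no v).
  pose o := Ordinal npos; apply/(fin_BADP o o matching_functional).
  by have /forallP/(_ o) := implyP (h o) erefl.
apply/implyP => _; apply/forallP => i; apply/implyP => _.
by apply/(fin_BADP i j matching_functional); rewrite matched_le; apply/chosen_correct.
Qed.

Lemma out_search : out_bits false fin tOUT = enc_set (~: chosen).
Proof.
rewrite /out_bits /enc_set; apply: eq_map => j; rewrite /out_bit fin_OUT inE.
apply/forallP/idP => [h|h i]; last by rewrite h implybT.
have npos : 0 < n by apply: leq_ltn_trans (ltn_ord j).
by have := h (Ordinal npos).
Qed.
End Program.

Theorem theorem1 :
  (exists (T : TM) (c k : nat),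
     forall (n : nat) (e m : rel 'I_n), valid_input e m ->
       computes_within T (enc e m) (c * (size (enc e m)).+1 ^ k)
         [:: 3 * diss e == 4 * alpha (edge_minus e m)])
  /\
  (exists (T : TM) (c k : nat),
     forall (n : nat) (e m : rel 'I_n), valid_input e m ->
       3 * diss e = 4 * alpha (edge_minus e m) ->
       exists I : {set 'I_n}, max_dissociation_set e I /\
         computes_within T (enc e m) (c * (size (enc e m)).+1 ^ k) (enc_set I)).
Proof.
(* The relations are numbered 0 to 26 and the variables 0 to 7. *)
have wfp : wf 27 8 program by [].
split.
  have [T [c [k hT]]] := @lang_computable 27 8 true tBAD program isT erefl wfp.
  exists T, c, k => n e m hv.
  by have := hT n e m; rewrite eval_program out_decide.
have [T [c [k hT]]] := @lang_computable 27 8 false tOUT program isT erefl wfp.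
exists T, c, k => n e m hv eq; exists (~: chosen e m); split; last first.
  by have := hT n e m; rewrite eval_program out_search.
have [hs [hb hm]] := hv.
have [np sC] := (chosen_correct hv).2 eq.
have [hD eD] := diss_of_solution hs hb hm (fin_N e m) (konig_exists e) np sC.
by split=> //; move: eD; rewrite -eq; lia.
Qed.
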